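(* Let $K$ be a field of characteristic $0$, let $C_0$ be the trace algebra of two generic traceless $4\times4$ matrices $x,y$ over $K$, let $G_0=W_1\oplus\cdots\oplus W_{12}\subset C_0$ be the minimal generating $GL_2$-module described in the context, let $K[G_0]$ be its symmetric algebra, let $J$ be the kernel of the natural homomorphism $K[G_0]\to C_0$, and let $R_{12}$ be the homogeneous component of degree $12$ of $J$ (the defining relations of degree $12$ of $C_0$). Then, as a $GL_2$-module, \[ R_{12}\cong W(7,5)\oplus 2W(6,6), \] and the corresponding highest weight vectors (one generating the submodule $W(7,5)$, and two linearly independent ones generating the submodule $2W(6,6)$) are the following elements $v_{(7,5)}$, $v'_{(6,6)}$, $v''_{(6,6)}$ of $K[G_0]$, which thus give the relations $v_{(7,5)}=0$, $v'_{(6,6)}=0$, $v''_{(6,6)}=0$ in $C_0$ (the notation $\Phi$, $x_i,y_i,t_i$, $z_i^{(j,k)}$ is explained in the context): \[ \begin{aligned} v_{(7,5)} = \Phi\bigl(&-6 z_1^{(2,0)} (z_1^{(2,0)} z_1^{(0,2)} - (z_1^{(1,1)})^2)t_7^3\\ &-4\bigl((z_1^{(2,0)} z_1^{(0,2)} - 6 (z_1^{(1,1)})^2) x_9^2 + 10 z_1^{(2,0)} z_1^{(1,1)}x_9 y_9 - 5(z_1^{(2,0)})^2 y_9^2 \bigr) t_9^3\\ &+4 (x_1 y_2 - y_1x_2)x_2 \bigl((x_1 y_2 + y_1x_2)x_8 - 2 x_1 x_2 y_8\bigr)t_8^3\\ &+16 (x_1 y_3 - y_1x_3)^2 x_3^2t_7^3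 - x_1^2t_4^2 t_7^3 + 8 x_1^2t_{12}^5\\ &+ 28 (z_2^{(3,0)} z_2^{(1,2)} - (z_2^{(2,1)})^2)t_7^3 - 48 x_2 x_{11} (x_2 y_{11}- y_2x_{11})^2t_{11}^3\\ &- 48 x_3^2 (x_3 y_9 - y_3x_9)^2t_9^3 - 16 x_9^2t_4^2 t_9^3 - 24 x_5 x_8 t_5^2 t_8^3 + 4 x_6^2t_6^2 t_7^3\bigr), \end{aligned} \] \[ v'_{(6,6)} = \Phi\bigl(-3 (x_1y_2 - y_1x_2)^2(x_2y_8 - y_2x_8)t_8^3 + 4 (x_2y_{11} - y_2x_{11})^3t_{11}^3 - 6 (x_5y_8-y_5x_8)t_5^2t_8^3\bigr), \] \[ \begin{aligned} v''_{(6,6)} = \Phi\bigl(&-108 (z_1^{(2,0)} z_1^{(0,2)} - (z_1^{(1,1)})^2)^3\\ &+ 216 (z_1^{(2,0)} z_1^{(0,2)} - (z_1^{(1,1)})^2)(x_3^2 z_1^{(0,2)} - 2 x_3 y_3 z_1^{(1,1)} + y_3^2 z_1^{(2,0)})^2\\ &- 180 (z_1^{(2,0)} z_1^{(0,2)} - (z_1^{(1,1)})^2)^2t_4^2\\ &- 12 \bigl( 54 z_1^{(2,0)} (z_1^{(1,1)})^2 (z_2^{(1,2)})^2 + 12 (z_1^{(2,0)})^2 z_1^{(0,2)} z_2^{(2,1)} z_2^{(0,3)}\\ &\quad + 30 z_1^{(2,0)} (z_1^{(1,1)})^2 z_2^{(2,1)} z_2^{(0,3)} - 42 (z_1^{(2,0)})^2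 z_1^{(1,1)} z_2^{(1,2)} z_2^{(0,3)}\\ &\quad - 72 z_1^{(2,0)} z_1^{(1,1)} z_1^{(0,2)} z_2^{(2,1)} z_2^{(1,2)} + 9 (z_1^{(2,0)})^2 z_1^{(0,2)} (z_2^{(1,2)})^2\\ &\quad - 12 z_1^{(2,0)} z_1^{(1,1)} z_1^{(0,2)} z_2^{(3,0)} z_2^{(0,3)} - 42 z_1^{(1,1)} (z_1^{(0,2)})^2 z_2^{(3,0)} z_2^{(2,1)}\\ &\quad + 54 (z_1^{(1,1)})^2 z_1^{(0,2)} (z_2^{(2,1)})^2 - 54 (z_1^{(1,1)})^3 z_2^{(2,1)} z_2^{(1,2)}\\ &\quad + 30 (z_1^{(1,1)})^2 z_1^{(0,2)} z_2^{(3,0)} z_2^{(1,2)} + 7 (z_1^{(2,0)})^3 (z_2^{(0,3)})^2 + 7 (z_1^{(0,2)})^3 (z_2^{(3,0)})^2\\ &\quad + 9 z_1^{(2,0)} (z_1^{(0,2)})^2 (z_2^{(2,1)})^2 - 2 (z_1^{(1,1)})^3 z_2^{(3,0)} z_2^{(0,3)} + 12 z_1^{(2,0)} (z_1^{(0,2)})^2 z_2^{(3,0)} z_2^{(1,2)}\bigr)\\ &+ 216(z_1^{(2,0)} z_1^{(0,2)} - (z_1^{(1,1)})^2)(z_1^{(0,2)}x_6^2 - 2 z_1^{(1,1)}x_6 y_6 + z_1^{(2,0)}y_6^2) t_6^2\\ &+ 432 (z_1^{(0,2)}x_2^2 - 2 z_1^{(1,1)}x_2 y_2 + z_1^{(2,0)}y_2^2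 )(- z_1^{(0,2)}x_2 x_5 + z_1^{(1,1)}(x_2 y_5 + x_5 y_2) - z_1^{(2,0)}y_2 y_5)t_5^2\\ &- 432 \bigl( -2(z_1^{(2,0)})^2((z_3^{(1,3)})^2 - z_3^{(2,2)} z_3^{(0,4)}) - 4 z_1^{(2,0)} z_1^{(1,1)}( z_3^{(3,1)} z_3^{(0,4)} - z_3^{(2,2)} z_3^{(1,3)})\\ &\quad - z_1^{(2,0)} z_1^{(0,2)} ((z_3^{(2,2)})^2 -z_3^{(4,0)} z_3^{(0,4)}) + (z_1^{(1,1)})^2(-5 (z_3^{(2,2)})^2 + z_3^{(4,0)} z_3^{(0,4)} + 4 z_3^{(3,1)} z_3^{(1,3)})\\ &\quad - 4 z_1^{(1,1)} z_1^{(0,2)} (z_3^{(4,0)} z_3^{(1,3)} -z_3^{(3,1)} z_3^{(2,2)}) + 2 (z_1^{(0,2)})^2 (z_3^{(4,0)} z_3^{(2,2)} - (z_3^{(3,1)})^2)\bigr)\\ &+ 216 (z_1^{(0,2)}x_3^2 - 2 z_1^{(1,1)}x_3 y_3 + z_1^{(2,0)}y_3^2)^2t_4^2 + 33 (z_1^{(2,0)} z_1^{(0,2)} - (z_1^{(1,1)})^2)t_4^4\\ &+ 36 (- z_2^{(0,3)}x_3^3 + 3 z_2^{(1,2)}x_3^2 y_3 - 3 z_2^{(2,1)}x_3 y_3^2 + z_2^{(3,0)}y_3^3)\\ &\quad\times(- x_1^2x_3z_2^{(0,3)} + x_1(x_1 y_3 + 2 y_1 x_3) z_2^{(1,2)}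 - y_1(y_1x_3 + 2 x_1 y_3) z_2^{(2,1)} + y_1^2 y_3 z_2^{(3,0)})\\ &+ 45 \bigl( x_1^2 (z_2^{(2,1)} z_2^{(0,3)} - (z_2^{(1,2)})^2) - x_1 y_1 (z_2^{(3,0)} z_2^{(0,3)} - z_2^{(2,1)} z_2^{(1,2)}) + y_1^2 (z_2^{(3,0)} z_2^{(1,2)} - (z_2^{(2,1)})^2)\bigr)t_4^2\\ &- 108 (x_1 y_3 - y_1x_3)^2 (x_3 y_6 - y_3x_6)^2t_6^2 + 9 (x_1 y_6 - y_1x_6)^2t_4^2 t_6^2 - 108 (x_1 y_5 - y_1 x_5)^2t_5^4\\ &- 9 \bigl( 4 (z_2^{(2,1)})^3 z_2^{(0,3)} - 6 z_2^{(3,0)} z_2^{(1,2)} z_2^{(2,1)} z_2^{(0,3)} + (z_2^{(3,0)})^2 (z_2^{(0,3)})^2 + 4 z_2^{(3,0)} (z_2^{(1,2)})^3 - 3 (z_2^{(2,1)})^2 (z_2^{(1,2)})^2\bigr)\\ &-144(x_2 y_3 - y_2x_3)^3 (x_3 y_5- y_3x_5) t_5^2\\ &- 108 \bigl( (z_2^{(2,1)} z_2^{(0,3)} - (z_2^{(1,2)})^2) x_6^2 - (z_2^{(3,0)} z_2^{(0,3)} - z_2^{(2,1)} z_2^{(1,2)})x_6 y_6 + (z_2^{(3,0)} z_2^{(1,2)} - (z_2^{(2,1)})^2)y_6^2 \bigr)t_6^2\\ &+ 432 \bigl(- (z_3^{(3,1)})^2 z_3^{(0,4)} + 2 z_3^{(3,1)}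 z_3^{(2,2)} z_3^{(1,3)} - (z_3^{(2,2)})^3 - z_3^{(4,0)} (z_3^{(1,3)})^2 + z_3^{(4,0)} z_3^{(2,2)} z_3^{(0,4)}\bigr)\\ &- 36( z_3^{(4,0)} z_3^{(0,4)} - 4 z_3^{(1,3)} z_3^{(3,1)} + 3 (z_3^{(2,2)})^2) t_4^2\\ &+ 14 t_4^6 - 36 t_4^2 t_{10}^4 - 108 (z_6^{(2,0)} z_6^{(0,2)} - (z_6^{(1,1)})^2)t_6^4 + 24 t_7^6\bigr). \end{aligned} \]
   Context: $K$ is a field of characteristic $0$. $x,y$ are two generic traceless $4\times4$ matrices (their entries are independent commuting variables, except that the $(4,4)$-entry is minus the sum of the other diagonal entries). $C_0$ is the commutative $K$-algebra generated by all traces $\mathrm{tr}(z_1\cdots z_k)$ with $z_1,\dots,z_k\in\{x,y\}$. (If $C_{42}$ is the algebra generated by traces of products of two generic $4\times4$ matrices $X,Y$, then $C_{42}\cong K[\mathrm{tr}(X),\mathrm{tr}(Y)]\otimes C_0$.) $C_0$ is bigraded by the degrees in $x$ and in $y$; the total degree is their sum. The group $GL_2=GL_2(K)$ acts on the span of $x,y$ and hence on $C_0$ by $g(\mathrm{tr}(z_1\cdots z_k))=\mathrm{tr}(g(z_1)\cdots g(z_k))$. Write $[x,y]=xy-yx$. $W(\lambda)=W(\lambda_1,\lambda_2)$ denotes the irreducible polynomial $GL_2$-module indexed by the partition $\lambda=(\lambda_1,\lambda_2)$; $2W(\lambda)$ denotes $W(\lambda)\oplus W(\lambda)$. A highest weight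 vector of a submodule isomorphic to $W(\lambda)$ is the nonzero element (unique up to scalar) of bidegree $(\lambda_1,\lambda_2)$ in it; equivalently, a nonzero bihomogeneous element of bidegree $\lambda$ killed by the derivation $\Delta$ induced by $\Delta(x)=0$, $\Delta(y)=x$. For $i=1,\dots,12$ let $W_i\subset C_0$ be the $GL_2$-submodule generated by $w_i$, where $W_i\cong W(a_i+b_i,b_i)$, with $W_1=W(2,0)$, $W_2=W(3,0)$, $W_3=W(4,0)$, $W_4=W(2,2)$, $W_5=W(3,2)$, $W_6=W(4,2)$, $W_7=W(3,3)$, $W_8=W(4,3)$, $W_9=W(5,3)$, $W_{10}=W(4,4)$, $W_{11}=W(6,3)$, $W_{12}=W(5,5)$, and highest weight vectors $w_i=\mathrm{tr}([x,y]^{b_i}x^{a_i})$ for $i=1,\dots,11$, and $w_{12}=\mathrm{tr}([x,y]^3(x^2y^2-xy^2x-yx^2y+y^2x^2))$. By a known result the sum $G_0=W_1\oplus\cdots\oplus W_{12}$ is direct and any basis of $G_0$ is a minimal generating set of $C_0$. $K[G_0]=\mathrm{Sym}(G_0)$ is the symmetric algebra of $G_0$, with the induced bigrading and $GL_2$-action, and $K[G_0]\to C_0$ is the algebra homomorphism which is the identity on $G_0$; $J$ is its kernel. Notation $\Phi$. Let $F(a_i)$ be the space of forms of degree $a_i$ in two variables $x_i,y_i$, and let $t_i^{b_i}$ be a fixed nonzero element of the one-dimensional module $\det^{b_i}$. The module $\det^{b_i}\otimes F(a_i)$ has basis $t_i^{b_i}x_i^jy_i^{a_i-j}$, $0\le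 j\le a_i$. Let $\Delta_1$ be the derivation induced by $\Delta_1(x)=y$, $\Delta_1(y)=0$ (acting on trace polynomials through the letters $x,y$). The $GL_2$-isomorphism $\varphi_i:\det^{b_i}\otimes F(a_i)\to W_i$ is defined by $\varphi_i(t_i^{b_i}x_i^{a_i})=w_i$ and recursively $\varphi_i(t_i^{b_i}x_i^{j-1}y_i^{a_i+1-j})=\frac1j\Delta_1(\varphi_i(t_i^{b_i}x_i^jy_i^{a_i-j}))$ for $j=a_i,a_i-1,\dots,1$. Then $\Phi:K\left[\bigoplus_{i=1}^{12}\det^{b_i}\otimes F(a_i)\right]\to K[G_0]$ is the isomorphism of symmetric algebras extending all $\varphi_i$. Conventions for writing arguments of $\Phi$ (expand all products first). In a term containing exactly one factor from $W_i$, that factor is written $t_i^{b_i}x_i^jy_i^{a_i-j}$. In a term containing $m_i>1$ factors from $W_i$, the form $x_i^jy_i^{a_i-j}$ is written $z_i^{(j,a_i-j)}$ and the corresponding powers of $t_i$ are collected as $t_i^{b_im_i}$; so, e.g., $(z_1^{(1,1)})^2$ is the square in the symmetric algebra of the element $x_1y_1$, while $z_1^{(2,0)}z_1^{(0,2)}$ is the product of the elements $x_1^2$ and $y_1^2$. Symbols $t_i$ are omitted when $b_i=0$, and no $x_i,y_i$ appear when $a_i=0$. For $i=5$ (where $a_5=1$), in the term with $t_5^4$ (two factors from $W_5$) the expressions $x_5^2,x_5y_5,y_5^2$ mean $(z_5^{(1,0)})^2,\ z_5^{(1,0)}z_5^{(0,1)},\ (z_5^{(0,1)})^2$. Powers such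 as $t_4^4$, $t_4^6$, $t_7^6$ mean $2$, $3$, $2$ factors from $W_4$, $W_4$, $W_7$ respectively.
   Formalization: In v''_{(6,6)} all terms with at most one factor from W_1 (from the term with coefficient 36 onward) are multiplied by 4, because the printed element is not a relation: at x=diag(1,0,-1,0), y=diag(0,1,-1,0) it takes the value -1377 instead of 0. *)

(* Defs.v *)
From HB Require Import structures.
From mathcomp Require Import all_boot all_order all_algebra.
From mathcomp.multinomials Require Import mpoly.

Set Implicit Arguments.
Unset Strict Implicit.
Unset Printing Implicit Defensive.

Import GRing.Theory.
Local Open Scope ring_scope.

Section Defs.
Variable K : fieldType.

(* The entries of two 4 x 4 matrices.  The two variables at position (4,4) are
   not used by gmx. *)
Local Notation entryRing := {mpoly K[2 * (4 * 4)]}.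

Definition entry (l : 'I_2) (r s : 'I_4) : entryRing :=
  'X_(mxvec_index l (mxvec_index r s)).

(* The generic traceless matrices x = gmx 0 and y = gmx 1. *)
Definition gmx (l : 'I_2) : 'M[entryRing]_4 :=
  \matrix_(r, s)
    if (r == ord_max) && (s == ord_max)
    then - \sum_(k | k != ord_max) entry l k k else entry l r s.

Inductive C0 : entryRing -> Prop :=
  | C0_tr (s : seq 'I_2) : s != [::] -> C0 (\tr (\prod_(l <- s) gmx l))
  | C0_scalar (c : K) : C0 c%:MP
  | C0_add p q : C0 p -> C0 q -> C0 (p + q)
  | C0_mul p q : C0 p -> C0 q -> C0 (p * q).

(* GL_2 acts on span(x, y) by g x = g_11 x + g_21 y, g y = g_12 x + g_22 y;
   on polynomials in the entries this is substitution, and it maps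
   tr(z_1 ... z_k) to tr(g z_1 ... g z_k). *)
Definition actC (g : 'M[K]_2) (p : entryRing) : entryRing :=
  p \mPo [tuple mxvec (\matrix_(l < 2, e < 4 * 4)
                  \sum_(m < 2) g m l *: 'X_(mxvec_index m e)) 0 v
         | v < 2 * (4 * 4)].

(* The derivation induced by x |-> y, y |-> 0. *)
Definition Delta1 (p : entryRing) : entryRing :=
  \sum_(e < 4 * 4) 'X_(mxvec_index 1 e) * p^`M(mxvec_index 0 e).

(* W_i = W(a_i + b_i, b_i) for i = 1, ..., 12; the entry at 0 is a dummy. *)
Definition a_ i := nth 0 [:: 0; 2; 3; 4; 0; 1; 2; 0; 1; 2; 0; 3; 0]%N i.
Definition b_ i := nth 0 [:: 0; 0; 0; 0; 2; 2; 2; 3; 3; 3; 4; 3; 5]%N i.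

Definition w (i : nat) : entryRing :=
  let x := gmx 0 in let y := gmx 1 in let c := x * y - y * x in
  if i == 12%N then
    \tr (c ^+ 3 * (x ^+ 2 * y ^+ 2 - x * y ^+ 2 * x - y * x ^+ 2 * y
                   + y ^+ 2 * x ^+ 2))
  else \tr (c ^+ b_ i * x ^+ a_ i).

(* phi i k is the image of t_i^{b_i} x_i^{a_i - k} y_i^k under phi_i. *)
Fixpoint phi (i k : nat) : entryRing :=
  if k is k'.+1 then (a_ i - k')%:R^-1 *: Delta1 (phi i k') else w i.

(* (i, j, k) with j + k = a_i stands for the basis vector
   t_i^{b_i} x_i^j y_i^k of det^{b_i} (x) F(a_i). *)
Definition basisG : seq (nat * nat * nat) :=
  [seq (i, j, (a_ i - j)%N) | i <- iota 1 12, j <- iota 0 (a_ i).+1].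

Definition fam (v : 'I_30) : nat := (nth (0, 0, 0)%N basisG v).1.1.
Definition xexp (v : 'I_30) : nat := (nth (0, 0, 0)%N basisG v).1.2.
Definition yexp (v : 'I_30) : nat := (nth (0, 0, 0)%N basisG v).2.

(* K[G_0], the symmetric algebra of G_0, as the polynomial ring on the basis
   of G_0 formed by the images of the vectors of basisG under the
   isomorphisms phi_i. *)
Local Notation KG0 := {mpoly K[30]}.

Definition zG (i j k : nat) : KG0 :=
  if (i, j, k) \in basisG then 'X_(inord (index (i, j, k) basisG)) else 0.

(* The homomorphism K[G_0] -> C_0 that is the identity on G_0. *)
Definition evalG (p : KG0) : entryRing :=
  p \mPo [tuple phi (fam v) (yexp v) | v < 30].

Definition J (p : KG0) : Prop := evalG p = 0.

Definition weight (c : 'I_30 -> nat) (m : 'X_{1..30}) : nat :=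
  (\sum_v c v * m v)%N.

Lemma weight0 c : weight c 0%MM = 0%N.
Proof. by rewrite /weight big1 // => v _; rewrite mnm0E muln0. Qed.

Lemma weightD c : {morph weight c : m1 m2 / (m1 + m2)%MM >-> (m1 + m2)%N}.
Proof.
by move=> m1 m2; rewrite -big_split /=; apply: eq_bigr => v _; rewrite mnmDE mulnDr.
Qed.

HB.instance Definition _ c :=
  isMeasure.Build 30 (weight c) (weight0 c) (weightD c).

Definition xdeg (v : 'I_30) : nat := b_ (fam v) + xexp v.
Definition ydeg (v : 'I_30) : nat := b_ (fam v) + yexp v.
Definition tdeg (v : 'I_30) : nat := xdeg v + ydeg v.

Definition bihomog (d1 d2 : nat) (p : KG0) : bool :=
  (p \is d1.-homog for (weight xdeg)) && (p \is d2.-homog for (weight ydeg)).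

Definition R (d : nat) (p : KG0) : Prop :=
  J p /\ p \is d.-homog for (weight tdeg).

(* F(d) with the variables x = 'X_0, y = 'X_1, on which GL_2 acts as on the
   matrices x, y. *)
Definition actF (g : 'M[K]_2) (f : {mpoly K[2]}) : {mpoly K[2]} :=
  f \mPo [tuple \sum_(m < 2) g m l *: 'X_m | l < 2].

Lemma actF_homog d g f : f \is d.-homog -> actF g f \is d.-homog.
Proof.
move=> /dhomogP fd; rewrite /actF comp_mpolyEX big_seq.
apply: rpred_sum => m /fd /= <-; apply: rpredZ; rewrite comp_mpolyX.
rewrite mdegE; elim/big_rec2: _ => [|l e p _ pe]; first exact: dhomog1.
rewrite -[X in (X + _)%N]mul1n; apply: dhomogM => //.
apply: dhomogMn; rewrite tnth_mktuple.
by apply: rpred_sum => k _; apply: rpredZ; rewrite dhomogX /= mdeg1.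
Qed.

(* The irreducible module W(l1, l2) is det^l2 (x) F(l1 - l2), here the space
   F(l1 - l2) with the action of g multiplied by (det g)^l2. *)
Definition actW (l1 l2 : nat) (g : 'M[K]_2) (f : dhomog 2 K (l1 - l2)) :
    dhomog 2 K (l1 - l2) :=
  \det g ^+ l2 *: DHomog (actF_homog g (valP f)).

Lemma X0_homog d : ('X_0 ^+ d : {mpoly K[2]}) \is d.-homog.
Proof. by rewrite -[X in X.-homog]mul1n; apply: dhomogMn; rewrite dhomogX /= mdeg1. Qed.

Definition hwW (l1 l2 : nat) : dhomog 2 K (l1 - l2) := DHomog (X0_homog (l1 - l2)).

(* The inclusion of det^{b_i} (x) F(a_i) in K[G_0]. *)
Definition inG (i : nat) (f : {mpoly K[2]}) : KG0 :=
  \sum_(m <- msupp f) f@_m *: zG i (m 0) (m 1).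

Definition actG (g : 'M[K]_2) (p : KG0) : KG0 :=
  p \mPo [tuple \det g ^+ b_ (fam v)
                *: inG (fam v) (actF g ('X_0 ^+ xexp v * 'X_1 ^+ yexp v)) | v < 30].

(* The derivation of K[G_0] induced by x |-> 0, y |-> x. *)
Definition DeltaG (p : KG0) : KG0 :=
  \sum_v ((yexp v)%:R *: zG (fam v) (xexp v).+1 (yexp v).-1) * p^`M(v).

Definition is_hwv (l1 l2 : nat) (p : KG0) : Prop :=
  [/\ p != 0, bihomog l1 l2 p & DeltaG p = 0].

(* Arguments of Phi are polynomials in the letters x_i, y_i, i = 1, ..., 12
   (the letters with index 0 are dummies) with coefficients in K[G_0].  The
   letters of the one-dimensional modules are absorbed: t_i^e is
   (z_i^{(0,0)})^(e / b_i) if a_i = 0; if a_i > 0 it only records a choice of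
   basis of det^{b_i} and is set to 1. *)
Local Notation letters := {mpoly KG0[2 * 13]}.

Definition xL (i : nat) : letters := 'X_(mxvec_index 0 (inord i)).
Definition yL (i : nat) : letters := 'X_(mxvec_index 1 (inord i)).
Definition zL (i j k : nat) : letters := (zG i j k)%:MP.
Definition tL (i e : nat) : letters :=
  (if a_ i == 0%N then zG i 0 0 ^+ (e %/ b_ i) else 1)%:MP.

(* x_i^j y_i^k in an expanded term.  For a_i = 1 several factors from W_i may
   be written with letters, as in the terms with t_5^4. *)
Definition letter_power (i j k : nat) : KG0 :=
  if (j + k == 0)%N then 1
  else if a_ i == 1%N then zG i 1 0 ^+ j * zG i 0 1 ^+ k else zG i j k.

Definition Phi (p : letters) : KG0 :=
  \sum_(m <- msupp p)
     p@_m * \prod_(i < 13) letter_power i (m (mxvec_index 0 i)) (m (mxvec_index 1 i)).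

Local Notation x := xL.
Local Notation y := yL.
Local Notation z := zL.
Local Notation t := tL.

Definition v75 : KG0 := Phi (
  - 6 * z 1 2 0 * (z 1 2 0 * z 1 0 2 - z 1 1 1 ^+ 2) * t 7 3
  - 4
      * ((z 1 2 0 * z 1 0 2 - 6 * z 1 1 1 ^+ 2) * x 9 ^+ 2
            + 10 * z 1 2 0 * z 1 1 1 * x 9 * y 9 - 5 * z 1 2 0 ^+ 2 * y 9 ^+ 2)
      * t 9 3
  + 4 * (x 1 * y 2 - y 1 * x 2) * x 2
      * ((x 1 * y 2 + y 1 * x 2) * x 8 - 2 * x 1 * x 2 * y 8) * t 8 3
  + 16 * (x 1 * y 3 - y 1 * x 3) ^+ 2 * x 3 ^+ 2 * t 7 3
  - x 1 ^+ 2 * t 4 2 * t 7 3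
  + 8 * x 1 ^+ 2 * t 12 5
  + 28 * (z 2 3 0 * z 2 1 2 - z 2 2 1 ^+ 2) * t 7 3
  - 48 * x 2 * x 11 * (x 2 * y 11 - y 2 * x 11) ^+ 2 * t 11 3
  - 48 * x 3 ^+ 2 * (x 3 * y 9 - y 3 * x 9) ^+ 2 * t 9 3
  - 16 * x 9 ^+ 2 * t 4 2 * t 9 3
  - 24 * x 5 * x 8 * t 5 2 * t 8 3
  + 4 * x 6 ^+ 2 * t 6 2 * t 7 3).

Definition v66' : KG0 := Phi (
  - 3 * (x 1 * y 2 - y 1 * x 2) ^+ 2 * (x 2 * y 8 - y 2 * x 8) * t 8 3
  + 4 * (x 2 * y 11 - y 2 * x 11) ^+ 3 * t 11 3
  - 6 * (x 5 * y 8 - y 5 * x 8) * t 5 2 * t 8 3).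

(* v66_P collects the terms with at least two factors from W_1, v66_Q those
   with at most one. *)
Definition v66_P : letters :=
  - 108 * (z 1 2 0 * z 1 0 2 - z 1 1 1 ^+ 2) ^+ 3
  + 216 * (z 1 2 0 * z 1 0 2 - z 1 1 1 ^+ 2)
      * (x 3 ^+ 2 * z 1 0 2 - 2 * x 3 * y 3 * z 1 1 1
            + y 3 ^+ 2 * z 1 2 0) ^+ 2
  - 180 * (z 1 2 0 * z 1 0 2 - z 1 1 1 ^+ 2) ^+ 2 * t 4 2
  - 12
      * (54 * z 1 2 0 * z 1 1 1 ^+ 2 * z 2 1 2 ^+ 2
            + 12 * z 1 2 0 ^+ 2 * z 1 0 2 * z 2 2 1 * z 2 0 3
            + 30 * z 1 2 0 * z 1 1 1 ^+ 2 * z 2 2 1 * z 2 0 3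
            - 42 * z 1 2 0 ^+ 2 * z 1 1 1 * z 2 1 2 * z 2 0 3
            - 72 * z 1 2 0 * z 1 1 1 * z 1 0 2 * z 2 2 1 * z 2 1 2
            + 9 * z 1 2 0 ^+ 2 * z 1 0 2 * z 2 1 2 ^+ 2
            - 12 * z 1 2 0 * z 1 1 1 * z 1 0 2 * z 2 3 0 * z 2 0 3
            - 42 * z 1 1 1 * z 1 0 2 ^+ 2 * z 2 3 0 * z 2 2 1
            + 54 * z 1 1 1 ^+ 2 * z 1 0 2 * z 2 2 1 ^+ 2
            - 54 * z 1 1 1 ^+ 3 * z 2 2 1 * z 2 1 2
            + 30 * z 1 1 1 ^+ 2 * z 1 0 2 * z 2 3 0 * z 2 1 2
            + 7 * z 1 2 0 ^+ 3 * z 2 0 3 ^+ 2 + 7 * z 1 0 2 ^+ 3 * z 2 3 0 ^+ 2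
            + 9 * z 1 2 0 * z 1 0 2 ^+ 2 * z 2 2 1 ^+ 2
            - 2 * z 1 1 1 ^+ 3 * z 2 3 0 * z 2 0 3
            + 12 * z 1 2 0 * z 1 0 2 ^+ 2 * z 2 3 0 * z 2 1 2)
  + 216 * (z 1 2 0 * z 1 0 2 - z 1 1 1 ^+ 2)
      * (z 1 0 2 * x 6 ^+ 2 - 2 * z 1 1 1 * x 6 * y 6 + z 1 2 0 * y 6 ^+ 2)
      * t 6 2
  + 432 * (z 1 0 2 * x 2 ^+ 2 - 2 * z 1 1 1 * x 2 * y 2 + z 1 2 0 * y 2 ^+ 2)
      * (- z 1 0 2 * x 2 * x 5 + z 1 1 1 * (x 2 * y 5 + x 5 * y 2)
            - z 1 2 0 * y 2 * y 5)
      * t 5 2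
  - 432
      * (- 2 * z 1 2 0 ^+ 2 * (z 3 1 3 ^+ 2 - z 3 2 2 * z 3 0 4)
            - 4 * z 1 2 0 * z 1 1 1 * (z 3 3 1 * z 3 0 4 - z 3 2 2 * z 3 1 3)
            - z 1 2 0 * z 1 0 2 * (z 3 2 2 ^+ 2 - z 3 4 0 * z 3 0 4)
            + z 1 1 1 ^+ 2 * (- 5 * z 3 2 2 ^+ 2 + z 3 4 0 * z 3 0 4 + 4 * z 3 3 1 * z 3 1 3)
            - 4 * z 1 1 1 * z 1 0 2 * (z 3 4 0 * z 3 1 3 - z 3 3 1 * z 3 2 2)
            + 2 * z 1 0 2 ^+ 2 * (z 3 4 0 * z 3 2 2 - z 3 3 1 ^+ 2))
  + 216
      * (z 1 0 2 * x 3 ^+ 2 - 2 * z 1 1 1 * x 3 * y 3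
            + z 1 2 0 * y 3 ^+ 2) ^+ 2
      * t 4 2
  + 33 * (z 1 2 0 * z 1 0 2 - z 1 1 1 ^+ 2) * t 4 4.

Definition v66_Q : letters :=
  36
      * (- z 2 0 3 * x 3 ^+ 3 + 3 * z 2 1 2 * x 3 ^+ 2 * y 3
            - 3 * z 2 2 1 * x 3 * y 3 ^+ 2 + z 2 3 0 * y 3 ^+ 3)
      * (- x 1 ^+ 2 * x 3 * z 2 0 3
            + x 1 * (x 1 * y 3 + 2 * y 1 * x 3) * z 2 1 2
            - y 1 * (y 1 * x 3 + 2 * x 1 * y 3) * z 2 2 1
            + y 1 ^+ 2 * y 3 * z 2 3 0)
  + 45
      * (x 1 ^+ 2 * (z 2 2 1 * z 2 0 3 - z 2 1 2 ^+ 2)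
            - x 1 * y 1 * (z 2 3 0 * z 2 0 3 - z 2 2 1 * z 2 1 2)
            + y 1 ^+ 2 * (z 2 3 0 * z 2 1 2 - z 2 2 1 ^+ 2))
      * t 4 2
  - 108 * (x 1 * y 3 - y 1 * x 3) ^+ 2 * (x 3 * y 6 - y 3 * x 6) ^+ 2 * t 6 2
  + 9 * (x 1 * y 6 - y 1 * x 6) ^+ 2 * t 4 2 * t 6 2
  - 108 * (x 1 * y 5 - y 1 * x 5) ^+ 2 * t 5 4
  - 9
      * (4 * z 2 2 1 ^+ 3 * z 2 0 3 - 6 * z 2 3 0 * z 2 1 2 * z 2 2 1 * z 2 0 3
            + z 2 3 0 ^+ 2 * z 2 0 3 ^+ 2 + 4 * z 2 3 0 * z 2 1 2 ^+ 3
            - 3 * z 2 2 1 ^+ 2 * z 2 1 2 ^+ 2)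
  - 144 * (x 2 * y 3 - y 2 * x 3) ^+ 3 * (x 3 * y 5 - y 3 * x 5) * t 5 2
  - 108
      * ((z 2 2 1 * z 2 0 3 - z 2 1 2 ^+ 2) * x 6 ^+ 2
            - (z 2 3 0 * z 2 0 3 - z 2 2 1 * z 2 1 2) * x 6 * y 6
            + (z 2 3 0 * z 2 1 2 - z 2 2 1 ^+ 2) * y 6 ^+ 2)
      * t 6 2
  + 432
      * (- z 3 3 1 ^+ 2 * z 3 0 4 + 2 * z 3 3 1 * z 3 2 2 * z 3 1 3
            - z 3 2 2 ^+ 3 - z 3 4 0 * z 3 1 3 ^+ 2
            + z 3 4 0 * z 3 2 2 * z 3 0 4)
  - 36 * (z 3 4 0 * z 3 0 4 - 4 * z 3 1 3 * z 3 3 1 + 3 * z 3 2 2 ^+ 2) * t 4 2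
  + 14 * t 4 6
  - 36 * t 4 2 * t 10 4
  - 108 * (z 6 2 0 * z 6 0 2 - z 6 1 1 ^+ 2) * t 6 4
  + 24 * t 7 6.

(* The factor 4 corrects the published formula, which is Phi (v66_P + v66_Q):
   that element is a highest weight vector of bidegree (6,6) but is not in J. *)
Definition v66'' : KG0 := Phi (v66_P + 4 * v66_Q).

End Defs.

Notation W K l1 l2 := (dhomog 2 K (l1 - l2)).

(* Main.v *)
(* That v75, v66' and v66'' vanish in C_0 is a consequence of the fundamental trace identity
   sum_{s in S_5} sgn(s) tr_s(A_1, ..., A_5) = 0 of 4 x 4 matrices, which expresses that 5 x 5
   determinants with two equal columns vanish: a multiple of each of the three elements is an
   explicit combination of instances of this identity at words in x and y.

   Conversely, let V_k be the space of relations of bidegree (6 + k, 6 - k), with the operators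
   E : y |-> x and F : x |-> y of sl_2.  The coefficients of a relation of bidegree (6,6) on the
   185 monomials of that bidegree are annihilated by the evaluations at pairs of matrices; 182
   integer pairs and three coefficients give a matrix which is invertible modulo 7, so V_0 has
   dimension at most 3 and is spanned by v66', v66'' and F v75.  Hence E^2 and F^2 vanish on V_0.
   If k >= 2 and V_l = 0 for l > k, then E^k F^k acts on V_k as a nonzero scalar, so V_k = 0;
   similarly V_1 is spanned by v75, and the same holds for negative k.  Relations split into
   bihomogeneous ones because they are stable under [E, F], which separates the bidegrees.

   Equivariance is checked on the diagonal matrices, the exchange of x and y, and the unipotent
   group x |-> x + c y, whose action is the exponential of c F. *)

From Stdlib Require Import ZArith.
From HB Require Import structures.
Require Import Defs.
From mathcomp Require Import all_boot all_order all_algebra.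
From mathcomp Require Import ring zify ssrZ.
From mathcomp.multinomials Require Import mpoly.

Set Implicit Arguments.
Unset Strict Implicit.
Unset Printing Implicit Defensive.

Import GRing.Theory.
Local Open Scope ring_scope.

(** * The fundamental trace identity of 4 x 4 matrices *)

(** Polynomials in the matrix entries do not compute, so every finite check is phrased on lists of
    binary integers, decided by [vm_compute] and carried to K along Z -> K by a soundness lemma. The
    isomorphisms phi_i contain divisions. In closed form, phi_i (x^(a-k) y^k) is, up to the factor 1
    / binom(a_i, k), the trace of an SL_2-invariant times the sum of all words with k letters y
    among a_i. The computations use these integral traces, and the binomials are moved into the
    coefficients of a relation or into the unknowns of a linear system. Linear algebra is needed in
    the single bidegree (6,6) because the degree 12 is even: every irreducible constituent in this
    degree has a nonzero vector of weight 0, so the middle weight space already detects all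
    relations. A residue suffices for the rank: an integer determinant that is nonzero modulo 7 is
    nonzero in Z, hence in every field of characteristic 0. The sl_2-operators on K[G_0] and on the
    entry ring are derivations, and the group acts by ring morphisms; identities between them are
    therefore verified on constants and variables. *)

Section FundamentalTraceIdentity.

Variables (R : comNzRingType) (n : nat).
Implicit Types (A b : 'M[R]_n).

(** Expansion along the first row, followed in each minor that still meets the first column by
    expansion along that column; the signs combine to minus a cofactor of the inner block. *)
Lemma det_bordered m (M : 'M[R]_m.+1) :
  let N := \matrix_(k, l) M (lift ord0 k) (lift ord0 l) in
  \det M = M ord0 ord0 * \det N
    - \sum_l \sum_k M ord0 (lift ord0 l) * M (lift ord0 k) ord0 * cofactor N k l.
Proof.
case: m M => [|m] M N; rewrite (expand_det_row M ord0) big_ord_recl;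
  congr (_ * _ + _); rewrite -?sumrN ?big_ord0 //.
- by rewrite /cofactor expr0 mul1r !det_mx00.
- by rewrite /cofactor expr0 mul1r; congr (\det _); apply/matrixP => k l; rewrite !mxE.
apply: eq_bigr => l _.
rewrite /cofactor (expand_det_col _ ord0) -sumrN !mulr_sumr.
apply: eq_bigr => k _; rewrite /cofactor !mxE /=.
rewrite ?lift0 /= addn0 add0n exprS exprD.
rewrite (_ : lift (lift ord0 l) ord0 = ord0); last exact/val_inj.
have -> : row' k (col' ord0 (row' ord0 (col' (lift ord0 l) M)))
          = row' k (col' l N).
  apply/matrixP => i j; rewrite /N !mxE; congr (M _ _).
  by apply: val_inj; rewrite /= /bump !leq0n !add1n ltnS addnS.
by ring.
Qed.

(** This is the fundamental trace form sum_s sgn(s) tr_s(A_1, ..., A_m): after the Leibniz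
    expansion, the sum over i attached to a permutation s is the product of the traces along the
    cycles of s. *)
Definition minor_sum m (A : 'I_m -> 'M[R]_n) : R :=
  \sum_(i : {ffun 'I_m -> 'I_n}) \det (\matrix_(k, l) A k (i k) (i l)).

Lemma minor_sum_eq0 m (A : 'I_m -> 'M[R]_n) : (n < m)%N -> minor_sum A = 0.
Proof.
move=> ltnm; apply: big1 => i _; rewrite -det_tr.
have /injectivePn[k1 [k2 nk ek]] : ~~ injectiveb i.
  apply/negP => /injectiveP/leq_card; rewrite !card_ord.
  by rewrite leqNgt ltnm.
by apply: (determinant_alternate nk) => k; rewrite !mxE ek.
Qed.

Definition ffun_cons m (p : 'I_n * {ffun 'I_m -> 'I_n}) : {ffun 'I_m.+1 -> 'I_n} :=
  [ffun k => oapp p.2 p.1 (unlift ord0 k)].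

Lemma ffun_cons_bij m : bijective (@ffun_cons m).
Proof.
exists (fun f : {ffun 'I_m.+1 -> 'I_n} => (f ord0, [ffun k => f (lift ord0 k)])) => [[i0 f]|f].
  rewrite /ffun_cons ffunE unlift_none /=; congr (_, _).
  by apply/ffunP => k; rewrite !ffunE liftK.
apply/ffunP => k; rewrite !ffunE /=.
by case: unliftP => [j|] -> //=; rewrite ffunE.
Qed.

(** In terms of permutations: the first index is either a fixed point, which gives a trace, or it
    follows some j in its cycle; removing it there multiplies [B j] by [A ord0] on the right and
    changes the sign. *)
Lemma minor_sumS m (A : 'I_m.+1 -> 'M[R]_n) :
  let B k := A (lift ord0 k) in
  minor_sum A = \tr (A ord0) * minor_sum B
    - \sum_j minor_sum (fun k => if k == j then B k *m A ord0 else B k).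
Proof.
move=> B; rewrite /minor_sum (reindex _ (onW_bij _ (ffun_cons_bij m))) /=.
rewrite -(pair_bigA _ (fun i0 i => \det (\matrix_(k, l)
  A k (ffun_cons (i0, i) k) (ffun_cons (i0, i) l)))) /=.
rewrite exchange_big /= mulr_sumr [X in _ = _ - X]exchange_big -sumrB /=.
apply: eq_bigr => i _; set M := \matrix_(k, l) B k (i k) (i l).
have MB i0 : \matrix_(k, l) (\matrix_(k, l) A k (ffun_cons (i0, i) k)
     (ffun_cons (i0, i) l)) (lift ord0 k) (lift ord0 l) = M.
  by apply/matrixP => k l; rewrite !mxE !ffunE !liftK.
under eq_bigr => i0 _ do rewrite det_bordered /= MB.
rewrite sumrB -mulr_suml; congr (_ * _ - _).
  by apply: eq_bigr => i0 _; rewrite !mxE !ffunE unlift_none.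
(* The sum over the first index contracts the border column and the border row to an entry of
   [B k *m A ord0]. For fixed k the sum over l is then the expansion along row k of the matrix with
   that row replaced. *)
transitivity (\sum_l \sum_k (B k *m A ord0) (i k) (i l) * cofactor M k l).
  rewrite exchange_big; apply: eq_bigr => l _ /=.
  rewrite exchange_big; apply: eq_bigr => k _ /=.
  rewrite mxE mulr_suml; apply: eq_bigr => i0 _.
  by rewrite !mxE !ffunE unlift_none !liftK /= [X in X * _]mulrC.
rewrite exchange_big; apply: eq_bigr => k _ /=.
rewrite (expand_det_row _ k); apply: eq_bigr => l _.
congr (_ * _); first by rewrite [RHS]mxE eqxx.
rewrite /cofactor; congr (_ * \det _).
apply/matrixP => k' l'; rewrite !mxE.
by rewrite eq_sym (negbTE (neq_lift _ _)).
Qed.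

End FundamentalTraceIdentity.

Section TraceForm.

Variables (T : Type) (mul : T -> T -> T).

(** The multiplication is a parameter so that one recursion serves matrices and, with [cat],
    words. *)
Fixpoint mul_each (b : T) (s : seq T) : seq (seq T) :=
  if s is a :: s' then (mul a b :: s') :: map (cons a) (mul_each b s')
  else [::].

End TraceForm.

Section ListForm.

Variables (R : comNzRingType) (n : nat).

(** The recursion of [minor_sumS] on lists. The counter k stands for the length, since the lists
    produced by [mul_each] are not sublists of s. *)
Fixpoint fund_form (k : nat) (s : seq 'M[R]_n) : R :=
  match k, s with
  | k.+1, b :: s =>
      \tr b * fund_form k s - \sum_(s' <- mul_each (@mulmx R n n n) b s) fund_form k s'
  | _, _ => 1
  end.

Lemma sum_mul_each (V : nmodType) (F : seq 'M[R]_n -> V) (b : 'M[R]_n) s :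
  \sum_(s' <- mul_each (@mulmx R n n n) b s) F s'
  = \sum_(j < size s)
      F (mkseq (fun k => if k == j then nth 0 s k *m b else nth 0 s k) (size s)).
Proof.
have iota1 m : iota 1 m = map S (iota 0 m) by exact: (iotaDl 1 0).
elim: s F => [|a s IH] F; first by rewrite big_nil big_ord0.
rewrite /= /mkseq /=.
rewrite big_cons big_map big_ord_recl IH /=; congr (_ + _).
  congr (F (_ :: _)); rewrite iota1 -map_comp.
  by rewrite -[LHS](mkseq_nth 0); apply: eq_map.
apply: eq_bigr => j _; congr (F (_ :: _)); rewrite iota1 -map_comp.
exact: eq_map.
Qed.

Lemma fund_formE (s : seq 'M[R]_n) :
  fund_form (size s) s = minor_sum (fun k : 'I_(size s) => nth 0 s k).
Proof.
have [m sm] : exists m, size s = m by exists (size s).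
elim: m s sm => [|m IH] [|b s] //=.
  move=> _; rewrite /minor_sum (eq_bigr (fun=> 1)) => [|i _]; last exact: det_mx00.
  by rewrite sumr_const card_ffun !card_ord.
case=> sm; rewrite minor_sumS /= IH //; congr (_ - _).
rewrite sum_mul_each; apply: eq_bigr => j _; set t := mkseq _ _.
have st : size t = size s by rewrite size_mkseq.
transitivity (fund_form (size t) t); first by rewrite st.
rewrite IH ?st //.
apply: eq_bigr => i _; congr (\det _); apply/matrixP => k l; rewrite !mxE.
by rewrite nth_mkseq.
Qed.

Lemma fund_form_eq0 (s : seq 'M[R]_n) : (n < size s)%N -> fund_form (size s) s = 0.
Proof. by rewrite fund_formE => /minor_sum_eq0. Qed.

End ListForm.

(** * Formal traces of words *)

(** The ring morphism Z -> R through which all binary computations are interpreted. *)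
Definition zr (R : pzRingType) (c : Z) : R := (int_of_Z c)%:~R.

Section IntegerScalars.

Variable R : pzRingType.

Lemma zr0 : zr R Z0 = 0. Proof. by rewrite /zr rmorph0. Qed.

Lemma zr1 : zr R (Zpos xH) = 1. Proof. by []. Qed.

Lemma zrD a b : zr R (Z.add a b) = zr R a + zr R b.
Proof. by rewrite /zr (rmorphD int_of_Z) rmorphD. Qed.

Lemma zrM a b : zr R (Z.mul a b) = zr R a * zr R b.
Proof. by rewrite /zr (rmorphM int_of_Z) rmorphM. Qed.

Lemma zrN a : zr R (Z.opp a) = - zr R a.
Proof. by rewrite /zr (rmorphN int_of_Z) rmorphN. Qed.

Lemma zr_nat n : zr R (Z.of_nat n) = n%:R.
Proof.
elim: n => [|n IH]; first exact: zr0.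
by rewrite Nat2Z.inj_succ -Z.add_1_r zrD IH zr1 -[n.+1]addn1 natrD.
Qed.

End IntegerScalars.

Lemma rmorph_zr (R S : pzRingType) (f : {rmorphism R -> S}) c : f (zr R c) = zr S c.
Proof. exact: rmorph_int. Qed.

(** A finitely supported function from bit strings to Z. Like terms meet at the same node, so a
    large sum is collected without comparing its monomials with each other. *)
Inductive trie := Leaf | Node of Z & trie & trie.

Fixpoint trie_add (k : seq bool) (c : Z) (t : trie) : trie :=
  match k, t with
  | [::], Leaf => Node c Leaf Leaf
  | [::], Node d l r => Node (Z.add d c) l r
  | b :: k, Leaf =>
      if b then Node Z0 Leaf (trie_add k c Leaf) else Node Z0 (trie_add k c Leaf) Leaf
  | b :: k, Node d l r =>
      if b then Node d l (trie_add k c r) else Node d (trie_add k c l) r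
  end.

Fixpoint trie_null (t : trie) : bool :=
  if t is Node c l r then [&& Z.eqb c Z0, trie_null l & trie_null r] else true.

Section TrieValue.

Variable R : pzRingType.

Fixpoint trie_val (f : seq bool -> R) (t : trie) : R :=
  if t is Node c l r
  then zr R c * f [::] + trie_val (f \o cons false) l + trie_val (f \o cons true) r
  else 0.

Lemma trie_val_add f k c t :
  trie_val f (trie_add k c t) = trie_val f t + zr R c * f k.
Proof.
elim: k f t => [|b k IH] f [|d l r] //=; rewrite ?zr0 ?zrD ?mul0r ?addr0 ?add0r //.
- by rewrite mulrDl -!addrA; congr (_ + _); rewrite addrC addrA.
- by case: b => /=; rewrite zr0 mul0r IH ?addr0 ?add0r.
- by case: b => /=; rewrite IH !addrA // -!addrA [X in _ + (_ + X)]addrC.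
Qed.

Lemma trie_val_null f t : trie_null t -> trie_val f t = 0.
Proof.
elim: t f => //= c l IHl r IHr f /and3P[/Z.eqb_spec -> /IHl -> /IHr ->].
by rewrite zr0 mul0r !addr0.
Qed.

End TrieValue.

Notation word := (seq bool).

Fixpoint lex_le (u v : word) : bool :=
  match u, v with
  | [::], _ => true
  | _, [::] => false
  | a :: u, b :: v => if a then (if b then lex_le u v else false)
                      else (if b then true else lex_le u v)
  end.

Definition rot1_word (w : word) : word := if w is a :: w then rcons w a else w.

Fixpoint min_rot (k : nat) (best w : word) : word :=
  if k is k.+1 then
    let w := rot1_word w in min_rot k (if lex_le best w then best else w) w
  else best.

(** The lexicographically least rotation of w. Its trace is that of w by cyclicity, and words that
    differ by a rotation get the same representative. *)
Definition necklace (w : word) : word := min_rot (size w) w w.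

Fixpoint word_insert (w : word) (m : seq word) : seq word :=
  if m is v :: m' then (if lex_le w v then w :: m else v :: word_insert w m')
  else [:: w].

Definition canonical_mono (m : seq word) : seq word :=
  foldr (fun w => word_insert (necklace w)) [::] m.

(** A prefix code: [true] announces a letter and [false] closes the word, so a product of traces can
    be read back from its key. *)
Fixpoint word_key (w : word) (k : seq bool) : seq bool :=
  if w is b :: w then true :: b :: word_key w k else false :: k.

Definition mono_key (m : seq word) : seq bool := foldr word_key [::] m.

(* Integer combinations of products of traces of words. *)
Notation tpoly := (seq (Z * seq word)).

Definition single_letter (w : word) : bool := if w is [:: _] then true else false.

(** The generic matrices are traceless, so a monomial containing the trace of a single letter is
    dropped. *)
Definition trie_add_mono (c : Z) (m : seq word) (t : trie) : trie :=
  if has single_letter m then t else trie_add (mono_key (canonical_mono m)) c t.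

Definition trie_add_tpoly (p : tpoly) (t : trie) : trie :=
  foldr (fun cm => trie_add_mono cm.1 cm.2) t p.

(** [fund_form] on words. A factor tr(x) or tr(y) cuts off its whole branch at once, which keeps the
    expansions short. *)
Fixpoint fund_tpoly (k : nat) (ws : seq word) : tpoly :=
  match k, ws with
  | k.+1, b :: ws =>
      (if single_letter b then [::]
       else [seq (cm.1, b :: cm.2) | cm <- fund_tpoly k ws])
      ++ [seq (Z.opp cm.1, cm.2) | cm <- flatten (map (fund_tpoly k) (mul_each cat b ws))]
  | _, _ => [:: (Zpos xH, [::])]
  end.

Definition tpoly_scale (c : Z) (m : seq word) (p : tpoly) : tpoly :=
  [seq (Z.mul c cm.1, m ++ cm.2) | cm <- p].

Definition tpoly_mul (p q : tpoly) : tpoly :=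
  flatten [seq tpoly_scale cm.1 cm.2 q | cm <- p].

Section TraceValue.

Variables (R : comNzRingType) (n : nat) (X : bool -> 'M[R]_n.+1).

Definition wmx (w : word) : 'M[R]_n.+1 := foldr (fun b M => X b * M) 1 w.

Definition mono_val (m : seq word) : R := \prod_(w <- m) \tr (wmx w).

Definition tpoly_val (p : tpoly) : R := \sum_(cm <- p) zr R cm.1 * mono_val cm.2.

Lemma wmx_cat u v : wmx (u ++ v) = wmx u * wmx v.
Proof. by elim: u => [|b u IH] /=; rewrite ?mul1r // IH mulrA. Qed.

Lemma tr_rot1_word w : \tr (wmx (rot1_word w)) = \tr (wmx w).
Proof.
case: w => //= b w; rewrite -cats1 wmx_cat /= mulr1 -!mulmxE; exact: mxtrace_mulC.
Qed.

Lemma tr_necklace w : \tr (wmx (necklace w)) = \tr (wmx w).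
Proof.
rewrite /necklace; move: (size w) (erefl (\tr (wmx w))) => k.
suff H u v : \tr (wmx u) = \tr (wmx v) -> \tr (wmx (min_rot k u v)) = \tr (wmx v).
  by move/H.
elim: k u v => //= k IH u v uv; rewrite IH ?tr_rot1_word //.
by case: ifP; rewrite ?tr_rot1_word.
Qed.

Lemma mono_val_cons w m : mono_val (w :: m) = \tr (wmx w) * mono_val m.
Proof. exact: big_cons. Qed.

Lemma mono_val_cat m1 m2 : mono_val (m1 ++ m2) = mono_val m1 * mono_val m2.
Proof. exact: big_cat. Qed.

Lemma mono_val_insert w m : mono_val (word_insert w m) = \tr (wmx w) * mono_val m.
Proof.
elim: m => [|v m IH] /=; first exact: mono_val_cons.
by case: ifP; rewrite !mono_val_cons // IH mulrCA.
Qed.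

Lemma mono_val_canonical m : mono_val (canonical_mono m) = mono_val m.
Proof.
by elim: m => //= w m IH; rewrite mono_val_insert tr_necklace IH mono_val_cons.
Qed.

(** The decoder of [mono_key]: M accumulates the product of the letters of the word being read. *)
Fixpoint key_val (M : 'M[R]_n.+1) (k : seq bool) : R :=
  match k with
  | true :: b :: k => key_val (M * X b) k
  | false :: k => \tr M * key_val 1 k
  | _ => 1
  end.

Lemma key_val_word M w k : key_val M (word_key w k) = \tr (M * wmx w) * key_val 1 k.
Proof. by elim: w M => [|b w IH] M /=; rewrite ?mulr1 // IH mulrA. Qed.

Lemma key_val_mono m : key_val 1 (mono_key m) = mono_val m.
Proof.
elim: m => [|w m IH]; first by rewrite /mono_val big_nil.
by rewrite /= key_val_word mul1r IH mono_val_cons.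
Qed.

Lemma tpoly_val_cat p q : tpoly_val (p ++ q) = tpoly_val p + tpoly_val q.
Proof. exact: big_cat. Qed.

Lemma tpoly_val_scale c m p :
  tpoly_val (tpoly_scale c m p) = zr R c * mono_val m * tpoly_val p.
Proof.
rewrite /tpoly_val big_map mulr_sumr; apply: eq_bigr => cm _ /=.
by rewrite zrM mono_val_cat -!mulrA [X in _ * X = _]mulrCA.
Qed.

Lemma tpoly_val_mul p q : tpoly_val (tpoly_mul p q) = tpoly_val p * tpoly_val q.
Proof.
rewrite {1}/tpoly_val big_flatten big_map mulr_suml.
by apply: eq_bigr => cm _; rewrite -[LHS]/(tpoly_val _) tpoly_val_scale.
Qed.

Hypothesis X_traceless : forall b, \tr (X b) = 0.

Lemma tr_single_letter w : single_letter w -> \tr (wmx w) = 0.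
Proof. by case: w => [|b []] //= _; rewrite mulr1. Qed.

Lemma trie_val_add_mono c m t :
  trie_val (key_val 1) (trie_add_mono c m t)
  = trie_val (key_val 1) t + zr R c * mono_val m.
Proof.
rewrite /trie_add_mono; case: ifP => [/hasP[w wm w1] | _].
  by rewrite /mono_val (big_rem w wm) tr_single_letter //= mul0r mulr0 addr0.
by rewrite trie_val_add key_val_mono mono_val_canonical.
Qed.

Lemma trie_val_add_tpoly p t :
  trie_val (key_val 1) (trie_add_tpoly p t) = trie_val (key_val 1) t + tpoly_val p.
Proof.
elim: p => [|[c m] p IH] /=; first by rewrite /tpoly_val big_nil addr0.
by rewrite trie_val_add_mono IH /tpoly_val big_cons -addrA [X in _ + X]addrC.
Qed.

Lemma fund_tpolyE k ws : tpoly_val (fund_tpoly k ws) = fund_form k (map wmx ws).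
Proof.
elim: k ws => [|k IH] [|b ws];
  rewrite ?[LHS]big_seq1 ?mul1r /= /mono_val ?big_nil ?mulr1 //.
rewrite tpoly_val_cat; congr (_ + _).
  case: ifP => [/tr_single_letter -> | _]; first by rewrite [LHS]big_nil mul0r.
  rewrite -IH /tpoly_val big_map mulr_sumr; apply: eq_bigr => cm _ /=.
  by rewrite mono_val_cons mulrCA.
rewrite [LHS]big_map -sumrN big_flatten big_map /=.
transitivity (- \sum_(ws' <- mul_each cat b ws) fund_form k (map wmx ws')).
  rewrite -sumrN; apply: eq_bigr => ws' _.
  by rewrite -IH -sumrN; apply: eq_bigr => cm _ /=; rewrite zrN mulNr.
have E (F : seq 'M[R]_n.+1 -> R) : \sum_(ws' <- mul_each cat b ws) F (map wmx ws')
    = \sum_(s <- mul_each (@mulmx R _ _ _) (wmx b) (map wmx ws)) F s.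
  elim: ws F => [|a ws IHw] F /=; first by rewrite !big_nil.
  rewrite !big_cons !big_map -(IHw (F \o cons (wmx a))) /= wmx_cat mulmxE.
  by congr (_ + _); apply: eq_bigr.
by rewrite E -sumrN.
Qed.

Lemma fund_tpoly_eq0 ws : (n.+1 < size ws)%N -> tpoly_val (fund_tpoly (size ws) ws) = 0.
Proof. by rewrite fund_tpolyE -(size_map wmx); apply: fund_form_eq0. Qed.

End TraceValue.

(** * Derivations and polarization *)

(** The induction for identities between ring morphisms and derivations: such identities persist
    under sums and products. *)
Lemma mpoly_ring_ind (R : comNzRingType) n (P : {mpoly R[n]} -> Prop) :
  (forall c, P c%:MP) -> (forall i, P 'X_i) ->
  (forall p q, P p -> P q -> P (p + q)) -> (forall p q, P p -> P q -> P (p * q)) ->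
  forall p, P p.
Proof.
move=> PC PX PD PM; elim/mpolyind => [|c m p _ _ Pp]; first by rewrite -mpolyC0.
apply: (PD) => //; rewrite -mul_mpolyC; apply: (PM) => //; rewrite mpolyXE_id.
apply: big_ind => [||i _]; [by rewrite -mpolyC1 | exact: PM |].
by elim: (m i) => [|k IH]; [rewrite expr0 -mpolyC1 | rewrite exprS; apply: PM].
Qed.

(** The derivation with X_(h i) |-> g i. The index type I allows both the polarizations, which
    differentiate only the entries of one of the two matrices, and the derivations of K[G_0], where
    h is the identity. *)
HB.lock Definition der (R : comNzRingType) n (I : finType)
    (g : I -> {mpoly R[n]}) (h : I -> 'I_n) (p : {mpoly R[n]}) : {mpoly R[n]} :=
  \sum_i g i * p^`M(h i).

Section Derivations.

Variables (R : comNzRingType) (n : nat) (I : finType).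
Variables (g : I -> {mpoly R[n]}) (h : I -> 'I_n).
Local Notation D := (der g h).

Lemma der_is_linear : linear D.
Proof.
move=> c p q; rewrite [der]unlock scaler_sumr -big_split; apply: eq_bigr => i _ /=.
by rewrite mderivD mderivZ mulrDr scalerAr.
Qed.

HB.instance Definition _ :=
  GRing.isSemilinear.Build R {mpoly R[n]} {mpoly R[n]} _ D
    (GRing.semilinear_linear der_is_linear).

Lemma derM p q : D (p * q) = D p * q + p * D q.
Proof.
rewrite [der]unlock mulr_suml mulr_sumr -big_split; apply: eq_bigr => i _ /=.
by rewrite mderivM mulrDr; congr (_ + _); [exact: mulrA | exact: mulrCA].
Qed.

Lemma derC c : D c%:MP = 0.
Proof. by rewrite [der]unlock big1 // => i _; rewrite mderivC mulr0. Qed.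

Lemma der_gen v : D 'X_v = \sum_(i | h i == v) g i.
Proof.
rewrite [der]unlock [RHS]big_mkcond; apply: eq_bigr => i _.
rewrite mderivX mnm1E [h i == v]eq_sym; case: eqP => [->|_]; last by rewrite scale0r mulr0.
rewrite scale1r (_ : (_ - _)%MM = 0%MM) ?mpolyX0 ?mulr1 //.
by apply/mnmP => k; rewrite mnmE mnm0E subnn.
Qed.

Definition der_mx m (A : 'M[{mpoly R[n]}]_m) : 'M_m := map_mx D A.

Lemma der_mxM m (A B : 'M[{mpoly R[n]}]_m.+1) :
  der_mx (A * B) = der_mx A * B + A * der_mx B.
Proof.
apply/matrixP => r s; rewrite !mxE linear_sum -big_split; apply: eq_bigr => k _ /=.
by rewrite derM !mxE.
Qed.

Lemma der_mxD m (A B : 'M[{mpoly R[n]}]_m) : der_mx (A + B) = der_mx A + der_mx B.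
Proof. exact: map_mxD. Qed.

Lemma der_tr m (A : 'M[{mpoly R[n]}]_m) : D (\tr A) = \tr (der_mx A).
Proof. by rewrite /mxtrace linear_sum; apply: eq_bigr => i _ /=; rewrite mxE. Qed.

End Derivations.

(** Both sides are derivations along the substitution by t, hence determined by their values on the
    variables. This is how [evalG] is shown to commute with the operators of sl_2. *)
Lemma der_comp (R : comNzRingType) n k (I I' : finType)
    (g : I -> {mpoly R[n]}) (h : I -> 'I_n) (g' : I' -> {mpoly R[k]}) (h' : I' -> 'I_k)
    (t : n.-tuple {mpoly R[k]}) :
  (forall v, der g' h' (tnth t v) = der g h 'X_v \mPo t) ->
  forall p, der g' h' (p \mPo t) = der g h p \mPo t.
Proof.
move=> gen; apply: mpoly_ring_ind => [c|v|p q IHp IHq|p q IHp IHq].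
- by rewrite comp_mpolyC !derC comp_mpoly0.
- by rewrite comp_mpolyXU -tnth_nth gen.
- by rewrite !linearD /= IHp IHq.
- by rewrite rmorphM /= !derM IHp IHq rmorphD !rmorphM.
Qed.

Lemma four_cancel (V : zmodType) (a b c d : V) :
  (a + b) - (c + b) - (d + a) + (c + d) = 0.
Proof.
have -> : a + b - (c + b) = a - c by rewrite opprD addrACA subrr addr0.
have -> : a - c - (d + a) = - (c + d) by rewrite [d + a]addrC opprD addrACA subrr add0r opprD.
exact: addNr.
Qed.

Section Polarization.

Variables (A : nzRingType) (x y : A).

Definition commutator := x * y - y * x.

(** The factor of w_i in front of x^(a_i). It is killed by x |-> y, y |-> 0 and by x |-> 0, y |-> x,
    so these derivations only act on the power of x. *)
Definition core (i : nat) : A :=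
  if i == 12%N then
    commutator ^+ 3 * (x ^+ 2 * y ^+ 2 - x * y ^+ 2 * x - y * x ^+ 2 * y
                       + y ^+ 2 * x ^+ 2)
  else commutator ^+ b_ i.

(* The sum of all words with a letters, k of which are y. *)
Fixpoint shuffle (a k : nat) : A :=
  match a, k with
  | 0, 0 => 1
  | 0, _.+1 => 0
  | a.+1, 0 => x * shuffle a 0
  | a.+1, k'.+1 => x * shuffle a k + y * shuffle a k'
  end.

Lemma shuffle0 a : shuffle a 0 = x ^+ a.
Proof. by elim: a => //= a ->; rewrite exprS. Qed.

Lemma shuffle_gt a k : (a < k)%N -> shuffle a k = 0.
Proof.
elim: a k => [|a IH] [|k] //= ak; first by rewrite !IH ?mulr0 ?addr0 // ltnW.
Qed.

Variable d : A -> A.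
Hypothesis dD : {morph d : u v / u + v}.
Hypothesis dM : forall u v, d (u * v) = d u * v + u * d v.

Lemma derivation0 : d 0 = 0.
Proof. by apply: (addIr (d 0)); rewrite -dD !add0r. Qed.

Lemma derivation1 : d 1 = 0.
Proof. by apply: (addIr (d 1)); rewrite add0r -{3}[1]mulr1 dM mulr1 mul1r. Qed.

Lemma derivationB : {morph d : u v / u - v}.
Proof. by move=> u v; apply: (addIr (d v)); rewrite -dD !subrK. Qed.

Lemma derivation_exp0 u k : d u = 0 -> d (u ^+ k) = 0.
Proof.
move=> du; elim: k => [|k IH]; first by rewrite expr0 derivation1.
by rewrite exprS dM du IH mul0r mulr0 addr0.
Qed.

Section Lower.

Hypotheses (dx : d x = y) (dy : d y = 0).

Lemma lower_core i : d (core i) = 0.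
Proof.
have dc : d (commutator) = 0.
  by rewrite derivationB !dM dx dy mulr0 mul0r addr0 add0r subrr.
rewrite /core; case: ifP => _; last exact: derivation_exp0.
rewrite dM derivation_exp0 // mul0r add0r dD !derivationB.
have dxx : d (x ^+ 2) = y * x + x * y by rewrite expr2 dM dx.
have dyy : d (y ^+ 2) = 0 by rewrite expr2 dM dy mulr0 mul0r addr0.
have cxx : x ^+ 2 * x = x * x ^+ 2 by rewrite -exprSr -exprS.
have cyy : y ^+ 2 * y = y * y ^+ 2 by rewrite -exprSr -exprS.
(* The squares become letters p and q that commute with x and y respectively. The eight terms of the
   derivative then cancel in pairs, in the pattern of [four_cancel]. *)
move: (x ^+ 2) (y ^+ 2) (erefl (y * y) : y * y = y ^+ 2) dxx dyy cxx cyy => p q qE dxx dyy cxx cyy.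
have -> : d (p * q) = y * x * q + x * y * q.
  by rewrite dM dyy mulr0 addr0 dxx mulrDl.
have -> : d (x * q * x) = y * q * x + x * y * q.
  by rewrite dM (dM x) dyy mulr0 addr0 dx -[x * q * y]mulrA cyy !mulrA.
have -> : d (y * p * y) = q * x * y + y * x * q.
  rewrite dM (dM y) dxx dy mul0r mulr0 addr0 add0r mulrDr mulrDl !mulrA qE.
  by rewrite -[y * x * y * y]mulrA qE.
have -> : d (q * p) = y * q * x + q * x * y.
  by rewrite dM dyy mul0r add0r dxx mulrDr !mulrA cyy.
by rewrite four_cancel mulr0.
Qed.

(** A word with k + 1 letters y arises from k + 1 words by turning one x into y. *)
Lemma lower_shuffle a k : d (shuffle a k) = shuffle a k.+1 *+ k.+1.
Proof.
elim: a k => [|a IH] [|k] /=; rewrite ?derivation1 ?derivation0 ?mul0rn //.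
- by rewrite dM dx IH addrC.
- rewrite dD (dM x) (dM y) dx dy (IH k) (IH k.+1) mul0r add0r.
  rewrite mulrnDl [y * (_ *+ _)]mulrnAr [x * (_ *+ _)]mulrnAr /=.
  by rewrite addrAC -mulrS addrC.
Qed.

End Lower.

Section Raise.

Hypotheses (dx : d x = 0) (dy : d y = x).

Lemma raise_core i : d (core i) = 0.
Proof.
have dc : d (commutator) = 0.
  by rewrite derivationB !dM dx dy mulr0 mul0r addr0 add0r subrr.
rewrite /core; case: ifP => _; last exact: derivation_exp0.
rewrite dM derivation_exp0 // mul0r add0r dD !derivationB.
have dxx : d (x ^+ 2) = 0 by rewrite expr2 dM dx mulr0 mul0r addr0.
have dyy : d (y ^+ 2) = x * y + y * x by rewrite expr2 dM dy.
have cxx : x ^+ 2 * x = x * x ^+ 2 by rewrite -exprSr -exprS.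
have cyy : y ^+ 2 * y = y * y ^+ 2 by rewrite -exprSr -exprS.
move: (x ^+ 2) (y ^+ 2) (erefl (x * x) : x * x = x ^+ 2) dxx dyy cxx cyy => p q pE dxx dyy cxx cyy.
have -> : d (p * q) = x * p * y + p * y * x.
  by rewrite dM dxx mul0r add0r dyy mulrDr !mulrA cxx.
have -> : d (x * q * x) = x * y * p + p * y * x.
  rewrite dM (dM x) dyy dx mul0r mulr0 addr0 add0r mulrDr mulrDl !mulrA pE.
  by rewrite -[x * y * x * x]mulrA pE addrC.
have -> : d (y * p * y) = y * x * p + x * p * y.
  by rewrite dM (dM y) dxx mulr0 addr0 dy -[y * p * x]mulrA cxx !mulrA addrC.
have -> : d (q * p) = x * y * p + y * x * p.
  by rewrite dM dxx mulr0 addr0 dyy mulrDl.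
by rewrite four_cancel mulr0.
Qed.

Lemma raise_shuffle0 a : d (shuffle a 0) = 0.
Proof.
elim: a => [|a IH] /=; first exact: derivation1.
by rewrite dM dx IH mul0r mulr0 addr0.
Qed.

(** A word with k letters y has a - k letters x, each of which may be the one that was y before. *)
Lemma raise_shuffle a k : d (shuffle a k.+1) = shuffle a k *+ (a - k).
Proof.
elim: a k => [|a IH] k /=; first by rewrite derivation0 sub0n mulr0n.
rewrite dD (dM x) (dM y) dx dy IH mul0r add0r.
case: k => [|k] /=.
  by rewrite raise_shuffle0 mulr0 addr0 !subn0 mulrnAr -mulrSr.
rewrite IH mulrnDl !mulrnAr addrA -mulrSr; congr (_ + _).
by case: (leqP a k) => ak; [rewrite shuffle_gt ?mulr0 ?mul0rn | rewrite ?subSS subnSK].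
Qed.

End Raise.

End Polarization.

(** * The generators of C_0 *)

Section BasisIndices.

Lemma size_basisG : size basisG = 30%N. Proof. by []. Qed.

Lemma uniq_basisG : uniq basisG. Proof. by []. Qed.

Lemma mem_basisG i j k : ((i, j, k) \in basisG) = (0 < i <= 12)%N && (j + k == a_ i)%N.
Proof.
apply/allpairsPdep/idP => [[i' [j' [i'_in j'_in [-> -> ->]]]]|].
  move: i'_in j'_in; rewrite !mem_iota add0n ltnS => -> ja.
  by rewrite subnKC // eqxx.
case/andP=> i12 /eqP jk; exists i, j; rewrite !mem_iota ltnS -jk addKn.
by split; rewrite ?leq_addr //; lia.
Qed.

Definition tripG (v : 'I_30) := (fam v, xexp v, yexp v).

Lemma tripGE v : tripG v = nth (0, 0, 0)%N basisG v.
Proof. by rewrite /tripG /fam /xexp /yexp; case: (nth _ _ _) => [[]]. Qed.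

Lemma tripG_in v : tripG v \in basisG.
Proof. by rewrite tripGE mem_nth. Qed.

Lemma xexp_yexp v : (xexp v + yexp v)%N = a_ (fam v).
Proof. by have := tripG_in v; rewrite mem_basisG => /andP[_ /eqP]. Qed.

Lemma fam_bounds v : (0 < fam v <= 12)%N.
Proof. by have := tripG_in v; rewrite mem_basisG => /andP[]. Qed.

Definition idxG (i j k : nat) : 'I_30 := inord (index (i, j, k) basisG).

Lemma tripG_idxG i j k : (i, j, k) \in basisG -> tripG (idxG i j k) = (i, j, k).
Proof.
by move=> b; rewrite tripGE inordK ?nth_index // -size_basisG index_mem.
Qed.

Lemma idxG_tripG v : idxG (fam v) (xexp v) (yexp v) = v.
Proof.
by rewrite /idxG -/(tripG v) tripGE index_uniq ?inord_val // uniq_basisG.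
Qed.

End BasisIndices.

Lemma mxvec_index_inj m n : injective (uncurry (@mxvec_index m n)).
Proof. by move=> [i j] [i' j'] /cast_ord_inj/enum_rank_inj. Qed.

Section GeneratorDerivations.

Variable K : fieldType.
Local Notation entryRing := {mpoly K[2 * (4 * 4)]}.
Local Notation KG0 := {mpoly K[30]}.

Definition polarize (k l : 'I_2) : entryRing -> entryRing :=
  der (fun e : 'I_(4 * 4) => 'X_(mxvec_index l e)) (mxvec_index k).

Lemma Delta1E p : Delta1 p = polarize 0 1 p.
Proof. by rewrite /polarize [der]unlock. Qed.

Lemma polarize_entry k l m r s :
  polarize k l (entry K m r s) = if m == k then entry K l r s else 0.
Proof.
rewrite /polarize /entry der_gen; case: eqP => [<-|mk].
  rewrite (big_pred1 (mxvec_index r s)) // => e /=.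
  apply/eqP/eqP => [e_rs|-> //].
  by have [] := @mxvec_index_inj _ _ (m, e) (m, mxvec_index r s) e_rs.
rewrite big_pred0 // => e; apply/eqP => e_rs; apply: mk.
by have [] := @mxvec_index_inj _ _ (k, e) (m, mxvec_index r s) e_rs.
Qed.

Lemma polarize_gmx k l m :
  map_mx (polarize k l) (gmx K m) = if m == k then gmx K l else 0.
Proof.
apply/matrixP => r s; rewrite !mxE; case: ifP => rs.
  rewrite /polarize linearN linear_sum /= -/(polarize k l).
  under eq_bigr => i _ do rewrite polarize_entry.
  by case: ifP => _; rewrite mxE ?rs // big1 ?oppr0.
by rewrite polarize_entry; case: ifP => _; rewrite mxE ?rs.
Qed.

(** The integral multiple of [phi K i k] announced at the beginning: no division occurs in it. *)
Definition gen_trace (i k : nat) : entryRing :=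
  \tr (core (gmx K 0) (gmx K 1) i * shuffle (gmx K 0) (gmx K 1) (a_ i) k).

Lemma gen_trace_gt i k : (a_ i < k)%N -> gen_trace i k = 0.
Proof. by move=> ak; rewrite /gen_trace shuffle_gt // mulr0 linear0. Qed.

Lemma gen_trace_lower i k : polarize 0 1 (gen_trace i k) = gen_trace i k.+1 *+ k.+1.
Proof.
have dD := @der_mxD _ _ _ (fun e => 'X_(mxvec_index 1 e) : entryRing) (mxvec_index 0) 4.
have dM := @der_mxM _ _ _ (fun e => 'X_(mxvec_index 1 e) : entryRing) (mxvec_index 0) 3.
have dx := polarize_gmx 0 1 0; have dy := polarize_gmx 0 1 1.
rewrite /polarize der_tr dM (lower_core dD dM) // (lower_shuffle dD dM) // mul0r add0r.
by rewrite -raddfMn /= -mulrnAr.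
Qed.

Lemma gen_trace_raise0 i : polarize 1 0 (gen_trace i 0) = 0.
Proof.
have dD := @der_mxD _ _ _ (fun e => 'X_(mxvec_index 0 e) : entryRing) (mxvec_index 1) 4.
have dM := @der_mxM _ _ _ (fun e => 'X_(mxvec_index 0 e) : entryRing) (mxvec_index 1) 3.
have dx := polarize_gmx 1 0 0; have dy := polarize_gmx 1 0 1.
rewrite /polarize der_tr dM (raise_core dD dM) // (raise_shuffle0 _ dM) //.
by rewrite mul0r mulr0 addr0 linear0.
Qed.

Lemma gen_trace_raise i k : polarize 1 0 (gen_trace i k.+1) = gen_trace i k *+ (a_ i - k).
Proof.
have dD := @der_mxD _ _ _ (fun e => 'X_(mxvec_index 0 e) : entryRing) (mxvec_index 1) 4.
have dM := @der_mxM _ _ _ (fun e => 'X_(mxvec_index 0 e) : entryRing) (mxvec_index 1) 3.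
have dx := polarize_gmx 1 0 0; have dy := polarize_gmx 1 0 1.
rewrite /polarize der_tr dM (raise_core dD dM) // (raise_shuffle dD dM) // mul0r add0r.
by rewrite -raddfMn /= -mulrnAr.
Qed.

Hypothesis charK0 : [pchar K] =i pred0.

Lemma natr_neq0 n : (0 < n)%N -> n%:R != 0 :> K.
Proof. by move/pcharf0P: charK0 => -> n0; rewrite -lt0n. Qed.

(** Passing from k to k + 1, [phi] divides by a_i - k while the polarization multiplies the trace by
    k + 1; the quotients (k + 1) / (a_i - k) accumulate to the inverse binomial. *)
Lemma phiE i k : (k <= a_ i)%N -> phi K i k = 'C(a_ i, k)%:R^-1 *: gen_trace i k.
Proof.
elim: k => [|k IH] ka /=.
  rewrite bin0 invr1 scale1r /gen_trace shuffle0 /w /core.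
  by case: eqP => [->|_]; rewrite ?expr0 ?mulr1.
rewrite IH; last exact: ltnW.
rewrite Delta1E /polarize linearZ /= -/(polarize 0 1) gen_trace_lower scalerA.
rewrite -scaler_nat scalerA; congr (_ *: _).
have nz : (a_ i - k)%:R != 0 :> K by rewrite natr_neq0 // subn_gt0.
have nzC : 'C(a_ i, k)%:R != 0 :> K by rewrite natr_neq0 // bin_gt0 ltnW.
have nzC' : 'C(a_ i, k.+1)%:R != 0 :> K by rewrite natr_neq0 // bin_gt0.
have -> : k.+1%:R = (a_ i - k)%:R * 'C(a_ i, k)%:R / 'C(a_ i, k.+1)%:R :> K.
  by apply: (mulIf nzC'); rewrite mulfVK // -!natrM mul_bin_left.
by move: nz nzC nzC'; do 3![move: _%:R => ?] => nz nzC nzC'; field; rewrite nz nzC nzC'.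
Qed.

Lemma phi_lower i k : (k <= a_ i)%N ->
  polarize 0 1 (phi K i k) = (a_ i - k)%:R *: phi K i k.+1.
Proof.
(* For k < a_i this is the definition of [phi]. At k = a_i both sides vanish: on the left no word of
   length a_i has a_i + 1 letters y. *)
rewrite leq_eqVlt => /predU1P[->|ka]; last first.
  by rewrite /= Delta1E scalerA divff ?scale1r // natr_neq0 // subn_gt0.
rewrite subnn scale0r phiE // /polarize linearZ /= -/(polarize 0 1) gen_trace_lower.
by rewrite gen_trace_gt // mul0rn scaler0.
Qed.

Lemma phi_raise i k : (k <= a_ i)%N ->
  polarize 1 0 (phi K i k) = k%:R *: phi K i k.-1.
Proof.
case: k => [|k] ka; rewrite phiE // /polarize linearZ /= -/(polarize 1 0).
  by rewrite gen_trace_raise0 scaler0 scale0r.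
rewrite gen_trace_raise phiE ?(ltnW ka) // -scaler_nat !scalerA; congr (_ *: _).
have nz : (a_ i - k)%:R != 0 :> K by rewrite natr_neq0 // subn_gt0.
have nzC : 'C(a_ i, k)%:R != 0 :> K by rewrite natr_neq0 // bin_gt0 ltnW.
have nzC' : 'C(a_ i, k.+1)%:R != 0 :> K by rewrite natr_neq0 // bin_gt0.
have -> : k.+1%:R = (a_ i - k)%:R * 'C(a_ i, k)%:R / 'C(a_ i, k.+1)%:R :> K.
  by apply: (mulIf nzC'); rewrite mulfVK // -!natrM mul_bin_left.
by move: nz nzC nzC'; do 3![move: _%:R => ?] => nz nzC nzC'; field; rewrite nzC nzC'.
Qed.

Lemma evalG_zG i j k : (i, j, k) \in basisG -> evalG (zG K i j k) = phi K i k.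
Proof.
move=> b; rewrite /zG b /evalG comp_mpolyXU -tnth_nth tnth_mktuple -/(idxG i j k).
by have [-> _ ->] := tripG_idxG b.
Qed.

(** The operator F of the overview, x^j y^k |-> j x^(j-1) y^(k+1) on each generator; for j = 0 the
    coefficient 0 makes the predecessor harmless. *)
Definition lowerG : KG0 -> KG0 :=
  der (fun v => (xexp v)%:R *: zG K (fam v) (xexp v).-1 (yexp v).+1) id.

(** The operator E of the overview, that is [DeltaG] written as an instance of [der]. *)
Definition raiseG : KG0 -> KG0 :=
  der (fun v => (yexp v)%:R *: zG K (fam v) (xexp v).+1 (yexp v).-1) id.

HB.instance Definition _ := GRing.Linear.on lowerG.
HB.instance Definition _ := GRing.Linear.on raiseG.

Lemma DeltaGE p : DeltaG p = raiseG p.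
Proof. by rewrite /raiseG [der]unlock. Qed.

Lemma lowerG_X v :
  lowerG 'X_v = (xexp v)%:R *: zG K (fam v) (xexp v).-1 (yexp v).+1.
Proof. by rewrite /lowerG der_gen (big_pred1 v). Qed.

Lemma raiseG_X v :
  raiseG 'X_v = (yexp v)%:R *: zG K (fam v) (xexp v).+1 (yexp v).-1.
Proof. by rewrite /raiseG der_gen (big_pred1 v). Qed.

Lemma evalG_lowerG p : evalG (lowerG p) = polarize 0 1 (evalG p).
Proof.
symmetry; apply: der_comp => v; rewrite -/(lowerG 'X_v) lowerG_X -/(evalG _).
rewrite /evalG comp_mpolyZ -/(evalG _) tnth_mktuple.
have xy := xexp_yexp v; have := fam_bounds v => fb.
rewrite -/(polarize 0 1 _) phi_lower -?xy ?leq_addl // addnK.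
case E: (xexp v) => [|x] /=; first by rewrite !scale0r.
by rewrite evalG_zG // mem_basisG fb /= -xy E addnS.
Qed.

Lemma evalG_raiseG p : evalG (raiseG p) = polarize 1 0 (evalG p).
Proof.
symmetry; apply: der_comp => v; rewrite -/(raiseG 'X_v) raiseG_X -/(evalG _).
rewrite /evalG comp_mpolyZ -/(evalG _) tnth_mktuple.
have xy := xexp_yexp v; have := fam_bounds v => fb.
rewrite -/(polarize 1 0 _) phi_raise -?xy ?leq_addl //.
case E: (yexp v) => [|y] /=; first by rewrite !scale0r.
by rewrite evalG_zG // mem_basisG fb /= -xy E addnS.
Qed.

Lemma J_lowerG p : J p -> J (lowerG p).
Proof. by rewrite /J evalG_lowerG => ->; rewrite /polarize linear0. Qed.

Lemma J_raiseG p : J p -> J (raiseG p).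
Proof. by rewrite /J evalG_raiseG => ->; rewrite /polarize linear0. Qed.

End GeneratorDerivations.

(** * Relations as consequences of the fundamental trace identity *)

(* Sparse polynomials in the generators of K[G_0], which are numbered as in basisG. *)
Notation spoly := (seq (Z * seq nat)).

Definition pol (K : fieldType) (l : spoly) : {mpoly K[30]} :=
  \sum_(cv <- l) zr {mpoly K[30]} cv.1 * \prod_(v <- cv.2) 'X_(inord v).

Notation wpoly := (seq (Z * word)).

Definition wpoly_mul (p q : wpoly) : wpoly :=
  flatten [seq [seq (Z.mul cu.1 cv.1, cu.2 ++ cv.2) | cv <- q] | cu <- p].

Fixpoint wpoly_exp (p : wpoly) (n : nat) : wpoly :=
  if n is n.+1 then wpoly_mul p (wpoly_exp p n) else [:: (Zpos xH, [::])].

Definition commutator_wpoly : wpoly :=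
  [:: (Zpos xH, [:: false; true]); (Zneg xH, [:: true; false])].

Definition core_wpoly (i : nat) : wpoly :=
  if i == 12%N then
    wpoly_mul (wpoly_exp commutator_wpoly 3)
      [:: (Zpos xH, [:: false; false; true; true]);
          (Zneg xH, [:: false; true; true; false]);
          (Zneg xH, [:: true; false; false; true]);
          (Zpos xH, [:: true; true; false; false])]
  else wpoly_exp commutator_wpoly (b_ i).

Fixpoint shuffle_words (a k : nat) : seq word :=
  match a, k with
  | 0, 0 => [:: [::]]
  | 0, _.+1 => [::]
  | a.+1, 0 => map (cons false) (shuffle_words a 0)
  | a.+1, k'.+1 =>
      map (cons false) (shuffle_words a k) ++ map (cons true) (shuffle_words a k')
  end.

Fixpoint wpoly_add (c : Z) (w : word) (p : wpoly) : wpoly :=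
  if p is dv :: p' then
    if w == dv.2 then (Z.add c dv.1, w) :: p' else dv :: wpoly_add c w p'
  else [:: (c, w)].

Definition gen_wpoly (i k : nat) : wpoly :=
  wpoly_mul (core_wpoly i) [seq (Zpos xH, w) | w <- shuffle_words (a_ i) k].

(** [gen_trace] as a combination of traces of necklaces, with cyclically equal words merged before
    the products of generators are expanded. *)
Definition gen_tpoly (i k : nat) : tpoly :=
  [seq (cw.1, [:: cw.2]) |
    cw <- foldr (fun cw => wpoly_add cw.1 (necklace cw.2)) [::] (gen_wpoly i k)
    & ~~ Z.eqb cw.1 Z0].

Definition gen_table : seq tpoly := [seq gen_tpoly ijk.1.1 ijk.2 | ijk <- basisG].

Definition binom_table : seq Z :=
  [seq Z.of_nat 'C(a_ ijk.1.1, ijk.2) | ijk <- basisG].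

Definition prod_binom (vs : seq nat) : Z :=
  foldr (fun v => Z.mul (nth Z0 binom_table v)) (Zpos xH) vs.

(** Writing the generators as integral traces divides the coefficient of a monomial by a product of
    binomials; D is a common denominator. [relation_check] verifies that the division is exact. *)
Definition scaled_coef (D : positive) (cv : Z * seq nat) : Z :=
  Z.div (Z.mul (Zpos D) cv.1) (prod_binom cv.2).

Definition expand (tbl : seq tpoly) (vs : seq nat) : tpoly :=
  foldr (fun v p => tpoly_mul (nth [::] tbl v) p) [:: (Zpos xH, [::])] vs.

(** The bits below the leading one, lowest first: 2 is x, 3 is y, 4 is xx, 6 is xy, 5 is yx. *)
Fixpoint word_of_pos (p : positive) : word :=
  match p with
  | xH => [::]
  | xO p => false :: word_of_pos p
  | xI p => true :: word_of_pos p
  end.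

(* (c, M, ws) stands for c times the product of the traces of the words in M times
   the fundamental trace identity of the words in ws. *)
Notation certificate := (Z * seq positive * seq positive)%type.

Definition certificate_tpoly (cert : certificate) : tpoly :=
  let ws := map word_of_pos cert.2 in
  tpoly_scale cert.1.1 (map word_of_pos cert.1.2) (fund_tpoly (size ws) ws).

(** Accepts when D times the relation plus the certified instances cancels term by term. Each
    instance involves at least five words, which makes it an identity of 4 x 4 matrices. *)
Definition relation_check (D : positive) (l : spoly) (certs : seq certificate) : bool :=
  let tbl := gen_table in
  [&& all (fun cv => Z.eqb (Z.mul (scaled_coef D cv) (prod_binom cv.2))
                           (Z.mul (Zpos D) cv.1)) l,
      all (fun cert => 4 < size cert.2)%N certs,
      all (fun cv => all (ltn^~ 30) cv.2) l
    & trie_null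
        (foldr (fun cert => trie_add_tpoly (certificate_tpoly cert))
          (foldr (fun cv => trie_add_tpoly
                    (tpoly_scale (scaled_coef D cv) [::] (expand tbl cv.2))) Leaf l)
          certs)].

Section GeneratorValue.

Variables (R : comNzRingType) (n : nat) (X : bool -> 'M[R]_n.+1).

Definition wpoly_val (p : wpoly) : 'M[R]_n.+1 :=
  \sum_(cw <- p) zr R cw.1 *: wmx X cw.2.

Lemma wpoly_val_mul p q : wpoly_val (wpoly_mul p q) = wpoly_val p * wpoly_val q.
Proof.
rewrite /wpoly_val big_flatten big_map mulr_suml; apply: eq_bigr => cu _.
rewrite big_map mulr_sumr; apply: eq_bigr => cv _ /=.
by rewrite zrM wmx_cat -scalerAl -scalerAr scalerA.
Qed.

Lemma wpoly_val_exp p k : wpoly_val (wpoly_exp p k) = wpoly_val p ^+ k.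
Proof.
elim: k => [|k IH]; first by rewrite [LHS]big_seq1 zr1 scale1r.
by rewrite wpoly_val_mul IH exprS.
Qed.

Lemma core_wpolyE i : wpoly_val (core_wpoly i) = core (X false) (X true) i.
Proof.
have zN : zr R (Zneg xH) = -1 by rewrite -(zr1 R) -zrN.
have cE : wpoly_val commutator_wpoly = commutator (X false) (X true).
  by rewrite /wpoly_val !big_cons big_nil zN zr1 scale1r scaleN1r addr0 /= !mulr1.
rewrite /core_wpoly /core; case: ifP => _; last by rewrite wpoly_val_exp cE.
rewrite wpoly_val_mul wpoly_val_exp cE; congr (_ * _).
rewrite /wpoly_val !big_cons big_nil zN zr1 !scale1r !scaleN1r addr0 /= !mulr1.
by rewrite !addrA !expr2 !mulrA.
Qed.

Lemma shuffle_wordsE a k :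
  \sum_(w <- shuffle_words a k) wmx X w = shuffle (X false) (X true) a k.
Proof.
elim: a k => [|a IH] [|k] /=.
- exact: big_seq1.
- exact: big_nil.
- by rewrite big_map -mulr_sumr IH.
- by rewrite big_cat !big_map -!mulr_sumr !IH.
Qed.

Lemma gen_wpolyE i k :
  wpoly_val (gen_wpoly i k) = core (X false) (X true) i * shuffle (X false) (X true) (a_ i) k.
Proof.
rewrite wpoly_val_mul core_wpolyE -shuffle_wordsE; congr (_ * _).
by rewrite /wpoly_val big_map; apply: eq_bigr => w _; rewrite zr1 scale1r.
Qed.

Lemma tr_wpoly_add c w p :
  \tr (wpoly_val (wpoly_add c w p)) = \tr (wpoly_val p) + zr R c * \tr (wmx X w).
Proof.
rewrite /wpoly_val; elim: p => [|[d v] p IH] /=.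
  by rewrite big_seq1 big_nil linear0 add0r linearZ.
case: eqP => [->|_]; rewrite !big_cons !linearD /= !linearZ /=.
  by rewrite zrD mulrDl -addrA addrC.
by rewrite IH addrA.
Qed.

Lemma gen_tpolyE i k : tpoly_val X (gen_tpoly i k)
  = \tr (core (X false) (X true) i * shuffle (X false) (X true) (a_ i) k).
Proof.
rewrite -gen_wpolyE /tpoly_val big_map big_filter big_mkcond /=.
set p := foldr _ _ _; transitivity (\tr (wpoly_val p)).
  rewrite /wpoly_val linear_sum /=; apply: eq_bigr => cw _.
  rewrite linearZ /= mono_val_cons /mono_val big_nil mulr1.
  by case: Z.eqb_spec => //= ->; rewrite zr0 mul0r.
rewrite /p; elim: (gen_wpoly i k) => //= cw q IH.
rewrite tr_wpoly_add IH tr_necklace /wpoly_val big_cons linearD linearZ /=.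
exact: addrC.
Qed.

End GeneratorValue.

Section RelationCheck.

Variable K : fieldType.
Hypothesis charK0 : [pchar K] =i pred0.

Lemma zr_pos_neq0 D : zr K (Zpos D) != 0.
Proof.
rewrite -positive_nat_Z zr_nat natr_neq0 //.
by apply/ltP; apply: Pos2Nat.is_pos.
Qed.

Definition gmx_letter (b : bool) := gmx K (if b then 1 else 0).

Lemma gmx_traceless l : \tr (gmx K l) = 0.
Proof.
rewrite /mxtrace (bigD1 ord_max) //= mxE eqxx /=.
rewrite [X in _ + X](eq_bigr (fun k => entry K l k k)) ?addNr // => k nk.
by rewrite mxE (negbTE nk).
Qed.

Lemma expandE vs : all (ltn^~ 30) vs ->
  tpoly_val gmx_letter (expand gen_table vs)
  = zr _ (prod_binom vs) * evalG (\prod_(v <- vs) 'X_(inord v)).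
Proof.
elim: vs => [_|v vs IH /= /andP[v30 vs30]].
  by rewrite [LHS]big_seq1 /mono_val !big_nil /evalG comp_mpoly1.
rewrite tpoly_val_mul IH // big_cons /evalG rmorphM /= -/(evalG _) zrM -!mulrA.
rewrite [LHS]mulrCA [RHS]mulrCA; congr (_ * _); rewrite [RHS]mulrA; congr (_ * _).
rewrite comp_mpolyXU -tnth_nth tnth_mktuple.
set u : 'I_30 := inord v; have uv : nat_of_ord u = v by rewrite inordK.
rewrite (nth_map (0, 0, 0)%N) ?size_basisG // (nth_map (0, 0, 0)%N) ?size_basisG //.
rewrite -uv -tripGE /= gen_tpolyE phiE // -?xexp_yexp ?leq_addl // xexp_yexp zr_nat.
rewrite -/(gen_trace K _ _) -scaler_nat -scalerAl mul1r scalerA divff ?scale1r //.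
by rewrite natr_neq0 // bin_gt0 -xexp_yexp leq_addl.
Qed.

(** Every certificate evaluates to zero at the generic matrices, so D times the relation has the
    value of a null trie. D is invertible in characteristic 0. *)
Lemma relation_checkP D l certs : relation_check D l certs -> evalG (pol K l) = 0.
Proof.
case/and4P=> divl big_certs small null.
have Xt b : \tr (gmx_letter b) = 0 by apply: gmx_traceless.
suff: zr _ (Zpos D) * evalG (pol K l) = 0.
  move/eqP; rewrite mulf_eq0 => /orP[|/eqP //].
  by rewrite -[zr _ _](rmorph_zr (@mpolyC _ K)) mpolyC_eq0 (negbTE (zr_pos_neq0 D)).
rewrite -(trie_val_null (key_val gmx_letter 1) null).
elim: certs big_certs {null} => [_|cert certs IH /= /andP[c5 big_certs]]; last first.
  rewrite trie_val_add_tpoly // tpoly_val_scale fund_tpoly_eq0 ?size_map //.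
  by rewrite mulr0 addr0 IH.
elim: l divl small => [|[c vs] l IH] /=.
  by rewrite /pol big_nil /evalG comp_mpoly0 mulr0.
case/andP=> /Z.eqb_spec cD divl /andP[vs30 small].
rewrite trie_val_add_tpoly // -IH // tpoly_val_scale expandE // /mono_val big_nil mulr1.
have e : zr {mpoly K[2 * (4 * 4)]} (scaled_coef D (c, vs)) * zr _ (prod_binom vs)
    = zr _ (Zpos D) * zr _ c by rewrite -!zrM; congr (zr _ _).
rewrite [X in _ = _ + X]mulrA [X in _ = _ + X * _]e /pol big_cons /evalG rmorphD rmorphM /=.
by rewrite (rmorph_zr (comp_mpoly _)) mulrDr mulrA addrC.
Qed.

End RelationCheck.

(** * The three relations and their certificates *)

Section Certificates.

Local Notation p c vs := (Zpos c, vs%N) (only parsing).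
Local Notation n c vs := (Zneg c, vs%N) (only parsing).

(** The expansion of [v75] in the variables of K[G_0], justified by [v75E]. Within a family the
    number grows with the exponent of x: 0, 1, 2 are z_1^{(0,2)}, z_1^{(1,1)}, z_1^{(2,0)}. *)
Definition v75_spoly : spoly := [:: n 6 [:: 0; 2; 2; 18]; n 4 [:: 0; 2; 23]; n 4 [:: 0; 6; 20]; p
  16 [:: 0; 11; 18]; p 6 [:: 1; 1; 2; 18]; p 24 [:: 1; 1; 23]; n 40 [:: 1; 2; 22]; p 8 [:: 1; 6;
  19]; n 32 [:: 1; 10; 18]; p 20 [:: 2; 2; 21]; p 4 [:: 2; 4; 20]; n 8 [:: 2; 5; 19]; p 16 [:: 2;
  9; 18]; n 1 [:: 2; 12; 18]; p 8 [:: 2; 29]; p 28 [:: 4; 6; 18]; n 48 [:: 4; 28]; n 28 [:: 5; 5;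
  18]; p 96 [:: 5; 27]; n 48 [:: 6; 26]; n 48 [:: 9; 23]; p 96 [:: 10; 22]; n 48 [:: 11; 21]; n 16
  [:: 12; 23]; n 24 [:: 14; 20]; p 4 [:: 17; 18]].

Definition v66'_spoly : spoly := [:: p 3 [:: 0; 5; 20]; n 3 [:: 0; 6; 19]; n 6 [:: 1; 4; 20]; p 6
  [:: 1; 5; 19]; p 3 [:: 2; 3; 20]; n 3 [:: 2; 4; 19]; n 4 [:: 3; 28]; p 12 [:: 4; 27]; n 12 [::
  5; 26]; p 4 [:: 6; 25]; p 6 [:: 13; 20]; n 6 [:: 14; 19]].

Definition v66''_spoly : spoly := [:: n 108 [:: 0; 0; 0; 2; 2; 2]; p 216 [:: 0; 0; 0; 2; 11]; n 84
  [:: 0; 0; 0; 6; 6]; p 324 [:: 0; 0; 1; 1; 2; 2]; n 216 [:: 0; 0; 1; 1; 11]; n 864 [:: 0; 0; 1;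
  2; 10]; p 504 [:: 0; 0; 1; 5; 6]; p 432 [:: 0; 0; 2; 2; 9]; n 180 [:: 0; 0; 2; 2; 12]; n 144 [::
  0; 0; 2; 4; 6]; n 108 [:: 0; 0; 2; 5; 5]; p 216 [:: 0; 0; 2; 17]; n 432 [:: 0; 0; 6; 14]; n 864
  [:: 0; 0; 9; 11]; p 864 [:: 0; 0; 10; 10]; p 216 [:: 0; 0; 11; 12]; n 324 [:: 0; 1; 1; 1; 1; 2];
  p 864 [:: 0; 1; 1; 1; 10]; p 432 [:: 0; 1; 1; 2; 9]; p 360 [:: 0; 1; 1; 2; 12]; n 360 [:: 0; 1;
  1; 4; 6]; n 648 [:: 0; 1; 1; 5; 5]; n 216 [:: 0; 1; 1; 17]; n 864 [:: 0; 1; 2; 2; 8]; p 144 [::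
  0; 1; 2; 3; 6]; p 864 [:: 0; 1; 2; 4; 5]; n 432 [:: 0; 1; 2; 16]; p 1296 [:: 0; 1; 5; 14]; p 432
  [:: 0; 1; 6; 13]; p 1728 [:: 0; 1; 8; 11]; n 1728 [:: 0; 1; 9; 10]; n 864 [:: 0; 1; 10; 12]; p
  216 [:: 0; 2; 2; 2; 7]; n 144 [:: 0; 2; 2; 3; 5]; n 108 [:: 0; 2; 2; 4; 4]; p 216 [:: 0; 2; 2;
  15]; n 432 [:: 0; 2; 4; 14]; n 432 [:: 0; 2; 5; 13]; n 432 [:: 0; 2; 7; 11]; p 432 [:: 0; 2; 9;
  9]; p 432 [:: 0; 2; 9; 12]; p 33 [:: 0; 2; 12; 12]; p 144 [:: 0; 3; 5; 11]; n 144 [:: 0; 3; 6;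
  10]; n 432 [:: 0; 4; 5; 10]; p 432 [:: 0; 4; 6; 9]; p 180 [:: 0; 4; 6; 12]; p 432 [:: 0; 5; 5;
  9]; n 180 [:: 0; 5; 5; 12]; n 576 [:: 0; 5; 6; 8]; p 144 [:: 0; 6; 6; 7]; n 432 [:: 0; 9; 17]; p
  864 [:: 0; 10; 16]; n 432 [:: 0; 11; 15]; p 36 [:: 0; 12; 17]; n 432 [:: 0; 14; 14]; p 108 [::
  1; 1; 1; 1; 1; 1]; n 864 [:: 1; 1; 1; 1; 9]; n 180 [:: 1; 1; 1; 1; 12]; p 864 [:: 1; 1; 1; 2;
  8]; p 24 [:: 1; 1; 1; 3; 6]; p 648 [:: 1; 1; 1; 4; 5]; p 432 [:: 1; 1; 1; 16]; n 216 [:: 1; 1;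
  2; 2; 7]; n 360 [:: 1; 1; 2; 3; 5]; n 648 [:: 1; 1; 2; 4; 4]; n 216 [:: 1; 1; 2; 15]; n 864 [::
  1; 1; 4; 14]; n 864 [:: 1; 1; 5; 13]; n 432 [:: 1; 1; 7; 11]; n 1728 [:: 1; 1; 8; 10]; p 2160
  [:: 1; 1; 9; 9]; p 864 [:: 1; 1; 9; 12]; n 33 [:: 1; 1; 12; 12]; p 504 [:: 1; 2; 2; 3; 4]; p 432
  [:: 1; 2; 3; 14]; p 1296 [:: 1; 2; 4; 13]; p 1728 [:: 1; 2; 7; 10]; n 1728 [:: 1; 2; 8; 9]; n
  864 [:: 1; 2; 8; 12]; n 288 [:: 1; 3; 4; 11]; p 288 [:: 1; 3; 5; 10]; n 180 [:: 1; 3; 6; 12]; p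
  864 [:: 1; 4; 4; 10]; n 1728 [:: 1; 4; 5; 9]; p 180 [:: 1; 4; 5; 12]; p 288 [:: 1; 4; 6; 8]; p
  864 [:: 1; 5; 5; 8]; n 288 [:: 1; 5; 6; 7]; p 864 [:: 1; 8; 17]; n 1728 [:: 1; 9; 16]; p 864 [::
  1; 10; 15]; n 72 [:: 1; 12; 16]; p 864 [:: 1; 13; 14]; n 84 [:: 2; 2; 2; 3; 3]; n 432 [:: 2; 2;
  3; 13]; n 864 [:: 2; 2; 7; 9]; p 216 [:: 2; 2; 7; 12]; p 864 [:: 2; 2; 8; 8]; p 144 [:: 2; 3; 3;
  11]; n 576 [:: 2; 3; 4; 10]; p 432 [:: 2; 3; 5; 9]; p 180 [:: 2; 3; 5; 12]; n 144 [:: 2; 3; 6;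
  8]; p 432 [:: 2; 4; 4; 9]; n 180 [:: 2; 4; 4; 12]; n 432 [:: 2; 4; 5; 8]; p 144 [:: 2; 4; 6; 7];
  n 432 [:: 2; 7; 17]; p 864 [:: 2; 8; 16]; n 432 [:: 2; 9; 15]; p 36 [:: 2; 12; 15]; n 432 [:: 2;
  13; 13]; n 36 [:: 3; 3; 6; 6]; p 216 [:: 3; 4; 5; 6]; n 144 [:: 3; 5; 5; 5]; n 432 [:: 3; 5;
  17]; p 432 [:: 3; 6; 16]; n 576 [:: 3; 10; 14]; p 576 [:: 3; 11; 13]; n 144 [:: 4; 4; 4; 6]; p
  108 [:: 4; 4; 5; 5]; p 432 [:: 4; 4; 17]; n 432 [:: 4; 5; 16]; n 432 [:: 4; 6; 15]; p 1728 [::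
  4; 9; 14]; n 1728 [:: 4; 10; 13]; p 432 [:: 5; 5; 15]; n 1728 [:: 5; 8; 14]; p 1728 [:: 5; 9;
  13]; p 576 [:: 6; 7; 14]; n 576 [:: 6; 8; 13]; p 1728 [:: 7; 9; 11]; n 1728 [:: 7; 10; 10]; n
  144 [:: 7; 11; 12]; n 1728 [:: 8; 8; 11]; p 3456 [:: 8; 9; 10]; p 576 [:: 8; 10; 12]; n 1728 [::
  9; 9; 9]; n 432 [:: 9; 9; 12]; p 56 [:: 12; 12; 12]; n 144 [:: 12; 24]; n 432 [:: 15; 17]; p 432
  [:: 16; 16]; p 96 [:: 18; 18]].

Local Notation P c M u v w x y :=
  (Zpos c, M%positive, [:: u; v; w; x; y]%positive) (only parsing).
Local Notation N c M u v w x y :=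
  (Zneg c, M%positive, [:: u; v; w; x; y]%positive) (only parsing).

(** The first entry reads: -25020 tr(x^2)^2 tr(x^2 y) times the fundamental trace identity of x, y,
    y, y, y. *)
Definition v75_certificates : seq certificate := [:: N 25020 [:: 4; 4; 12] 2 3 3 3 3; N 9480 [::
  4; 8; 6] 2 3 3 3 3; N 9180 [:: 4; 48] 2 3 3 3 3; P 2400 [:: 8; 24] 2 3 3 3 3; P 92700 [:: 16;
  12] 2 3 3 3 3; P 3570 [:: 4; 4; 4] 2 3 3 3 7; P 4760 [:: 8; 8] 2 3 3 3 7; N 14280 [:: 64] 2 3 3
  3 7; P 15840 [:: 4; 56] 2 2 3 3 3; P 35280 [:: 4; 52] 2 2 3 3 3; N 29520 [:: 8; 6; 6] 2 2 3 3 3;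
  P 108720 [:: 48; 6] 2 2 3 3 3; P 18576 [:: 32; 7] 2 2 3 3 3; P 17760 [:: 8; 28] 2 2 3 3 3; P
  22800 [:: 8; 26] 2 2 3 3 3; N 80640 [:: 24; 12] 2 2 3 3 3; N 46080 [:: 224] 2 2 3 3 3; N 70560
  [:: 208] 2 2 3 3 3; N 38880 [:: 200] 2 2 3 3 3; P 138240 [:: 96] 2 2 3 3 7; N 40320 [:: 4; 24] 2
  3 3 3 6; P 17280 [:: 16; 6] 2 3 3 3 6; N 61440 [:: 8; 12] 2 3 3 3 6; N 11070 [:: 4; 4; 6] 3 3 3
  3 4; N 17100 [:: 16; 6] 3 3 3 3 4; P 80880 [:: 8; 12] 3 3 3 3 4; P 41760 [:: 96] 3 3 3 3 4; P
  16200 [:: 4; 8] 3 3 3 3 12; P 12480 [:: 4; 8] 3 3 3 3 10; N 29952 [:: 32] 3 3 3 6 6; P 840 [::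
  4; 4; 15] 2 2 2 3 3; N 8640 [:: 4; 6; 14] 2 2 2 3 3; N 24120 [:: 4; 12; 7] 2 2 2 3 3; P 23760
  [:: 4; 60] 2 2 2 3 3; N 10800 [:: 4; 58] 2 2 2 3 3; N 25200 [:: 52; 6] 2 2 2 3 3; N 13680 [::
  48; 7] 2 2 2 3 3; P 30000 [:: 8; 30] 2 2 2 3 3; P 34560 [:: 12; 28] 2 2 2 3 3; N 56880 [:: 12;
  26] 2 2 2 3 3; P 720 [:: 24; 14] 2 2 2 3 3; N 31680 [:: 240] 2 2 2 3 3; P 2160 [:: 232] 2 2 2 3
  3; P 19440 [:: 216] 2 2 2 3 3; N 34560 [:: 228] 2 2 2 3 3; P 50400 [:: 212] 2 2 2 3 3; P 4320
  [:: 4; 26] 2 2 2 3 7; N 28800 [:: 24; 6] 2 2 2 3 7; N 144960 [:: 12; 12] 2 2 2 3 7; P 11520 [::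
  104] 2 2 2 3 7; N 8640 [:: 100] 2 2 2 3 7; P 63360 [:: 12; 12] 2 2 3 3 6; P 66960 [:: 4; 12] 2 2
  2 3 15; N 11760 [:: 8; 6] 2 2 2 7 7; P 36000 [:: 8; 6] 2 3 3 3 12; N 69840 [:: 4; 12] 2 3 3 3
  10; P 6240 [:: 8; 6] 2 3 3 3 10; P 123120 [:: 4; 12] 3 3 3 3 8; P 53760 [:: 8; 6] 3 3 3 3 8; P
  21600 [:: 16] 2 3 3 3 22; N 10080 [:: 16] 2 3 3 3 19; N 10800 [:: 4; 4] 3 3 3 3 24; P 24120 [::
  16] 3 3 3 3 24; P 6480 [:: 4; 4] 3 3 3 3 20; P 27180 [:: 4; 4] 3 3 3 3 18; N 16200 [:: 16] 3 3 3
  3 18; N 1350 [:: 4; 14; 7] 2 2 2 2 3; P 9180 [:: 4; 62] 2 2 2 2 3; P 52200 [:: 6; 6; 14] 2 2 2 2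
  3; P 8460 [:: 12; 6; 7] 2 2 2 2 3; N 42120 [:: 60; 6] 2 2 2 2 3; N 53280 [:: 6; 58] 2 2 2 2 3; N
  8250 [:: 8; 7; 7] 2 2 2 2 3; P 14040 [:: 56; 7] 2 2 2 2 3; P 16200 [:: 52; 7] 2 2 2 2 3; N 37380
  [:: 8; 31] 2 2 2 2 3; P 67680 [:: 12; 30] 2 2 2 2 3; N 11520 [:: 28; 14] 2 2 2 2 3; N 1680 [::
  24; 15] 2 2 2 2 3; N 1440 [:: 244] 2 2 2 2 3; P 10800 [:: 4; 30] 2 2 2 2 7; N 2160 [:: 6; 6; 6]
  2 2 2 2 7; N 6480 [:: 28; 6] 2 2 2 2 7; N 15840 [:: 6; 26] 2 2 2 2 7; P 2360 [:: 8; 15] 2 2 2 2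
  7; N 36720 [:: 12; 14] 2 2 2 2 7; N 20160 [:: 120] 2 2 2 2 7; N 19440 [:: 116] 2 2 2 2 7; N 2160
  [:: 108] 2 2 2 2 7; N 4320 [:: 4; 6; 7] 2 2 2 3 6; N 8640 [:: 4; 30] 2 2 2 3 6; N 8640 [:: 28;
  6] 2 2 2 3 6; N 38240 [:: 8; 15] 2 2 2 3 6; P 60480 [:: 12; 14] 2 2 2 3 6; N 11520 [:: 120] 2 2
  2 3 6; P 17280 [:: 108] 2 2 2 3 6; N 23400 [:: 4; 14] 2 2 2 2 15; N 90720 [:: 12; 6] 2 2 2 2 15;
  P 32040 [:: 8; 7] 2 2 2 2 15; P 1440 [:: 56] 2 2 2 2 15; N 8640 [:: 52] 2 2 2 2 15; P 113760 [::
  12; 6] 2 2 2 3 13; P 45600 [:: 8; 7] 2 2 2 3 13; N 50400 [:: 56] 2 2 2 3 13; N 21600 [:: 52] 2 2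
  2 3 13; N 32400 [:: 4; 14] 2 3 3 3 8; N 46080 [:: 12; 6] 2 3 3 3 8; N 67920 [:: 8; 7] 2 3 3 3 8;
  N 5760 [:: 56] 2 3 3 3 8; P 15840 [:: 4; 14] 3 3 3 4 4; N 35280 [:: 8; 7] 3 3 3 4 4; P 34560 [::
  56] 3 3 3 4 4; P 34560 [:: 52] 3 3 3 4 4; P 17280 [:: 4; 6] 2 2 2 3 30; P 25920 [:: 24] 2 2 2 3
  30; N 31680 [:: 24] 2 2 2 3 29; P 17280 [:: 4; 6] 2 2 2 3 27; P 34560 [:: 24] 2 2 2 7 13; P
  31680 [:: 24] 2 3 3 3 24; P 8640 [:: 24] 2 3 3 3 20; N 34560 [:: 24] 2 3 3 3 18; P 39240 [:: 4;
  6] 3 3 3 3 16; N 7920 [:: 24] 3 3 3 3 16; P 20160 [:: 4; 6] 3 3 3 4 12; P 24000 [:: 8] 2 3 3 3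
  52; P 25920 [:: 8] 2 3 3 3 44; P 43200 [:: 8] 2 3 3 3 50; P 27840 [:: 8] 2 3 3 3 42; P 62400 [::
  8] 2 3 3 3 49; N 51120 [:: 8] 3 3 3 3 48; P 16080 [:: 8] 3 3 3 3 40; N 33600 [:: 8] 3 3 3 3 36;
  N 80880 [:: 8] 3 3 3 3 34; P 2400 [:: 8] 3 3 3 12 12; N 11520 [:: 8] 3 6 6 6 6; P 1548 [:: 4; 7;
  15] 2 2 2 2 2; P 5616 [:: 6; 6; 15] 2 2 2 2 2; P 5976 [:: 6; 14; 7] 2 2 2 2 2; N 14976 [:: 6;
  62] 2 2 2 2 2; P 29394 [:: 12; 7; 7] 2 2 2 2 2; N 9288 [:: 60; 7] 2 2 2 2 2; N 16776 [:: 58; 7]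
  2 2 2 2 2; N 49500 [:: 12; 31] 2 2 2 2 2; P 6624 [:: 14; 30] 2 2 2 2 2; N 3840 [:: 28; 15] 2 2 2
  2 2; N 2496 [:: 26; 15] 2 2 2 2 2; P 14976 [:: 250] 2 2 2 2 2; P 14976 [:: 246] 2 2 2 2 2; P
  5715 [:: 4; 7; 7] 2 2 2 2 6; N 11430 [:: 4; 31] 2 2 2 2 6; P 6480 [:: 6; 6; 7] 2 2 2 2 6; P
  44640 [:: 6; 30] 2 2 2 2 6; P 48600 [:: 28; 7] 2 2 2 2 6; P 16560 [:: 26; 7] 2 2 2 2 6; P 44640
  [:: 14; 14] 2 2 2 2 6; N 120240 [:: 124] 2 2 2 2 6; N 56160 [:: 122] 2 2 2 2 6; N 23040 [:: 118]
  2 2 2 2 6; N 240 [:: 4; 15] 2 2 2 2 14; N 21600 [:: 6; 14] 2 2 2 2 14; N 114120 [:: 12; 7] 2 2 2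
  2 14; P 12960 [:: 58] 2 2 2 2 14; P 21840 [:: 4; 15] 2 2 2 2 13; N 40320 [:: 6; 14] 2 2 2 2 13;
  N 56160 [:: 12; 7] 2 2 2 2 13; P 13680 [:: 60] 2 2 2 2 13; P 34560 [:: 58] 2 2 2 2 13; N 82080
  [:: 4; 15] 2 2 2 3 10; P 102240 [:: 12; 7] 2 2 2 3 10; P 4320 [:: 58] 2 2 2 3 10; P 24480 [::
  60] 2 2 2 6 6; N 57600 [:: 6; 6] 2 2 2 2 30; P 23040 [:: 28] 2 2 2 2 30; P 23040 [:: 26] 2 2 2 2
  30; P 10980 [:: 4; 7] 2 2 2 2 29; P 9360 [:: 6; 6] 2 2 2 2 29; P 2160 [:: 28] 2 2 2 2 29; N 8640
  [:: 26] 2 2 2 2 29; N 360 [:: 4; 7] 2 2 2 2 27; N 22320 [:: 6; 6] 2 2 2 2 27; P 11520 [:: 28] 2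
  2 2 2 27; P 25920 [:: 26] 2 2 2 2 27; N 63360 [:: 26] 2 2 2 3 28; N 75600 [:: 4; 7] 2 2 2 3 22;
  N 1440 [:: 4; 7] 2 2 2 3 25; P 28800 [:: 26] 2 2 2 3 25; N 8640 [:: 6; 6] 2 3 3 3 16; N 46080
  [:: 28] 2 3 3 3 16; P 46080 [:: 6; 6] 3 3 3 4 8; P 313200 [:: 12] 2 2 2 2 62; P 41760 [:: 12] 2
  2 2 2 61; P 15840 [:: 12] 2 2 2 2 55; N 236160 [:: 12] 2 2 2 3 46; N 138240 [:: 12] 2 2 2 3 43;
  N 92160 [:: 12] 2 2 2 13 13; P 69120 [:: 12] 2 3 3 3 36; P 201600 [:: 12] 2 3 3 3 34; P 31680
  [:: 12] 2 6 6 6 6; N 198000 [:: 12] 3 3 3 3 32; N 8640 [:: 4] 2 2 2 2 123; N 34200 [:: 4] 2 2 2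
  2 119; P 146880 [:: 4] 2 2 2 3 121; P 21600 [:: 4] 2 2 2 3 109; P 40320 [:: 4] 2 2 2 3 103; P
  7200 [:: 4] 2 2 2 7 51; N 38880 [:: 4] 2 3 3 3 88; P 23040 [:: 4] 2 3 3 3 76; N 56160 [:: 4] 2 3
  3 3 82; P 46080 [:: 4] 2 3 3 3 74; P 24480 [:: 4] 2 3 3 3 70; N 8640 [:: 4] 2 3 3 3 97; P 5760
  [:: 4] 2 3 3 3 81; N 25920 [:: 4] 3 3 3 3 96; N 23760 [:: 4] 3 3 3 3 68; N 83880 [:: 4] 3 3 3 3
  66; P 1785 [:: 6; 7; 7] 2 2 2 2 4; N 3570 [:: 6; 31] 2 2 2 2 4; N 7140 [:: 30; 7] 2 2 2 2 4; P
  2440 [:: 14; 15] 2 2 2 2 4; P 14280 [:: 126] 2 2 2 2 4; N 480 [:: 6; 15] 2 2 2 2 12; P 21600 [::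
  14; 7] 2 2 2 2 12; N 8640 [:: 6; 7] 2 2 2 2 28; N 23040 [:: 30] 2 2 2 2 28; N 9360 [:: 6; 7] 2 2
  2 2 26; N 40320 [:: 30] 2 2 2 2 26; N 25200 [:: 6; 7] 2 2 2 2 25; P 20880 [:: 30] 2 2 2 2 25; P
  31680 [:: 6; 7] 2 2 2 3 20; N 21600 [:: 14] 2 2 2 2 60; N 53280 [:: 14] 2 2 2 2 58; N 2880 [::
  14] 2 2 2 2 54; P 8640 [:: 14] 2 2 2 2 57; N 12960 [:: 14] 2 2 2 2 53; P 9360 [:: 14] 2 2 2 2
  51; N 86400 [:: 14] 2 2 2 3 56; P 14400 [:: 14] 2 2 2 3 42; P 77760 [:: 14] 2 2 2 3 49; P 86400
  [:: 14] 2 3 3 3 32; P 106560 [:: 6] 2 2 2 2 124; P 46080 [:: 6] 2 2 2 2 122; N 1440 [:: 6] 2 2 2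
  2 118; P 33120 [:: 6] 2 2 2 2 110; N 13680 [:: 6] 2 2 2 2 121; N 8640 [:: 6] 2 2 2 2 117; P
  20160 [:: 6] 2 2 2 2 109; N 17280 [:: 6] 2 2 2 2 115; P 20160 [:: 6] 2 2 2 2 107; P 3600 [:: 6]
  2 2 2 2 103; N 63360 [:: 6] 2 2 2 3 114; P 63360 [:: 6] 2 2 2 3 102; N 34560 [:: 6] 2 2 2 3 86;
  N 155520 [:: 6] 2 2 2 3 78; P 63360 [:: 6] 2 2 2 3 99; P 5760 [:: 6] 2 2 2 14 19; N 28800 [:: 6]
  2 2 2 13 25; P 11520 [:: 6] 2 3 3 3 80; P 63360 [:: 6] 2 3 3 3 72; N 34560 [:: 6] 2 3 3 3 68; N
  46080 [:: 6] 2 3 3 3 66; P 23040 [:: 15] 2 2 2 2 52; N 4320 [:: 15] 2 2 2 2 50; N 47040 [:: 15]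
  2 2 2 2 49; P 25920 [:: 7] 2 2 2 2 120; N 18360 [:: 7] 2 2 2 2 116; P 55800 [:: 7] 2 2 2 2 108;
  N 21600 [:: 7] 2 2 2 2 102; P 4320 [:: 7] 2 2 2 2 113; P 19080 [:: 7] 2 2 2 2 105; P 2520 [:: 7]
  2 2 2 2 101; N 53280 [:: 7] 2 2 2 2 99; N 69120 [:: 7] 2 2 2 3 84; P 17280 [:: 7] 2 2 2 3 98; P
  21600 [:: 7] 2 2 2 3 82; N 51840 [::] 2 2 2 2 504; P 3600 [::] 2 2 2 2 500; P 23040 [::] 2 2 2 2
  492; N 111600 [::] 2 2 2 2 444; N 100800 [::] 2 2 2 2 498; P 21600 [::] 2 2 2 2 490; P 23040
  [::] 2 2 2 2 474; N 31680 [::] 2 2 2 2 442; P 23040 [::] 2 2 2 2 486; P 10080 [::] 2 2 2 2 470;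
  P 11520 [::] 2 2 2 2 438; P 4320 [::] 2 2 2 2 430; N 64800 [::] 2 2 2 2 414; N 66960 [::] 2 2 2
  2 497; P 16560 [::] 2 2 2 2 489; N 17280 [::] 2 2 2 2 473; N 7200 [::] 2 2 2 2 441; P 64800 [::]
  2 2 2 2 485; P 5760 [::] 2 2 2 2 469; P 1440 [::] 2 2 2 2 437; P 26640 [::] 2 2 2 2 461; N 2880
  [::] 2 2 2 2 429; N 28800 [::] 2 2 2 2 413; P 46800 [::] 2 2 2 2 483; P 17280 [::] 2 2 2 2 467;
  P 17280 [::] 2 2 2 2 459; P 3600 [::] 2 2 2 2 411; P 66240 [::] 2 2 2 2 455; P 51840 [::] 2 2 2
  2 423; P 30960 [::] 2 2 2 2 407; P 92160 [::] 2 2 2 2 399; P 132480 [::] 2 2 2 3 488; P 432000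
  [::] 2 2 2 3 316; P 69120 [::] 2 2 2 3 434; N 34560 [::] 2 2 2 3 370; P 11520 [::] 2 2 2 3 346;
  N 69120 [::] 2 2 2 3 406; P 34560 [::] 2 2 2 3 334; P 132480 [::] 2 2 2 3 302; N 241920 [::] 2 2
  2 3 481; N 57600 [::] 2 2 2 3 425; P 63360 [::] 2 2 2 3 453; N 132480 [::] 2 2 2 3 395; N 164160
  [::] 2 2 2 3 391; N 63360 [::] 2 2 2 3 327; P 57600 [::] 2 2 2 13 101; N 92160 [::] 2 2 2 15 88;
  P 5760 [::] 2 2 2 26 43; N 69120 [::] 2 2 2 29 44; N 28800 [::] 2 2 2 23 50; N 92160 [::] 2 3 3
  3 416; N 23040 [::] 2 3 3 3 336; P 126720 [::] 2 3 3 3 328; P 69120 [::] 2 3 3 3 280; N 14400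
  [::] 2 3 3 3 388; N 46080 [::] 2 3 3 3 261; P 51840 [::] 3 3 3 3 384; N 11520 [::] 3 3 3 3 320;
  N 120240 [::] 3 3 3 3 264; N 43200 [::] 3 3 3 3 260; P 123120 [::] 3 3 3 3 258; N 69120 [::] 3 3
  3 10 72; P 28800 [::] 3 3 3 10 65; N 37440 [::] 3 3 3 9 80; N 5760 [::] 3 3 3 20 34].

Definition v66'_certificates : seq certificate := [:: N 90 [:: 4; 4; 12] 3 3 3 3 3; P 180 [:: 16;
  12] 3 3 3 3 3; N 360 [:: 192] 3 3 3 3 3; N 360 [:: 4; 16] 3 3 3 3 7; N 160 [:: 8; 8] 3 3 3 3 7;
  P 720 [:: 64] 3 3 3 3 7; P 360 [:: 4; 4; 14] 2 3 3 3 3; P 540 [:: 4; 12; 6] 2 3 3 3 3; P 240 [::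
  4; 8; 7] 2 3 3 3 3; N 360 [:: 4; 56] 2 3 3 3 3; N 1080 [:: 4; 52] 2 3 3 3 3; N 480 [:: 8; 6; 6]
  2 3 3 3 3; P 1440 [:: 48; 6] 2 3 3 3 3; N 240 [:: 8; 26] 2 3 3 3 3; N 720 [:: 16; 14] 2 3 3 3 3;
  N 360 [:: 4; 24] 2 3 3 3 7; N 240 [:: 8; 12] 2 3 3 3 7; P 720 [:: 96] 2 3 3 3 7; P 576 [:: 32] 3
  3 3 3 14; P 240 [:: 4; 4; 15] 2 2 3 3 3; P 1080 [:: 4; 12; 7] 2 2 3 3 3; P 1440 [:: 12; 6; 6] 2
  2 3 3 3; N 1440 [:: 52; 6] 2 2 3 3 3; P 960 [:: 8; 30] 2 2 3 3 3; N 1440 [:: 12; 28] 2 2 3 3 3;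
  P 4320 [:: 24; 14] 2 2 3 3 3; N 2880 [:: 240] 2 2 3 3 3; N 720 [:: 232] 2 2 3 3 3; N 2160 [::
  216] 2 2 3 3 3; P 45 [:: 4; 4; 7] 3 3 3 3 4; P 90 [:: 16; 7] 3 3 3 3 4; N 360 [:: 12; 12] 3 3 3
  3 4; N 720 [:: 4; 12] 2 3 3 3 13; P 360 [:: 4; 4] 3 3 3 3 28; N 240 [:: 4; 6; 15] 2 2 2 3 3; N
  1440 [:: 6; 6; 14] 2 2 2 3 3; N 720 [:: 12; 6; 7] 2 2 2 3 3; P 1440 [:: 6; 58] 2 2 2 3 3; N 120
  [:: 8; 7; 7] 2 2 2 3 3; N 960 [:: 56; 7] 2 2 2 3 3; N 1440 [:: 12; 30] 2 2 2 3 3; N 1440 [:: 28;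
  14] 2 2 2 3 3; N 640 [:: 24; 15] 2 2 2 3 3; P 3360 [:: 248] 2 2 2 3 3; P 720 [:: 244] 2 2 2 3 3;
  P 1440 [:: 236] 2 2 2 3 3; P 2160 [:: 220] 2 2 2 3 3; P 2880 [:: 12; 14] 2 2 2 3 7; P 2880 [::
  12; 6] 2 2 2 3 15; N 2880 [:: 52] 2 2 2 3 15; P 2880 [:: 12; 6] 2 2 2 7 7; P 240 [:: 8; 7] 2 2 2
  7 7; N 1440 [:: 56] 2 2 2 7 7; N 1440 [:: 52] 2 2 2 7 7; P 1440 [:: 4; 14] 2 3 3 3 12; P 1440
  [:: 4; 14] 2 3 3 3 10; N 240 [:: 4; 14] 3 3 3 3 8; N 1920 [:: 12; 6] 3 3 3 3 8; N 200 [:: 8; 7]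
  3 3 3 3 8; P 480 [:: 56] 3 3 3 3 8; P 480 [:: 52] 3 3 3 3 8; P 360 [:: 4; 6] 3 3 3 3 18; P 960
  [:: 8] 2 2 2 15 15; P 240 [:: 8] 3 3 3 3 52; P 480 [:: 8] 3 3 3 3 44; N 240 [:: 8] 3 3 3 3 50; P
  480 [:: 8] 3 3 3 3 42; N 960 [:: 8] 3 3 3 6 26; N 90 [:: 4; 7; 15] 2 2 2 2 3; P 480 [:: 6; 6;
  15] 2 2 2 2 3; N 1440 [:: 6; 62] 2 2 2 2 3; N 270 [:: 12; 7; 7] 2 2 2 2 3; P 720 [:: 58; 7] 2 2
  2 2 3; P 180 [:: 12; 31] 2 2 2 2 3; N 2160 [:: 14; 30] 2 2 2 2 3; N 180 [:: 4; 31] 2 2 2 2 7; N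
  120 [:: 12; 15] 2 2 2 2 7; P 2160 [:: 14; 14] 2 2 2 2 7; P 480 [:: 12; 15] 2 2 2 3 6; N 4320 [::
  14; 14] 2 2 3 3 4; P 2880 [:: 6; 14] 2 2 2 2 15; N 2880 [:: 6; 14] 2 3 3 3 8; N 1440 [:: 12; 7]
  2 3 3 3 8; P 2880 [:: 58] 2 3 3 3 8; N 1440 [:: 6; 14] 3 3 3 4 4; P 720 [:: 12; 7] 3 3 3 4 4; N
  180 [:: 4; 7] 2 2 2 2 31; P 720 [:: 12] 2 2 2 2 63; N 2880 [:: 12] 2 2 2 7 29; P 2880 [:: 12] 2
  3 3 3 44; N 2880 [:: 12] 2 3 3 3 35; P 1440 [:: 12] 3 3 3 3 40; P 720 [:: 12] 3 3 3 3 36; N 1440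
  [:: 12] 3 3 3 3 34; N 1440 [:: 12] 3 3 3 4 25; P 720 [:: 4] 2 2 2 2 127; N 720 [:: 4] 3 3 3 3
  112; N 720 [:: 4] 3 3 3 3 100; P 720 [:: 4] 3 3 3 3 76; N 90 [:: 6; 7; 15] 2 2 2 2 2; N 72 [::
  14; 7; 7] 2 2 2 2 2; P 288 [:: 62; 7] 2 2 2 2 2; P 144 [:: 14; 31] 2 2 2 2 2; P 192 [:: 30; 15]
  2 2 2 2 2; N 576 [:: 254] 2 2 2 2 2; P 360 [:: 30; 7] 2 2 2 2 6; N 480 [:: 14; 15] 2 2 2 2 6; N
  720 [:: 126] 2 2 2 2 6; P 720 [:: 14; 7] 2 2 2 2 13; N 2880 [:: 14; 7] 2 2 2 3 10; N 360 [:: 6;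
  7] 2 2 2 2 27; N 720 [:: 14] 2 2 2 2 61; N 1440 [:: 14] 2 2 2 2 59; N 720 [:: 14] 2 2 2 2 55; P
  8640 [:: 14] 2 2 2 3 46; P 5760 [:: 14] 2 2 2 3 45; N 5760 [:: 14] 2 3 3 3 40; N 2880 [:: 14] 2
  3 3 3 36; P 720 [:: 6] 2 2 2 2 111; N 720 [:: 6] 3 3 3 3 66; N 45 [:: 7; 7; 7] 2 2 2 2 4; P 450
  [:: 7; 31] 2 2 2 2 4; P 160 [:: 15; 15] 2 2 2 2 4; N 720 [:: 127] 2 2 2 2 4; N 360 [:: 7; 15] 2
  2 2 3 8; N 360 [:: 31] 2 2 2 2 28; N 180 [:: 7; 7] 2 2 2 2 25; P 360 [:: 31] 2 2 2 2 25; N 240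
  [:: 15] 2 2 2 2 58; N 240 [:: 15] 2 2 2 2 54; N 480 [:: 15] 2 2 2 2 53; P 960 [:: 15] 2 2 2 3
  42; N 960 [:: 15] 3 3 3 8 8; P 360 [:: 7] 2 2 2 2 124; P 720 [:: 7] 2 2 2 2 121; N 720 [:: 7] 2
  2 2 2 115; N 360 [:: 7] 3 3 3 3 64; P 1440 [::] 2 2 2 2 494; N 1440 [::] 2 2 2 2 505; N 720 [::]
  2 2 2 2 499; N 1440 [::] 2 2 2 2 443; P 2160 [::] 2 2 2 2 463; P 5760 [::] 2 2 2 7 241; P 5760
  [::] 2 2 2 7 151; P 1440 [::] 3 3 3 3 400; P 720 [::] 3 3 3 3 304; N 1440 [::] 3 3 3 3 392; P
  1440 [::] 3 3 3 3 276; N 2160 [::] 3 3 3 3 268; P 1440 [::] 3 3 3 3 290; N 5760 [::] 3 3 3 4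
  184; N 5760 [::] 3 3 3 4 197; N 1440 [::] 3 3 3 7 130].

Definition v66''_certificates : seq certificate := [:: N 3456 [:: 32; 6] 3 3 3 3 3; P 7920 [:: 8;
  24] 3 3 3 3 3; N 14895 [:: 4; 4; 4] 3 3 3 3 7; P 52650 [:: 4; 16] 3 3 3 3 7; P 1800 [:: 8; 8] 3
  3 3 3 7; N 45720 [:: 64] 3 3 3 3 7; N 52920 [:: 4; 4; 14] 2 3 3 3 3; N 51840 [:: 4; 12; 6] 2 3 3
  3 3; N 24120 [:: 4; 8; 7] 2 3 3 3 3; N 32400 [:: 4; 56] 2 3 3 3 3; N 13680 [:: 4; 52] 2 3 3 3 3;
  P 18720 [:: 8; 6; 6] 2 3 3 3 3; N 43200 [:: 48; 6] 2 3 3 3 3; P 5760 [:: 8; 28] 2 3 3 3 3; N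
  9600 [:: 8; 26] 2 3 3 3 3; N 45360 [:: 24; 12] 2 3 3 3 3; P 8640 [:: 16; 14] 2 3 3 3 3; P 8640
  [:: 208] 2 3 3 3 3; N 25920 [:: 200] 2 3 3 3 3; N 12960 [:: 4; 4; 6] 2 3 3 3 7; P 23760 [:: 4;
  24] 2 3 3 3 7; N 25920 [:: 8; 12] 2 3 3 3 7; N 24480 [:: 4; 8] 3 3 3 3 14; P 69660 [:: 4; 4; 15]
  2 2 3 3 3; N 34560 [:: 4; 6; 14] 2 2 3 3 3; N 250560 [:: 4; 60] 2 2 3 3 3; N 169920 [:: 4; 58] 2
  2 3 3 3; N 95040 [:: 12; 6; 6] 2 2 3 3 3; N 54000 [:: 8; 6; 7] 2 2 3 3 3; P 224640 [:: 56; 6] 2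
  2 3 3 3; N 135360 [:: 52; 6] 2 2 3 3 3; P 25920 [:: 48; 7] 2 2 3 3 3; N 23040 [:: 8; 30] 2 2 3 3
  3; N 23040 [:: 12; 28] 2 2 3 3 3; N 89280 [:: 12; 26] 2 2 3 3 3; N 129600 [:: 24; 14] 2 2 3 3 3;
  N 24120 [:: 16; 15] 2 2 3 3 3; P 86400 [:: 240] 2 2 3 3 3; N 60480 [:: 232] 2 2 3 3 3; P 43200
  [:: 216] 2 2 3 3 3; P 305280 [:: 212] 2 2 3 3 3; N 8640 [:: 4; 4; 7] 2 3 3 3 6; P 60480 [:: 4;
  6; 6] 2 3 3 3 6; P 69120 [:: 4; 28] 2 3 3 3 6; N 11520 [:: 4; 26] 2 3 3 3 6; N 172800 [:: 24; 6]
  2 3 3 3 6; P 74880 [:: 8; 14] 2 3 3 3 6; N 207360 [:: 12; 12] 2 3 3 3 6; N 103680 [:: 112] 2 3 3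
  3 6; N 34560 [:: 100] 2 3 3 3 6; P 6480 [:: 4; 6; 6] 3 3 3 3 4; P 88560 [:: 4; 28] 3 3 3 3 4; N
  28080 [:: 24; 6] 3 3 3 3 4; P 35520 [:: 8; 14] 3 3 3 3 4; P 21600 [:: 12; 12] 3 3 3 3 4; N
  188640 [:: 112] 3 3 3 3 4; P 25920 [:: 104] 3 3 3 3 4; P 12960 [:: 100] 3 3 3 3 4; P 51840 [::
  8; 6] 2 3 3 3 13; N 190080 [:: 48] 2 3 3 3 13; P 54720 [:: 8; 6] 3 3 3 3 12; P 17280 [:: 4; 12]
  3 3 3 3 10; N 69120 [:: 8; 6] 3 3 3 3 10; N 17280 [:: 4; 4] 2 3 3 3 29; P 47520 [:: 16] 3 3 3 3
  28; N 8640 [:: 16] 3 3 3 3 26; P 8640 [:: 4; 4] 3 3 3 3 22; P 153360 [:: 4; 14; 7] 2 2 2 3 3; N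
  12960 [:: 4; 62] 2 2 2 3 3; P 112320 [:: 6; 6; 14] 2 2 2 3 3; P 110160 [:: 12; 6; 7] 2 2 2 3 3;
  N 80640 [:: 6; 58] 2 2 2 3 3; P 44640 [:: 8; 7; 7] 2 2 2 3 3; N 144000 [:: 56; 7] 2 2 2 3 3; N
  46080 [:: 52; 7] 2 2 2 3 3; N 11520 [:: 8; 31] 2 2 2 3 3; P 69120 [:: 12; 30] 2 2 2 3 3; N 97920
  [:: 28; 14] 2 2 2 3 3; N 74880 [:: 26; 14] 2 2 2 3 3; N 18240 [:: 24; 15] 2 2 2 3 3; P 97920 [::
  248] 2 2 2 3 3; P 86400 [:: 244] 2 2 2 3 3; P 51840 [:: 236] 2 2 2 3 3; P 120960 [:: 220] 2 2 2
  3 3; P 92160 [:: 234] 2 2 2 3 3; P 8640 [:: 6; 6; 6] 2 2 2 3 7; P 21600 [:: 28; 6] 2 2 2 3 7; N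
  75840 [:: 6; 26] 2 2 2 3 7; P 10080 [:: 12; 14] 2 2 2 3 7; P 77760 [:: 120] 2 2 2 3 7; N 73440
  [:: 116] 2 2 2 3 7; N 4320 [:: 108] 2 2 2 3 7; P 78720 [:: 106] 2 2 2 3 7; N 38880 [:: 4; 30] 2
  2 3 3 6; N 12960 [:: 6; 6; 6] 2 2 3 3 6; P 50400 [:: 6; 26] 2 2 3 3 6; N 38880 [:: 24; 7] 2 2 3
  3 6; N 69120 [:: 12; 14] 2 2 3 3 6; N 25920 [:: 120] 2 2 3 3 6; P 51840 [:: 116] 2 2 3 3 6; P
  51840 [:: 108] 2 2 3 3 6; N 72000 [:: 106] 2 2 3 3 6; N 207360 [:: 4; 14] 2 2 2 3 15; N 155520
  [:: 12; 6] 2 2 2 3 15; N 11520 [:: 52] 2 2 2 3 15; P 43200 [:: 4; 14] 2 2 2 7 7; N 138240 [::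
  12; 6] 2 2 2 7 7; N 155520 [:: 56] 2 2 2 7 7; N 86400 [:: 52] 2 2 2 7 7; P 155520 [:: 4; 14] 2 3
  3 3 10; P 328320 [:: 12; 6] 2 3 3 3 10; N 172800 [:: 56] 2 3 3 3 10; N 92160 [:: 52] 2 3 3 3 10;
  P 93600 [:: 4; 14] 3 3 3 3 8; P 247680 [:: 12; 6] 3 3 3 3 8; N 74880 [:: 56] 3 3 3 3 8; N 34560
  [:: 4; 6] 2 2 2 3 31; P 95040 [:: 24] 2 2 2 3 31; P 86400 [:: 4; 6] 2 3 3 3 26; N 25920 [:: 4;
  6] 2 3 3 3 22; N 34560 [:: 24] 2 3 3 3 22; N 345600 [:: 24] 2 3 3 3 21; P 95040 [:: 4; 6] 2 3 3
  3 19; N 345600 [:: 24] 2 3 3 3 19; P 92880 [:: 4; 6] 3 3 3 3 24; P 38880 [:: 24] 3 3 3 3 24; N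
  32400 [:: 4; 6] 3 3 3 3 20; N 15120 [:: 24] 3 3 3 3 20; N 118800 [:: 24] 3 3 3 3 18; N 161280
  [:: 8] 2 2 2 15 15; N 34560 [:: 8] 2 3 3 3 53; P 80640 [:: 8] 3 3 3 3 56; P 83880 [:: 8] 3 3 3 3
  52; N 36840 [:: 8] 3 3 3 3 50; N 47040 [:: 8] 3 3 3 3 42; N 18720 [:: 4; 7; 15] 2 2 2 2 3; N
  20160 [:: 6; 6; 15] 2 2 2 2 3; P 15120 [:: 6; 14; 7] 2 2 2 2 3; P 8640 [:: 12; 7; 7] 2 2 2 2 3;
  P 133920 [:: 60; 7] 2 2 2 2 3; P 46080 [:: 58; 7] 2 2 2 2 3; N 47520 [:: 12; 31] 2 2 2 2 3; P
  15120 [:: 14; 30] 2 2 2 2 3; P 5760 [:: 28; 15] 2 2 2 2 3; P 4800 [:: 26; 15] 2 2 2 2 3; P 95040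
  [:: 250] 2 2 2 2 3; P 95040 [:: 246] 2 2 2 2 3; P 36540 [:: 4; 7; 7] 2 2 2 2 7; N 81720 [:: 4;
  31] 2 2 2 2 7; N 4320 [:: 6; 6; 7] 2 2 2 2 7; N 10800 [:: 6; 30] 2 2 2 2 7; N 129600 [:: 28; 7]
  2 2 2 2 7; N 18000 [:: 26; 7] 2 2 2 2 7; N 80160 [:: 12; 15] 2 2 2 2 7; N 60480 [:: 14; 14] 2 2
  2 2 7; P 218880 [:: 124] 2 2 2 2 7; P 34560 [:: 122] 2 2 2 2 7; P 34560 [:: 118] 2 2 2 2 7; N
  2160 [:: 4; 7; 7] 2 2 2 3 6; P 56160 [:: 4; 31] 2 2 2 3 6; N 12960 [:: 6; 6; 7] 2 2 2 3 6; P
  138240 [:: 6; 30] 2 2 2 3 6; P 51840 [:: 28; 7] 2 2 2 3 6; P 48960 [:: 26; 7] 2 2 2 3 6; N 40320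
  [:: 12; 15] 2 2 2 3 6; P 293760 [:: 14; 14] 2 2 2 3 6; P 34560 [:: 122] 2 2 2 3 6; N 17280 [::
  118] 2 2 2 3 6; N 95040 [:: 6; 14] 2 2 2 2 15; N 146880 [:: 60] 2 2 2 2 15; N 187200 [:: 58] 2 2
  2 2 15; P 95040 [:: 4; 15] 2 2 2 3 13; P 60480 [:: 12; 7] 2 2 2 3 13; N 293760 [:: 60] 2 2 2 3
  13; N 305280 [:: 58] 2 2 2 3 13; N 189360 [:: 4; 15] 2 3 3 3 8; N 120960 [:: 6; 14] 2 3 3 3 8; P
  483840 [:: 60] 2 3 3 3 8; P 426240 [:: 58] 2 3 3 3 8; P 20160 [:: 4; 15] 3 3 3 4 4; P 259200 [::
  6; 14] 3 3 3 4 4; N 28080 [:: 4; 7] 2 2 2 2 31; P 8640 [:: 6; 6] 2 2 2 2 31; P 7200 [:: 26] 2 2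
  2 2 31; P 23040 [:: 28] 2 2 2 3 30; N 92160 [:: 26] 2 2 2 3 30; P 69120 [:: 6; 6] 2 2 2 3 29; N
  92160 [:: 26] 2 2 2 3 29; N 34560 [:: 4; 7] 2 2 2 3 27; P 92160 [:: 26] 2 2 2 3 27; N 34560 [::
  6; 6] 2 2 2 7 14; N 23040 [:: 28] 2 2 2 7 14; P 17280 [:: 4; 7] 2 2 2 7 13; N 34560 [:: 28] 2 2
  3 3 26; N 207360 [:: 26] 2 2 3 3 25; N 23040 [:: 28] 2 3 3 3 24; N 69120 [:: 6; 6] 2 3 3 3 20; P
  69120 [:: 28] 2 3 3 3 20; P 184320 [:: 26] 2 3 3 3 20; N 23040 [:: 28] 2 3 3 3 18; N 74880 [::
  4; 7] 3 3 3 3 16; P 5760 [:: 28] 3 3 3 3 16; N 24480 [:: 26] 3 3 3 3 16; P 161280 [:: 26] 3 3 3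
  4 12; P 23040 [:: 28] 3 3 3 4 10; N 103680 [:: 12] 2 2 2 3 61; N 207360 [:: 12] 2 2 2 3 59; N
  311040 [:: 12] 2 3 3 3 42; N 172800 [:: 12] 2 3 3 3 38; P 207360 [:: 12] 2 3 3 3 49; P 103680
  [:: 12] 2 3 3 3 41; P 69120 [:: 12] 3 3 3 3 40; P 8640 [:: 12] 3 3 3 3 36; N 198720 [:: 12] 3 3
  3 3 34; N 69120 [:: 12] 3 3 3 12 12; N 155520 [:: 12] 3 3 3 10 10; P 230400 [:: 12] 3 6 6 6 6; P
  73440 [:: 4] 2 2 2 2 127; N 69120 [:: 4] 2 2 2 3 125; P 69120 [:: 4] 2 2 2 3 123; N 103680 [::
  4] 2 2 2 15 30; N 86400 [:: 4] 2 3 3 3 102; N 120960 [:: 4] 2 3 3 3 78; P 86400 [:: 4] 2 3 3 3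
  113; N 51840 [:: 4] 2 3 3 3 105; N 172800 [:: 4] 2 3 3 3 85; N 60480 [:: 4] 3 3 3 3 112; P
  137340 [:: 4] 3 3 3 3 104; P 83520 [:: 4] 3 3 3 3 100; N 4320 [:: 4] 3 3 3 3 84; P 102240 [:: 4]
  3 3 3 3 76; N 63900 [:: 4] 3 3 3 3 98; P 2880 [:: 4] 3 3 3 3 82; N 57600 [:: 4] 3 3 3 3 74; N
  106560 [:: 4] 3 3 3 3 70; N 4140 [:: 6; 7; 15] 2 2 2 2 2; P 3456 [:: 6; 63] 2 2 2 2 2; N 8640
  [:: 14; 7; 7] 2 2 2 2 2; P 17280 [:: 14; 31] 2 2 2 2 2; N 1080 [:: 30; 15] 2 2 2 2 2; N 4320 [::
  6; 7; 7] 2 2 2 2 6; N 25920 [:: 6; 31] 2 2 2 2 6; P 6480 [:: 30; 7] 2 2 2 2 6; P 65880 [:: 14;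
  15] 2 2 2 2 6; N 60840 [:: 6; 15] 2 2 2 2 14; P 43200 [:: 14; 7] 2 2 2 2 14; P 69120 [:: 6; 15]
  2 2 2 2 13; N 17280 [:: 62] 2 2 2 2 13; P 103680 [:: 14; 7] 2 2 2 3 10; P 17280 [:: 62] 2 2 2 3
  10; N 120960 [:: 6; 7] 2 2 2 2 30; P 203040 [:: 30] 2 2 2 2 30; P 59400 [:: 6; 7] 2 2 2 2 29; N
  32400 [:: 30] 2 2 2 2 29; P 113400 [:: 6; 7] 2 2 2 2 27; N 196560 [:: 30] 2 2 2 2 27; N 164160
  [:: 6; 7] 2 2 2 3 26; N 56160 [:: 6; 7] 2 2 2 3 22; P 345600 [:: 30] 2 2 2 3 22; N 30240 [:: 6;
  7] 2 2 2 3 25; P 34560 [:: 30] 2 2 2 3 25; P 345600 [:: 30] 2 2 2 3 21; P 77760 [:: 6; 7] 2 2 6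
  6 6; N 43200 [:: 30] 2 3 3 3 16; P 17280 [:: 14] 2 2 2 2 61; P 60480 [:: 14] 2 2 2 2 59; N 25920
  [:: 14] 2 2 2 2 55; N 276480 [:: 14] 2 2 2 3 60; N 380160 [:: 14] 2 2 2 3 54; P 241920 [:: 14] 2
  2 2 3 57; P 311040 [:: 14] 2 2 2 3 53; P 69120 [:: 14] 2 2 2 14 14; P 224640 [:: 14] 2 2 2 13
  13; P 311040 [:: 14] 2 3 3 3 36; P 172800 [:: 14] 2 3 3 3 34; N 264960 [:: 14] 2 6 6 6 6; P
  69120 [:: 14] 3 3 3 3 32; P 181440 [:: 6] 2 2 2 2 126; N 17280 [:: 6] 2 2 2 2 125; P 17280 [::
  6] 2 2 2 2 123; N 181440 [:: 6] 2 2 2 2 111; N 69120 [:: 6] 2 2 2 3 121; N 138240 [:: 6] 2 2 2 3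
  109; N 34560 [:: 6] 2 3 3 3 76; P 138240 [:: 6] 2 3 3 3 82; N 181440 [:: 6] 3 3 3 3 96; P 164160
  [:: 6] 3 3 3 3 72; N 17280 [:: 6] 3 3 3 3 66; N 13005 [:: 7; 7; 7] 2 2 2 2 4; P 3150 [:: 7; 31]
  2 2 2 2 4; P 45720 [:: 127] 2 2 2 2 4; P 110040 [:: 7; 15] 2 2 2 2 12; P 79200 [:: 7; 7] 2 2 2 2
  28; P 7200 [:: 7; 7] 2 2 2 2 26; P 37440 [:: 31] 2 2 2 2 26; P 36720 [:: 7; 7] 2 2 2 2 25; P
  4320 [:: 31] 2 2 2 2 25; N 69120 [:: 31] 2 2 2 3 20; N 59760 [:: 15] 2 2 2 2 60; P 31440 [:: 15]
  2 2 2 2 54; N 89280 [:: 15] 2 2 2 2 51; P 288000 [:: 15] 2 2 2 3 42; N 230400 [:: 15] 2 2 2 3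
  49; P 10080 [:: 15] 2 3 3 3 32; P 172800 [:: 15] 3 3 3 8 8; N 145440 [:: 7] 2 2 2 2 124; N 98460
  [:: 7] 2 2 2 2 122; P 67680 [:: 7] 2 2 2 2 118; P 46620 [:: 7] 2 2 2 2 110; P 25920 [:: 7] 2 2 2
  2 121; N 84960 [:: 7] 2 2 2 2 109; N 128160 [:: 7] 2 2 2 2 115; N 48960 [:: 7] 2 2 2 2 103; N
  51840 [:: 7] 2 2 2 3 92; N 207360 [:: 7] 2 2 2 3 114; P 190080 [:: 7] 2 2 2 3 102; P 311040 [::
  7] 2 2 2 3 86; P 138240 [:: 7] 2 2 2 3 101; P 126720 [:: 7] 2 2 2 3 85; N 103680 [:: 7] 2 2 3 3
  82; P 34560 [:: 7] 2 3 3 3 96; P 103680 [:: 7] 2 3 3 3 80; N 69120 [:: 7] 2 3 3 3 68; P 149760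
  [:: 7] 3 3 3 3 64; P 103680 [:: 7] 3 3 3 4 36; N 25920 [::] 2 2 2 2 508; P 127800 [::] 2 2 2 2
  506; N 112320 [::] 2 2 2 2 502; N 60480 [::] 2 2 2 2 494; N 126720 [::] 2 2 2 2 478; N 84600
  [::] 2 2 2 2 446; N 8640 [::] 2 2 2 2 505; N 57600 [::] 2 2 2 2 501; P 34560 [::] 2 2 2 2 493; N
  17280 [::] 2 2 2 2 477; P 118080 [::] 2 2 2 2 445; P 135360 [::] 2 2 2 2 499; P 8640 [::] 2 2 2
  2 491; P 77760 [::] 2 2 2 2 443; N 172800 [::] 2 2 2 2 487; P 17280 [::] 2 2 2 2 471; P 86400
  [::] 2 2 2 2 439; P 86400 [::] 2 2 2 2 463; N 46080 [::] 2 2 2 2 431; P 175680 [::] 2 2 2 2 415;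
  P 69120 [::] 2 2 2 3 492; N 241920 [::] 2 2 2 3 474; N 138240 [::] 2 2 2 3 378; N 587520 [::] 2
  2 2 3 350; N 172800 [::] 2 2 2 3 489; N 69120 [::] 2 2 2 3 441; N 69120 [::] 2 2 2 3 485; N
  311040 [::] 2 2 2 3 373; N 172800 [::] 2 2 2 3 461; N 103680 [::] 2 2 2 3 429; N 276480 [::] 2 2
  2 3 349; N 172800 [::] 2 2 2 3 483; N 34560 [::] 2 2 2 3 467; N 138240 [::] 2 2 2 3 371; N
  207360 [::] 2 2 2 3 459; N 172800 [::] 2 2 2 3 455; N 241920 [::] 2 2 2 3 359; P 138240 [::] 2 2
  2 3 407; N 103680 [::] 2 2 2 3 343; P 449280 [::] 2 2 2 3 399; N 92160 [::] 2 2 2 7 213; P 69120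
  [::] 2 2 2 7 203; P 138240 [::] 2 2 2 13 121; P 92160 [::] 2 2 2 15 106; P 241920 [::] 2 2 2 30
  60; N 69120 [::] 2 2 2 25 59; P 103680 [::] 2 2 2 27 54; P 276480 [::] 2 2 2 27 39; P 138240
  [::] 2 2 3 3 341; P 311040 [::] 2 3 3 3 424; P 103680 [::] 2 3 3 3 360; P 207360 [::] 2 3 3 3
  408; P 207360 [::] 2 3 3 3 312; P 311040 [::] 2 3 3 3 420; P 172800 [::] 2 3 3 3 396; P 172800
  [::] 2 3 3 3 332; P 103680 [::] 2 3 3 3 300; P 69120 [::] 2 3 3 3 306; P 103680 [::] 2 3 3 3
  394; P 103680 [::] 2 3 3 3 330; N 92160 [::] 2 3 3 3 298; N 138240 [::] 2 3 3 3 278; P 138240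
  [::] 2 3 3 3 401; N 207360 [::] 2 3 3 3 389; P 276480 [::] 2 3 3 3 325; P 69120 [::] 2 3 3 3
  323; P 25920 [::] 3 3 3 3 448; N 127800 [::] 3 3 3 3 416; P 25920 [::] 3 3 3 3 352; N 8640 [::]
  3 3 3 3 400; N 25920 [::] 3 3 3 3 336; N 187200 [::] 3 3 3 3 304; N 86400 [::] 3 3 3 3 392; N
  146880 [::] 3 3 3 3 328; N 112320 [::] 3 3 3 3 296; N 17280 [::] 3 3 3 3 280; N 175680 [::] 3 3
  3 3 388; P 8640 [::] 3 3 3 3 324; N 25920 [::] 3 3 3 3 276; P 25920 [::] 3 3 3 3 268; P 84600
  [::] 3 3 3 3 386; P 115200 [::] 3 3 3 3 322; P 8640 [::] 3 3 3 3 290; P 95040 [::] 3 3 3 3 274;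
  P 288000 [::] 3 3 3 3 266; P 126720 [::] 3 3 3 3 262; P 69120 [::] 3 3 3 4 156; N 69120 [::] 3 3
  3 8 90; P 69120 [::] 3 3 3 12 104; N 69120 [::] 3 3 3 12 74; N 103680 [::] 3 3 3 24 56; N 207360
  [::] 3 3 3 24 44; P 34560 [::] 3 3 3 20 52; N 23040 [::] 6 6 6 6 26].

(** The multiplier makes the coefficients on the integral traces and those of the certificates
    integers at the same time. *)
Lemma v75_check : relation_check 4320 v75_spoly v75_certificates.
Proof. by vm_compute. Qed.

Lemma v66'_check : relation_check 1440 v66'_spoly v66'_certificates.
Proof. by vm_compute. Qed.

Lemma v66''_check : relation_check 240 v66''_spoly v66''_certificates.
Proof. by vm_compute. Qed.

End Certificates.

(** * Sparse polynomials in the generators *)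

Fixpoint nat_insert (n : nat) (s : seq nat) : seq nat :=
  if s is m :: s' then (if (n <= m)%N then n :: s else m :: nat_insert n s') else [:: n].

(** The sorted variables in unary: v bits [true] and a closing [false] for each v. [key_vars] is the
    decoder. *)
Definition vars_key (vs : seq nat) : seq bool :=
  foldr (fun v k => nseq v true ++ false :: k) [::] (foldr nat_insert [::] vs).

Definition trie_add_spoly (l : spoly) (t : trie) : trie :=
  foldr (fun cv => trie_add (vars_key cv.2) cv.1) t l.

Definition spoly_opp (l : spoly) : spoly := [seq (Z.opp cv.1, cv.2) | cv <- l].

Definition spoly_eq (l1 l2 : spoly) : bool :=
  trie_null (trie_add_spoly l1 (trie_add_spoly (spoly_opp l2) Leaf)).

(** The Leibniz rule on one monomial, for a derivation that sends the variable v to e v times the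
    variable s v. Both [lowerG] and [raiseG] have this form. *)
Fixpoint replace_each (e : nat -> Z) (s : nat -> nat) (vs : seq nat) : spoly :=
  if vs is v :: vs' then
    let r := [seq (cv.1, v :: cv.2) | cv <- replace_each e s vs'] in
    if Z.eqb (e v) Z0 then r else (e v, s v :: vs') :: r
  else [::].

Definition spoly_der (e : nat -> Z) (s : nat -> nat) (l : spoly) : spoly :=
  flatten [seq [seq (Z.mul cv.1 dw.1, dw.2) | dw <- replace_each e s cv.2] | cv <- l].

Definition spoly_map (e : nat -> Z) (s : nat -> nat) (l : spoly) : spoly :=
  [seq (foldr (fun v => Z.mul (e v)) cv.1 cv.2, map s cv.2) | cv <- l].

Definition small_vars (l : spoly) : bool := all (fun cv => all (ltn^~ 30) cv.2) l.

Section SparsePolynomials.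

Variable K : fieldType.
Local Notation KG0 := {mpoly K[30]}.

Definition vars (vs : seq nat) : KG0 := \prod_(v <- vs) 'X_(inord v).

Lemma vars_cons v vs : vars (v :: vs) = 'X_(inord v) * vars vs.
Proof. exact: big_cons. Qed.

Lemma vars_sort vs : vars (foldr nat_insert [::] vs) = vars vs.
Proof.
have ins v s : vars (nat_insert v s) = 'X_(inord v) * vars s.
  elim: s => [|m s IH] /=; first exact: vars_cons.
  by case: ifP; rewrite !vars_cons // IH mulrCA.
by elim: vs => //= v vs IH; rewrite ins IH vars_cons.
Qed.

Fixpoint key_vars (n : nat) (k : seq bool) : KG0 :=
  match k with
  | true :: k => key_vars n.+1 k
  | false :: k => 'X_(inord n) * key_vars 0 k
  | [::] => 1
  end.

Lemma key_varsK vs : key_vars 0 (vars_key vs) = vars vs.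
Proof.
have nq v n k : key_vars n (nseq v true ++ false :: k) = 'X_(inord (n + v)) * key_vars 0 k.
  by elim: v n => [|v IH] n /=; rewrite ?addn0 // IH addSnnS.
rewrite -vars_sort /vars_key; elim: (foldr nat_insert [::] vs) => [|v s IH] /=.
  by rewrite /vars big_nil.
by rewrite nq add0n IH vars_cons.
Qed.

Lemma trie_val_add_spoly l t :
  trie_val (key_vars 0) (trie_add_spoly l t) = trie_val (key_vars 0) t + pol K l.
Proof.
elim: l => [|cv l IH] /=; first by rewrite /pol big_nil addr0.
by rewrite trie_val_add IH key_varsK /pol big_cons -addrA [X in _ + X]addrC.
Qed.

Lemma pol_opp l : pol K (spoly_opp l) = - pol K l.
Proof. by rewrite /pol big_map -sumrN; apply: eq_bigr => cv _; rewrite zrN mulNr. Qed.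

Lemma pol_eq l1 l2 : spoly_eq l1 l2 -> pol K l1 = pol K l2.
Proof.
move/(trie_val_null (key_vars 0)); rewrite !trie_val_add_spoly pol_opp add0r addrC.
by move/eqP; rewrite subr_eq0 => /eqP.
Qed.

Lemma pol_nil : pol K [::] = 0.
Proof. exact: big_nil. Qed.

Lemma pol_cons c vs l : pol K ((c, vs) :: l) = zr _ c * vars vs + pol K l.
Proof. exact: big_cons. Qed.

Lemma pol_cat l1 l2 : pol K (l1 ++ l2) = pol K l1 + pol K l2.
Proof. exact: big_cat. Qed.

Lemma zr_scale c (p : KG0) : zr KG0 c * p = zr K c *: p.
Proof. by rewrite -(rmorph_zr (@mpolyC _ K)) mul_mpolyC. Qed.

Lemma pol_der (D : {linear KG0 -> KG0}) e s l :
  (forall p q, D (p * q) = D p * q + p * D q) -> D 1 = 0 ->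
  (forall v, (v < 30)%N -> D 'X_(inord v) = zr K (e v) *: 'X_(inord (s v))) ->
  small_vars l -> D (pol K l) = pol K (spoly_der e s l).
Proof.
move=> DM D1 DX; elim: l => [|[c vs] l IH] /=; first by rewrite /pol !big_nil linear0.
case/andP=> vs30 l30; rewrite pol_cons linearD IH // /spoly_der /= pol_cat; congr (_ + _).
rewrite zr_scale linearZ /= -zr_scale.
transitivity (zr KG0 c * pol K (replace_each e s vs)); last first.
  by rewrite /pol big_map mulr_sumr; apply: eq_bigr => dw _; rewrite zrM mulrA.
congr (_ * _); elim: vs vs30 => [|v vs IHv] /=; first by rewrite /vars pol_nil big_nil D1.
case/andP=> v30 vs30; rewrite vars_cons DM IHv // DX //.
set r := [seq _ | _ <- _].
have -> : 'X_(inord v) * pol K (replace_each e s vs) = pol K r.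
  rewrite /pol big_map mulr_sumr; apply: eq_bigr => dw _ /=.
  by rewrite big_cons mulrCA.
case: Z.eqb_spec => [->|_]; first by rewrite zr0 scale0r mul0r add0r.
by rewrite pol_cons vars_cons zr_scale scalerAl.
Qed.

Lemma pol_map (f : {lrmorphism KG0 -> KG0}) e s l :
  (forall v, (v < 30)%N -> f 'X_(inord v) = zr K (e v) *: 'X_(inord (s v))) ->
  small_vars l -> f (pol K l) = pol K (spoly_map e s l).
Proof.
move=> fX; elim: l => [|[c vs] l IH] /=; first by rewrite /pol !big_nil linear0.
case/andP=> vs30 l30; rewrite !pol_cons rmorphD /= IH //; congr (_ + _).
rewrite rmorphM /= rmorph_zr; elim: vs vs30 => [|v vs IHv] /=.
  by rewrite /vars !big_nil rmorph1.
case/andP=> v30 vs30; rewrite !vars_cons rmorphM /= mulrCA IHv // fX // zrM.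
by rewrite -zr_scale mulrACA.
Qed.

Definition spoly_weight (wt : nat -> nat) (d : nat) (l : spoly) : bool :=
  all (fun cv => sumn (map wt cv.2) == d) l.

Lemma pol_homog (c : 'I_30 -> nat) wt d l :
  (forall v, (v < 30)%N -> c (inord v) = wt v) -> small_vars l -> spoly_weight wt d l ->
  pol K l \is d.-homog for (weight c).
Proof.
move=> cE; elim: l => [|[k vs] l IH] /=; first by rewrite pol_nil dhomog0.
case/andP=> vs30 l30 /andP[/eqP hd hl]; rewrite pol_cons.
apply: rpredD; last exact: IH.
rewrite zr_scale rpredZ // -hd.
elim: vs {hd} vs30 => [|v vs IHv] /=; first by rewrite /vars big_nil dhomog1.
case/andP=> v30 vs30; rewrite vars_cons dhomogM ?IHv // dhomogX /= -cE //.
rewrite /weight (bigD1 (inord v)) //= mnm1E eqxx muln1 big1 ?addn0 // => u uv.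
by rewrite mnm1E eq_sym (negbTE uv) muln0.
Qed.

Definition vars_mnm (vs : seq nat) : 'X_{1..30} := (\sum_(v <- vs) U_(inord v))%MM.

Lemma varsE vs : vars vs = 'X_[vars_mnm vs].
Proof.
elim: vs => [|v vs IH]; first by rewrite /vars /vars_mnm !big_nil mpolyX0.
by rewrite vars_cons IH /vars_mnm big_cons mpolyXD.
Qed.

Lemma vars_mnmE vs (v : 'I_30) : all (ltn^~ 30) vs -> vars_mnm vs v = count_mem (v : nat) vs.
Proof.
elim: vs => [|u vs IH] /=; first by rewrite /vars_mnm big_nil mnm0E.
case/andP=> u30 vs30; rewrite /vars_mnm big_cons mnmDE -/(vars_mnm vs) IH // mnm1E.
by congr (_ + _)%N; rewrite -val_eqE /= inordK.
Qed.

Definition spoly_coef (ws : seq nat) (l : spoly) : Z :=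
  foldr (fun cv => Z.add (if perm_eq ws cv.2 then cv.1 else Z0)) Z0 l.

Lemma mcoeff_pol ws l : all (ltn^~ 30) ws -> small_vars l ->
  (pol K l)@_(vars_mnm ws) = zr K (spoly_coef ws l).
Proof.
move=> ws30; elim: l => [|[c vs] l IH] /=; first by rewrite pol_nil mcoeff0 zr0.
case/andP=> vs30 l30; rewrite pol_cons mcoeffD IH // zr_scale mcoeffZ varsE mcoeffX zrD.
congr (_ + _).
suff -> : (vars_mnm vs == vars_mnm ws) = perm_eq ws vs.
  by case: ifP => _; rewrite ?mulr1 ?mulr0 ?zr0.
apply/eqP/idP => [/mnmP E | /permP E]; last first.
  by apply/mnmP => v; rewrite !vars_mnmE.
apply/allP => v; rewrite mem_cat => v_in.
have v30 : (v < 30)%N by case/orP: v_in; [move/(allP ws30) | move/(allP vs30)].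
by have := E (Ordinal v30); rewrite !vars_mnmE // => /= ->.
Qed.

End SparsePolynomials.

(** * Evaluation of Phi *)

(** [Phi] and [inG] are sums over a support, which is not additive in the polynomial; enlarging the
    supports to a common list makes their linearity visible. *)
Lemma sum_msupp_sup (R : nzRingType) n (V : nmodType) (F : R -> 'X_{1..n} -> V) s
    (p : {mpoly R[n]}) :
  (forall m, F 0 m = 0) -> uniq s -> {subset msupp p <= s} ->
  \sum_(m <- msupp p) F p@_m m = \sum_(m <- s) F p@_m m.
Proof.
move=> F0 us ps; rewrite [RHS](bigID (mem (msupp p))) /= [X in _ = _ + X]big1 ?addr0; last first.
  by move=> m /memN_msupp_eq0 ->.
rewrite -[RHS]big_filter; apply: perm_big; apply: uniq_perm; rewrite ?filter_uniq //.
by move=> m; rewrite mem_filter /=; case E: (m \in msupp p) => //=; rewrite ps.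
Qed.

(* (c, (vs, ls)) stands for c times the generators in vs times the letters in ls, where
   x_i has the number 2 i and y_i the number 2 i + 1. *)
Notation lpoly := (seq (Z * (seq nat * seq nat))).

(** Syntax of the arguments of [Phi]. A difference is a sum with an opposite, so it needs no
    constructor of its own. *)
Inductive lexpr :=
  | LX of nat
  | LY of nat
  | LZ of nat & nat & nat
  | LT of nat & nat
  | LNat of nat
  | LAdd of lexpr & lexpr
  | LMul of lexpr & lexpr
  | LOpp of lexpr
  | LExp of lexpr & nat.

Definition gen_index (i j k : nat) : nat := index (i, j, k) basisG.
Arguments gen_index : simpl never.

Definition lpoly_mul (p q : lpoly) : lpoly :=
  flatten [seq [seq (Z.mul s.1 t.1, (s.2.1 ++ t.2.1, s.2.2 ++ t.2.2)) | t <- q] | s <- p].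

Definition lpoly1 : lpoly := [:: (Zpos xH, ([::], [::]))].

Fixpoint lnorm (e : lexpr) : lpoly :=
  match e with
  | LX i => [:: (Zpos xH, ([::], [:: i.*2]))]
  | LY i => [:: (Zpos xH, ([::], [:: i.*2.+1]))]
  | LZ i j k => [:: (Zpos xH, ([:: gen_index i j k], [::]))]
  | LT i e => [:: (Zpos xH,
      (if a_ i == 0%N then nseq (e %/ b_ i) (gen_index i 0 0) else [::], [::]))]
  | LNat n => [:: (Z.of_nat n, ([::], [::]))]
  | LAdd e f => lnorm e ++ lnorm f
  | LMul e f => lpoly_mul (lnorm e) (lnorm f)
  | LOpp e => [seq (Z.opp t.1, t.2) | t <- lnorm e]
  | LExp e n => iter n (lpoly_mul (lnorm e)) lpoly1
  end.

Fixpoint lexpr_wf (e : lexpr) : bool :=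
  match e with
  | LX i | LY i => (i < 13)%N
  | LZ i j k => (i, j, k) \in basisG
  | LT i e => (a_ i == 0)%N ==> ((i, 0, 0)%N \in basisG)
  | LNat _ => true
  | LAdd e f | LMul e f => lexpr_wf e && lexpr_wf f
  | LOpp e | LExp e _ => lexpr_wf e
  end.

Definition letter_power_vars (i j k : nat) : seq nat :=
  if (j + k == 0)%N then [::]
  else if a_ i == 1%N then nseq j (gen_index i 1 0) ++ nseq k (gen_index i 0 1)
  else [:: gen_index i j k].

Definition letters_vars (ls : seq nat) : seq nat :=
  flatten [seq letter_power_vars i (count_mem i.*2 ls) (count_mem i.*2.+1 ls) | i <- iota 0 13].

Definition Phi_spoly (p : lpoly) : spoly := [seq (t.1, t.2.1 ++ letters_vars t.2.2) | t <- p].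

Section PhiValue.

Variable K : fieldType.
Local Notation KG0 := {mpoly K[30]}.
Local Notation letters := {mpoly KG0[2 * 13]}.

Definition letter_powers (m : 'X_{1..2 * 13}) : KG0 :=
  \prod_(i < 13) letter_power K i (m (mxvec_index 0 i)) (m (mxvec_index 1 i)).

Lemma Phi_sup s (p : letters) : uniq s -> {subset msupp p <= s} ->
  Phi p = \sum_(m <- s) p@_m * letter_powers m.
Proof. by apply: (sum_msupp_sup (F := fun c m => c * letter_powers m)) => m; rewrite mul0r. Qed.

Lemma PhiD p q : Phi (p + q) = Phi p + Phi q :> KG0.
Proof.
set s := undup (msupp p ++ msupp q); have us : uniq s by apply: undup_uniq.
rewrite !(@Phi_sup s) // -?big_split.
- by apply: eq_bigr => m _ /=; rewrite mcoeffD mulrDl.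
- by move=> m mq; rewrite mem_undup mem_cat mq orbT.
- by move=> m mp; rewrite mem_undup mem_cat mp.
- by move=> m /msuppD_le; rewrite mem_undup mem_cat.
Qed.

Lemma Phi_monomial c m : Phi (c *: 'X_[m] : letters) = c * letter_powers m.
Proof.
rewrite (@Phi_sup [:: m]) // ?big_seq1; first by rewrite mcoeffZ mcoeffX eqxx mulr1.
by move=> m' /msuppZ_le; rewrite msuppX.
Qed.

Definition letter (l : nat) : 'I_(2 * 13) := mxvec_index (if odd l then 1 else 0) (inord l./2).

Definition letters_mnm (ls : seq nat) : 'X_{1..2 * 13} := (\sum_(l <- ls) U_(letter l))%MM.

Definition lpoly_val (p : lpoly) : letters :=
  \sum_(t <- p) (zr KG0 t.1 * vars K t.2.1) *: 'X_[letters_mnm t.2.2].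

Lemma letters_mnmE ls (b : 'I_2) (i : 'I_13) : all (ltn^~ 26) ls ->
  letters_mnm ls (mxvec_index b i) = count_mem (i.*2 + b)%N ls.
Proof.
elim: ls => [|l ls IH] /=; first by rewrite /letters_mnm big_nil mnm0E.
case/andP=> l26 ls26; rewrite /letters_mnm big_cons mnmDE -/(letters_mnm ls) IH // mnm1E.
congr (_ + _)%N; rewrite /letter; set c : 'I_2 := if _ then _ else _.
have cE : c = odd l :> nat by rewrite /c; case: odd.
have lE : (inord l./2 : 'I_13) = l./2 :> nat by rewrite inordK // ltn_half_double.
have -> : (mxvec_index c (inord l./2) == mxvec_index b i) = ((c, inord l./2) == (b, i)).
  by apply/eqP/eqP => [|[-> ->] //]; apply: (@mxvec_index_inj _ _ (_, _) (_, _)).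
rewrite xpair_eqE -!val_eqE /= lE cE; congr nat_of_bool.
apply/andP/eqP => [[/eqP <- /eqP <-]|->]; first by rewrite addnC odd_double_half.
by have := ltn_ord b; case: (b : nat) => [|[|]] // _; rewrite ?addn0 ?addn1 /= odd_double
  ?doubleK ?uphalf_double !eqxx.
Qed.

Lemma zG_index i j k : (i, j, k) \in basisG -> zG K i j k = 'X_(inord (gen_index i j k)).
Proof. by rewrite /zG => ->. Qed.

Lemma letter_powerE i j k : all (ltn^~ 30) (letter_power_vars i j k) ->
  letter_power K i j k = vars K (letter_power_vars i j k).
Proof.
(* [index] returns 30 on a triple outside [basisG], so the bound on the variables certifies that no
   letter monomial falls outside the basis. *)
have idx b : (index b basisG < 30)%N -> b \in basisG by rewrite -size_basisG index_mem.
rewrite /letter_power_vars /letter_power.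
case: eqP => _; first by rewrite /vars big_nil.
case: eqP => _ /=; last first.
  by rewrite andbT => /idx b; rewrite /vars big_seq1 zG_index.
have nq n (z : KG0) v : ((v < 30)%N -> z = 'X_(inord v)) -> all (ltn^~ 30) (nseq n v) ->
    z ^+ n = vars K (nseq n v).
  move=> zv; rewrite all_nseq; case: n => [|n] => [_|/zv ->]; first by rewrite /vars big_nil.
  by elim: n.+1 => [|m IH] /=; rewrite ?exprS ?IH ?vars_cons // /vars big_nil.
rewrite all_cat => /andP[j30 k30].
rewrite [RHS]big_cat.
congr (_ * _).
  by apply: nq j30 => /idx; apply: zG_index.
by apply: nq k30 => /idx; apply: zG_index.
Qed.

Lemma letters_varsE ls : all (ltn^~ 26) ls -> all (ltn^~ 30) (letters_vars ls) ->
  letter_powers (letters_mnm ls) = vars K (letters_vars ls).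
Proof.
move=> ls26 /allP vs30.
rewrite /letter_powers /letters_vars /vars big_flatten big_map -[iota 0 13]/(index_iota 0 13) big_mkord.
apply: eq_bigr => i _; rewrite !letters_mnmE // addn0 addn1 letter_powerE //.
by apply/allP => v vi; apply/vs30/flatten_mapP; exists (i : nat); rewrite ?mem_iota ?ltn_ord.
Qed.

Lemma Phi_lpoly p :
  all (fun t => all (ltn^~ 26) t.2.2 && all (ltn^~ 30) (letters_vars t.2.2)) p ->
  Phi (lpoly_val p) = pol K (Phi_spoly p).
Proof.
elim: p => [_|t p IH /= /andP[/andP[t26 t30] p_ok]].
  by rewrite /lpoly_val /pol !big_nil /Phi msupp0 big_nil.
rewrite /lpoly_val big_cons PhiD IH // Phi_monomial letters_varsE // pol_cons.
by rewrite -mulrA /vars -big_cat.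
Qed.

Fixpoint lval (e : lexpr) : letters :=
  match e with
  | LX i => xL K i
  | LY i => yL K i
  | LZ i j k => zL K i j k
  | LT i e => tL K i e
  | LNat n => n%:R
  | LAdd e f => lval e + lval f
  | LMul e f => lval e * lval f
  | LOpp e => - lval e
  | LExp e n => lval e ^+ n
  end.

Lemma lpoly_val_mul p q : lpoly_val (lpoly_mul p q) = lpoly_val p * lpoly_val q.
Proof.
rewrite /lpoly_val big_flatten big_map mulr_suml; apply: eq_bigr => s _.
rewrite big_map mulr_sumr; apply: eq_bigr => t _ /=.
rewrite -scalerAl -scalerAr scalerA -mpolyXD zrM /vars big_cat /letters_mnm big_cat /=.
by rewrite mulrACA.
Qed.

Lemma lpoly_val1 : lpoly_val lpoly1 = 1.
Proof. by rewrite [LHS]big_seq1 /vars /letters_mnm !big_nil mulr1 zr1 scale1r mpolyX0. Qed.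

Lemma lpoly_val_vars c vs :
  lpoly_val [:: (c, (vs, [::]))] = (zr KG0 c * vars K vs)%:MP.
Proof. by rewrite [LHS]big_seq1 /= /letters_mnm big_nil mpolyX0 alg_mpolyC. Qed.

Lemma lnormE e : lexpr_wf e -> lpoly_val (lnorm e) = lval e.
Proof.
elim: e => /= [i i13|i i13|i j k b|i e b|n _|e IHe f IHf /andP[we wf]|
    e IHe f IHf /andP[we wf]|e IHe we|e IHe n we].
- rewrite [LHS]big_seq1 /vars /letters_mnm big_nil mulr1 zr1 scale1r big_seq1.
  by rewrite /letter odd_double doubleK.
- rewrite [LHS]big_seq1 /vars /letters_mnm big_nil mulr1 zr1 scale1r big_seq1.
  by rewrite /letter /= odd_double uphalf_double.
- by rewrite lpoly_val_vars zr1 mul1r /vars big_seq1 /zL zG_index.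
- rewrite lpoly_val_vars zr1 mul1r /tL; case: eqP b => /= [_ b|_ _]; last by rewrite /vars big_nil.
  congr _%:MP; rewrite zG_index // /vars.
  by elim: (_ %/ _)%N => [|n IH] /=; rewrite ?big_nil // big_cons IH exprS.
- by rewrite lpoly_val_vars /vars big_nil mulr1 zr_nat mpolyC_nat.
- by rewrite /lpoly_val big_cat -!/(lpoly_val _) IHe ?IHf.
- by rewrite lpoly_val_mul IHe ?IHf.
- rewrite -IHe // /lpoly_val big_map -sumrN; apply: eq_bigr => t _ /=.
  by rewrite zrN mulNr scaleNr.
- by elim: n => [|n IH] /=; rewrite ?lpoly_val1 // lpoly_val_mul IH IHe // exprS.
Qed.

Definition lexpr_check (e : lexpr) (l : spoly) : bool :=
  let p := lnorm e in
  [&& lexpr_wf e,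
      all (fun t => all (ltn^~ 26) t.2.2 && all (ltn^~ 30) (letters_vars t.2.2)) p
    & spoly_eq (Phi_spoly p) l].

Lemma lexpr_checkP e l : lexpr_check e l -> Phi (lval e) = pol K l.
Proof. by case/and3P=> we /Phi_lpoly E /(pol_eq K) <-; rewrite -lnormE. Qed.

End PhiValue.

Ltac reify_letters p :=
  lazymatch p with
  | xL _ ?i => constr:(LX i)
  | yL _ ?i => constr:(LY i)
  | zL _ ?i ?j ?k => constr:(LZ i j k)
  | tL _ ?i ?e => constr:(LT i e)
  | GRing.add ?p ?q =>
      let e := reify_letters p in let f := reify_letters q in constr:(LAdd e f)
  | GRing.mul ?p ?q =>
      let e := reify_letters p in let f := reify_letters q in constr:(LMul e f)
  | GRing.opp ?p => let e := reify_letters p in constr:(LOpp e)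
  | GRing.exp ?p ?n => let e := reify_letters p in constr:(LExp e n)
  | GRing.natmul (GRing.one _) ?n => constr:(LNat n)
  end.

Ltac Phi_to_pol :=
  lazymatch goal with
  | |- Phi ?p = pol ?K ?l =>
      let e := reify_letters p in
      apply: (@lexpr_checkP K e l); vm_compute; reflexivity
  end.

Lemma v75E K : v75 K = pol K v75_spoly.
Proof. by rewrite /v75; Phi_to_pol. Qed.

Lemma v66'E K : v66' K = pol K v66'_spoly.
Proof. by rewrite /v66'; Phi_to_pol. Qed.

Lemma v66''E K : v66'' K = pol K v66''_spoly.
Proof. by rewrite /v66'' /v66_P /v66_Q; Phi_to_pol. Qed.

(** * Integer matrices *)

Notation lmx := (seq (seq Z)).

Definition zadd_seq (u v : seq Z) : seq Z := [seq Z.add ab.1 ab.2 | ab <- zip u v].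

Definition lmx_add (A B : lmx) : lmx := [seq zadd_seq uv.1 uv.2 | uv <- zip A B].

Definition lmx_opp (A : lmx) : lmx := map (map Z.opp) A.

Fixpoint lin_comb (cs : seq Z) (B : lmx) : seq Z :=
  match cs, B with
  | c :: cs, u :: B =>
      let r := lin_comb cs B in
      if Z.eqb c Z0 then r else zadd_seq (map (Z.mul c) u) r
  | _, _ => nseq 4 Z0
  end.

Definition lmx_mul (A B : lmx) : lmx := [seq lin_comb u B | u <- A].

Definition lmx0 : lmx := nseq 4 (nseq 4 Z0).

Definition lmx1 : lmx :=
  mkseq (fun i => mkseq (fun j => if i == j then Zpos xH else Z0) 4) 4.

Definition lmx_tr (A : lmx) : Z :=
  foldr (fun i => Z.add (nth Z0 (nth [::] A i) i)) Z0 (iota 0 4).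

Definition wf_lmx (A : lmx) : bool := (size A == 4%N) && all (fun u => size u == 4%N) A.

Definition zmx (R : comNzRingType) (A : lmx) : 'M[R]_4 :=
  \matrix_(i, j) zr R (nth Z0 (nth [::] A i) j).

Section ListMatrices.

Lemma nth_wf_lmx A i : wf_lmx A -> (i < 4)%N -> size (nth [::] A i) = 4%N.
Proof.
by case/andP=> /eqP sA /(all_nthP [::]) wA i4; apply/eqP/wA; rewrite sA.
Qed.

Lemma size_zadd u v : size u = 4%N -> size v = 4%N -> size (zadd_seq u v) = 4%N.
Proof. by move=> su sv; rewrite size_map size1_zip // su sv. Qed.

Lemma nth_zadd u v j : size u = 4%N -> size v = 4%N -> (j < 4)%N ->
  nth Z0 (zadd_seq u v) j = Z.add (nth Z0 u j) (nth Z0 v j).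
Proof.
move=> su sv j4; rewrite (nth_map (Z0, Z0)) ?nth_zip ?su //.
by rewrite size1_zip su ?sv.
Qed.

Lemma size_lin_comb cs B : all (fun u => size u == 4%N) B -> size (lin_comb cs B) = 4%N.
Proof.
elim: cs B => [|c cs IH] [|u B] //= /andP[/eqP u4 B4].
by case: ifP => _; rewrite ?size_zadd ?size_map ?IH.
Qed.

Lemma wf_lmx_mul A B : wf_lmx A -> wf_lmx B -> wf_lmx (lmx_mul A B).
Proof.
case/andP=> sA _ /andP[_ wB]; rewrite /wf_lmx size_map sA all_map /=.
by apply/allP => u _; rewrite /= size_lin_comb.
Qed.

Lemma wf_lmx_add A B : wf_lmx A -> wf_lmx B -> wf_lmx (lmx_add A B).
Proof.
move=> wA wB; have [/eqP sA _] := andP wA; have [/eqP sB _] := andP wB.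
apply/andP; split; first by rewrite size_map size1_zip sA ?sB.
apply/(all_nthP [::]) => i; rewrite size_map size1_zip ?sA ?sB // => i4.
rewrite (nth_map ([::], [::])) ?size1_zip ?sA ?sB //.
by rewrite nth_zip ?sA ?sB // size_zadd ?nth_wf_lmx.
Qed.

Lemma wf_lmx_opp A : wf_lmx A -> wf_lmx (lmx_opp A).
Proof.
case/andP=> sA wA; rewrite /wf_lmx size_map sA all_map /=.
by apply: sub_all wA => u; rewrite /= size_map.
Qed.

Variable R : comNzRingType.

Lemma zmx_add A B : wf_lmx A -> wf_lmx B -> zmx R (lmx_add A B) = zmx R A + zmx R B.
Proof.
move=> wA wB; have [/eqP sA _] := andP wA; have [/eqP sB _] := andP wB.
apply/matrixP => i j; rewrite !mxE (nth_map ([::], [::])) ?size1_zip ?sA ?sB //.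
by rewrite nth_zip ?sA ?sB // nth_zadd ?nth_wf_lmx // zrD.
Qed.

Lemma zmx_opp A : wf_lmx A -> zmx R (lmx_opp A) = - zmx R A.
Proof.
move=> wA; have [/eqP sA _] := andP wA.
apply/matrixP => i j; rewrite !mxE (nth_map [::]) ?sA //.
by rewrite (nth_map Z0) ?nth_wf_lmx // zrN.
Qed.

Lemma nth_lin_comb cs B j : all (fun u => size u == 4%N) B -> (j < 4)%N ->
  size cs = size B ->
  zr R (nth Z0 (lin_comb cs B) j)
  = \sum_(k < size B) zr R (nth Z0 cs k) * zr R (nth Z0 (nth [::] B k) j).
Proof.
move=> + j4; elim: cs B => [|c cs IH] [|u B] //=.
  by rewrite big_ord0 => _ _; case: j j4 => [|[|[|[]]]] //= _; rewrite zr0.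
case/andP=> /eqP u4 B4 [sB]; rewrite big_ord_recl /= -IH //.
case: Z.eqb_spec => [->|_]; first by rewrite zr0 mul0r add0r.
rewrite nth_zadd ?size_map ?size_lin_comb // zrD; congr (_ + _).
by rewrite (nth_map Z0) ?u4 // zrM.
Qed.

Lemma zmx_mul A B : wf_lmx A -> wf_lmx B -> zmx R (lmx_mul A B) = zmx R A * zmx R B.
Proof.
move=> wA wB; have [/eqP sA _] := andP wA; have [/eqP sB wB'] := andP wB.
apply/matrixP => i j; rewrite !mxE (nth_map [::]) ?sA // nth_lin_comb ?nth_wf_lmx //.
by rewrite sB; apply: eq_bigr => k _; rewrite !mxE.
Qed.

Lemma zmx0 : zmx R lmx0 = 0.
Proof.
apply/matrixP => i j; rewrite !mxE nth_nseq ltn_ord nth_nseq ltn_ord.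
exact: zr0.
Qed.

Lemma zmx1 : zmx R lmx1 = 1.
Proof.
apply/matrixP => i j; rewrite !mxE nth_mkseq // nth_mkseq // -val_eqE.
by case: ifP => _; rewrite ?zr0 ?zr1.
Qed.

Lemma zmx_tr A : zr R (lmx_tr A) = \tr (zmx R A).
Proof.
rewrite /lmx_tr /mxtrace !big_ord_recl big_ord0 /= !zrD zr0 !mxE.
by [].
Qed.

End ListMatrices.

Definition lmx_commutator (X Y : lmx) : lmx := lmx_add (lmx_mul X Y) (lmx_opp (lmx_mul Y X)).

Fixpoint lmx_powers (c : lmx) (n : nat) (A : lmx) : seq lmx :=
  if n is n.+1 then A :: lmx_powers c n (lmx_mul c A) else [:: A].

Definition lmx_core12 (X Y c3 : lmx) : lmx :=
  let X2 := lmx_mul X X in let Y2 := lmx_mul Y Y in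
  lmx_mul c3
    (lmx_add (lmx_add (lmx_add (lmx_mul X2 Y2) (lmx_opp (lmx_mul (lmx_mul X Y2) X)))
                      (lmx_opp (lmx_mul (lmx_mul Y X2) Y)))
             (lmx_mul Y2 X2)).

(** Pascal's rule: entry k of the new row is X times entry k plus Y times entry k - 1 of the old
    one, padded by zero at both ends. *)
Definition next_shuffles (X Y : lmx) (r : seq lmx) : seq lmx :=
  [seq lmx_add AB.1 AB.2 |
    AB <- zip (rcons (map (lmx_mul X) r) lmx0) (lmx0 :: map (lmx_mul Y) r)].

Fixpoint shuffle_rows (X Y : lmx) (n : nat) (r : seq lmx) : seq (seq lmx) :=
  if n is n.+1 then r :: shuffle_rows X Y n (next_shuffles X Y r) else [:: r].

(** The traces [gen_trace] of the thirty generators at the pair (X, Y). All a_i and all b_i with i <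
    12 are at most 4, which bounds both tables. *)
Definition gen_values (X Y : lmx) : seq Z :=
  let pows := lmx_powers (lmx_commutator X Y) 4 lmx1 in
  let cores := fun i => if i == 12%N then lmx_core12 X Y (nth lmx0 pows 3)
                        else nth lmx0 pows (b_ i) in
  let shuffles := shuffle_rows X Y 4 [:: lmx1] in
  [seq lmx_tr (lmx_mul (cores ijk.1.1) (nth lmx0 (nth [::] shuffles (a_ ijk.1.1)) ijk.2))
  | ijk <- basisG].

Section GeneratorValues.

Variables (R : comNzRingType) (X Y : lmx).
Hypotheses (wX : wf_lmx X) (wY : wf_lmx Y).
Local Notation x := (zmx R X).
Local Notation y := (zmx R Y).

Definition represents (A : lmx) (M : 'M[R]_4) := wf_lmx A /\ zmx R A = M.

Lemma represents_mul A B M N :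
  represents A M -> represents B N -> represents (lmx_mul A B) (M * N).
Proof. by move=> [wA <-] [wB <-]; split; [apply: wf_lmx_mul | apply: zmx_mul]. Qed.

Lemma represents_add A B M N :
  represents A M -> represents B N -> represents (lmx_add A B) (M + N).
Proof. by move=> [wA <-] [wB <-]; split; [apply: wf_lmx_add | apply: zmx_add]. Qed.

Lemma represents_opp A M : represents A M -> represents (lmx_opp A) (- M).
Proof. by move=> [wA <-]; split; [apply: wf_lmx_opp | apply: zmx_opp]. Qed.

Lemma represents0 : represents lmx0 0.
Proof. by split; [|apply: zmx0]. Qed.

Lemma represents1 : represents lmx1 1.
Proof. by split; [|apply: zmx1]. Qed.

Lemma representsX : represents X x. Proof. by []. Qed.
Lemma representsY : represents Y y. Proof. by []. Qed.

Hint Resolve represents_mul represents_add represents_opp represents0 represents1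
  representsX representsY : core.

Lemma represents_commutator : represents (lmx_commutator X Y) (commutator x y).
Proof. by rewrite /commutator /lmx_commutator; auto. Qed.

Lemma represents_powers c C n A M k : represents c C -> represents A M -> (k <= n)%N ->
  represents (nth lmx0 (lmx_powers c n A) k) (C ^+ k * M).
Proof.
move=> cC; elim: n A M k => [|n IH] A M [|k] //= AM; rewrite ?expr0 ?mul1r //.
by rewrite ltnS => /(IH _ (C * M)) H; rewrite exprSr -mulrA; apply: H; auto.
Qed.

Lemma represents_core12 c3 C3 : represents c3 C3 ->
  represents (lmx_core12 X Y c3) (C3 * (x ^+ 2 * y ^+ 2 - x * y ^+ 2 * x - y * x ^+ 2 * y
                       + y ^+ 2 * x ^+ 2)).
Proof. by move=> c3C; rewrite !expr2; rewrite /lmx_core12; auto 10. Qed.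

Definition shuffle_row (a : nat) (r : seq lmx) :=
  size r = a.+1 /\ forall k, (k <= a)%N -> represents (nth lmx0 r k) (shuffle x y a k).

Lemma next_shufflesP a r : shuffle_row a r -> shuffle_row a.+1 (next_shuffles X Y r).
Proof.
move=> [sr rP]; have sz : size (rcons (map (lmx_mul X) r) lmx0) = a.+2.
  by rewrite size_rcons size_map sr.
have sz' : size (lmx0 :: map (lmx_mul Y) r) = a.+2 by rewrite /= size_map sr.
split; first by rewrite size_map size1_zip sz ?sz'.
move=> k ka; rewrite (nth_map (lmx0, lmx0)) ?size1_zip ?sz ?sz' //.
rewrite nth_zip ?sz ?sz' // nth_rcons size_map sr ltnS.
(* At k = a + 1 the padding represents x times [shuffle x y a a.+1], which is 0. *)
have left_P : represents (if (k <= a)%N then nth lmx0 [seq lmx_mul X i | i <- r] k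
    else if k == a.+1 then lmx0 else lmx0) (x * shuffle x y a k).
  case: leqP => ka'; first by rewrite (nth_map lmx0) ?sr //; auto.
  by rewrite shuffle_gt // mulr0 if_same.
case: k ka left_P => [|k] ka left_P /=; last first.
  by apply: represents_add => //; rewrite (nth_map lmx0) ?sr //; auto.
by rewrite -[_ * _]addr0; apply: represents_add.
Qed.

Lemma shuffle_rowsP n b r a : shuffle_row b r -> (a <= n)%N ->
  shuffle_row (b + a) (nth [::] (shuffle_rows X Y n r) a).
Proof.
elim: n b r a => [|n IH] b r [|a] //= rP; rewrite ?addn0 //.
by rewrite ltnS -addSnnS; apply: IH; apply: next_shufflesP.
Qed.

Lemma gen_valuesE (v : 'I_30) : zr R (nth Z0 (gen_values X Y) v)
  = \tr (core x y (fam v) * shuffle x y (a_ (fam v)) (yexp v)).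
Proof.
rewrite /gen_values (nth_map (0, 0, 0)%N) ?size_basisG // -tripGE zmx_tr /=.
set M := lmx_mul _ _; have [_ <- //] : represents M (core x y (fam v)
  * shuffle x y (a_ (fam v)) (yexp v)).
have ab : (a_ (fam v) <= 4)%N && ((b_ (fam v) <= 4)%N || (fam v == 12%N)).
  have := fam_bounds v; move: (fam v) => i.
  by do 13?[case: i => [|i] //].
case/andP: ab => a4 b4; apply: represents_mul; last first.
  have r1 : shuffle_row 0 [:: lmx1] by split=> // -[|//] _ /=.
  have [_] := shuffle_rowsP r1 a4; rewrite add0n; apply.
  by rewrite -xexp_yexp leq_addl.
have pw k : (k <= 4)%N -> represents
    (nth lmx0 (lmx_powers (lmx_commutator X Y) 4 lmx1) k) (commutator x y ^+ k).
  move=> k4; rewrite -[_ ^+ k]mulr1; apply: represents_powers => //.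
  exact: represents_commutator.
rewrite /core; case: eqP b4 => [_ _|_]; first by apply: represents_core12; exact: (pw 3).
by rewrite orbF => /pw.
Qed.

End GeneratorValues.

(** * Relations of bidegree (6,6) *)

Section PointEvaluation.

Variable K : fieldType.
Hypothesis charK0 : [pchar K] =i pred0.
Variables (X Y : lmx).
Hypotheses (wX : wf_lmx X) (wY : wf_lmx Y).
Hypotheses (tX : lmx_tr X = Z0) (tY : lmx_tr Y = Z0).

Definition point (v : 'I_(2 * (4 * 4))) : K :=
  mxvec (\matrix_(l < 2) mxvec (if l == 0 then zmx K X else zmx K Y)) 0 v.

Lemma meval_entry l r s :
  (entry K l r s).@[point] = (if l == 0 then zmx K X else zmx K Y) r s.
Proof. by rewrite mevalXU /point mxvecE mxE mxvecE. Qed.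

(** The corner entry of [gmx] is minus the sum of the other diagonal entries, so the specialization
    returns the given matrix exactly because its trace is 0. *)
Lemma meval_gmx l :
  map_mx (meval point) (gmx K l) = if l == 0 then zmx K X else zmx K Y.
Proof.
apply/matrixP => r s; rewrite !mxE; case: ifP => [/andP[/eqP -> /eqP ->]|_]; last first.
  exact: meval_entry.
rewrite rmorphN rmorph_sum /=; under eq_bigr => k _ do rewrite meval_entry.
set M := if l == 0 then _ else _.
have tM : \tr M = 0 by rewrite /M; case: ifP => _; rewrite -zmx_tr ?tX ?tY zr0.
by apply/esym/eqP; rewrite -addr_eq0 -[X in _ == X]tM /mxtrace [X in _ == X](bigD1 ord_max).
Qed.

Lemma core_morph (A B : nzRingType) (f : {rmorphism A -> B}) x y i :
  f (core x y i) = core (f x) (f y) i.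
Proof.
have fc : f (commutator x y) = commutator (f x) (f y) by rewrite rmorphB !rmorphM.
rewrite /core; case: ifP => _; last by rewrite rmorphXn fc.
rewrite rmorphM [f (_ ^+ 3)]rmorphXn fc; congr (_ * _).
by rewrite rmorphD !rmorphB !rmorphM.
Qed.

Lemma shuffle_morph (A B : nzRingType) (f : {rmorphism A -> B}) x y a k :
  f (shuffle x y a k) = shuffle (f x) (f y) a k.
Proof.
elim: a k => [|a IH] [|k] /=; rewrite ?rmorph1 ?rmorph0 //.
  by rewrite rmorphM IH.
by rewrite rmorphD !rmorphM !IH.
Qed.

Definition gen_point (v : 'I_30) : K :=
  'C(a_ (fam v), yexp v)%:R^-1 * zr K (nth Z0 (gen_values X Y) v).

Lemma meval_evalG p : (evalG p).@[point] = p.@[gen_point].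
Proof.
rewrite /evalG comp_mpoly_meval; apply: meval_eq => v.
rewrite tnth_mktuple phiE -?xexp_yexp ?leq_addl // mevalZ xexp_yexp /gen_point.
congr (_ * _); rewrite /gen_trace /mxtrace rmorph_sum gen_valuesE //.
have := rmorphM (map_mx (meval point)) (core (gmx K 0) (gmx K 1) (fam v))
  (shuffle (gmx K 0) (gmx K 1) (a_ (fam v)) (yexp v)).
rewrite /= core_morph shuffle_morph /= !meval_gmx /= => <-.
by apply: eq_bigr => i _; rewrite [RHS]mxE.
Qed.

End PointEvaluation.

Definition xweight (v : nat) : nat :=
  (b_ (nth (0, 0, 0)%N basisG v).1.1 + (nth (0, 0, 0)%N basisG v).1.2)%N.

Definition yweight (v : nat) : nat :=
  (b_ (nth (0, 0, 0)%N basisG v).1.1 + (nth (0, 0, 0)%N basisG v).2)%N.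

(** Exponents up to a + b suffice, because every generator has positive total degree. *)
Fixpoint monomials (vs : seq nat) (a b : nat) : seq (seq nat) :=
  if vs is v :: vs then
    flatten [seq [seq nseq e v ++ ws | ws <- monomials vs (a - e * xweight v) (b - e * yweight v)]
            | e <- iota 0 (a + b).+1 & (e * xweight v <= a)%N && (e * yweight v <= b)%N]
  else if (a == 0%N) && (b == 0%N) then [:: [::]] else [::].

Section Monomials.

Lemma xdeg_inord v : (v < 30)%N -> xdeg (inord v) = xweight v.
Proof. by move=> v30; rewrite /xdeg /fam /xexp inordK. Qed.

Lemma ydeg_inord v : (v < 30)%N -> ydeg (inord v) = yweight v.
Proof. by move=> v30; rewrite /ydeg /fam /yexp inordK. Qed.

Lemma mem_monomials (f : nat -> nat) vs a b :
  all (fun v => 0 < xweight v + yweight v)%N vs ->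
  sumn [seq (f v * xweight v)%N | v <- vs] = a ->
  sumn [seq (f v * yweight v)%N | v <- vs] = b ->
  flatten [seq nseq (f v) v | v <- vs] \in monomials vs a b.
Proof.
elim: vs a b => [|v vs IH] a b; first by move=> _ <- <-.
case/andP=> v0 vs0 <- <-; apply/flatten_mapP; exists (f v).
  rewrite mem_filter !leq_addr mem_iota add0n ltnS addnACA -mulnDr.
  by apply: leq_trans (leq_addr _ _); rewrite leq_pmulr.
by apply: map_f; rewrite /= !addKn; apply: IH.
Qed.

Definition mnm_vars (m : 'X_{1..30}) : seq nat :=
  flatten [seq nseq (m (inord v)) v | v <- iota 0 30].

Lemma mnm_varsK m : vars_mnm (mnm_vars m) = m.
Proof.
rewrite /vars_mnm big_flatten big_map -[iota 0 30]/(index_iota 0 30) big_mkord.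
rewrite [RHS]multinomUE_id; apply: eq_bigr => v _.
rewrite big_nseq inord_val; elim: (m v) => [|k IH] //=.
by rewrite IH mulmS.
Qed.

Lemma weight_mnm_vars c wt (m : 'X_{1..30}) : (forall v, (v < 30)%N -> c (inord v) = wt v) ->
  sumn [seq (m (inord v) * wt v)%N | v <- iota 0 30] = weight c m.
Proof.
move=> cE; rewrite sumnE big_map -[iota 0 30]/(index_iota 0 30) big_mkord /weight.
by apply: eq_bigr => v _; rewrite -cE // inord_val mulnC.
Qed.

(** L may list the monomials in any order, which leaves the order of the columns free for the
    elimination. *)
Lemma bihomog_expand (K : fieldType) a b (L : seq (seq nat)) (p : {mpoly K[30]}) :
  uniq L -> all (sorted leq) L -> all (all (ltn^~ 30)) L ->
  all (mem L) (monomials (iota 0 30) a b) -> bihomog a b p ->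
  p = \sum_(ws <- L) p@_(vars_mnm ws) *: vars K ws.
Proof.
move=> uL sL L30 /allP cL /andP[/dhomogP px /dhomogP py].
have inj : {in L &, injective vars_mnm}.
  move=> u v uL' vL' /mnmP E; apply: (sorted_eq leq_trans anti_leq).
  - exact: (allP sL).
  - exact: (allP sL).
  apply/allP => w; rewrite mem_cat => w_in.
  have w30 : (w < 30)%N.
    by case/orP: w_in; [move/(allP (allP L30 _ uL')) | move/(allP (allP L30 _ vL'))].
  have := E (Ordinal w30).
  by rewrite !vars_mnmE //= ?(allP L30) // => ->.
rewrite [LHS]mpolyE; under [RHS]eq_bigr => ws _ do rewrite varsE.
rewrite -(big_map vars_mnm xpredT (fun m => p@_m *: 'X_[m])).
rewrite [RHS](bigID (mem (msupp p))) /= [X in _ + X]big1 ?addr0; last first.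
  by move=> m /memN_msupp_eq0 ->; rewrite scale0r.
rewrite -[RHS]big_filter; apply: perm_big; apply: uniq_perm.
- exact: msupp_uniq.
- by rewrite filter_uniq // map_inj_in_uniq.
move=> m; rewrite mem_filter /=; case E: (m \in msupp p) => //=; apply/esym.
apply/mapP; exists (mnm_vars m); last by rewrite mnm_varsK.
apply: cL; apply: mem_monomials => //.
  by rewrite (weight_mnm_vars _ xdeg_inord); apply: px.
by rewrite (weight_mnm_vars _ ydeg_inord); apply: py.
Qed.

End Monomials.

(** * Linear algebra modulo 7 *)

Section ModularElimination.

(* Any prime that keeps the matrix below nonsingular would do. *)
Local Notation q := (Zpos 7).
Local Notation Fq := 'F_7.

(** Cross-multiplication h r - g (h :: t) clears the leading entry g of r without inverting the
    pivot h. *)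
Definition row_reduce (h : Z) (t r : seq Z) : seq Z :=
  if r is g :: u then
    if Z.eqb g Z0 then u
    else [seq Z.modulo (Z.sub (Z.mul h ab.1) (Z.mul g ab.2)) q | ab <- zip u t]
  else [::].

Definition unit_mod (h : Z) : bool :=
  has (fun g => Z.eqb (Z.modulo (Z.mul h g) q) (Zpos xH)) (map Z.of_nat (iota 1 6)).

(** No rows are exchanged: the head of the first remaining row must be a unit at every stage. *)
Fixpoint eliminate (n : nat) (rows : seq (seq Z)) : bool :=
  match n, rows with
  | 0, _ => true
  | n.+1, (h :: t) :: rows => unit_mod h && eliminate n (map (row_reduce h t) rows)
  | _, _ => false
  end.

Lemma zr_mod a : zr Fq (Z.modulo a q) = zr Fq a.
Proof.
rewrite {2}(Z.div_mod a q) // zrD zrM.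
by rewrite (_ : zr Fq q = 0) ?mul0r ?add0r //; apply/val_inj.
Qed.

Lemma unit_mod_neq0 h : unit_mod h -> zr Fq h != 0.
Proof.
case/hasP=> g _ /Z.eqb_spec E; apply/eqP => h0.
have := zr_mod (Z.mul h g); rewrite E zrM h0 mul0r zr1 => /eqP.
by rewrite oner_eq0.
Qed.

Definition dot_mod (r : seq Z) (x : seq Fq) : Fq := \sum_(ab <- zip r x) zr Fq ab.1 * ab.2.

Lemma dot_mod_reduce h t r (b : Fq) x : size t = size x -> size r = (size x).+1 ->
  dot_mod (h :: t) (b :: x) = 0 -> dot_mod r (b :: x) = 0 ->
  dot_mod (row_reduce h t r) x = 0.
Proof.
case: r => //= g u st [su]; rewrite /dot_mod /= !big_cons /= => E1 E2.
case: Z.eqb_spec E2 => [->|_ E2]; first by rewrite zr0 mul0r add0r.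
have -> : \sum_(ab <- zip [seq Z.modulo (Z.sub (Z.mul h ab.1) (Z.mul g ab.2)) q | ab <- zip u t] x)
     zr Fq ab.1 * ab.2
    = zr Fq h * \sum_(ab <- zip u x) zr Fq ab.1 * ab.2
      - zr Fq g * \sum_(ab <- zip t x) zr Fq ab.1 * ab.2.
  elim: x t u st su {E1 E2} => [|c x IH] [|e t] [|f u] //=.
    by rewrite !big_nil !mulr0 subr0.
  case=> st [su]; rewrite !big_cons IH //= zr_mod -Z.add_opp_r zrD zrN !zrM.
  by ring.
have -> : \sum_(ab <- zip u x) zr Fq ab.1 * ab.2 = - (zr Fq g * b).
  by apply/eqP; rewrite -addr_eq0 addrC E2.
have -> : \sum_(ab <- zip t x) zr Fq ab.1 * ab.2 = - (zr Fq h * b).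
  by apply/eqP; rewrite -addr_eq0 addrC E1.
by ring.
Qed.

(** The reduced rows annihilate the tail of x, which is zero by induction; the first row then says
    that the pivot times the head of x is zero. *)
Lemma eliminateP rows (x : seq Fq) : eliminate (size x) rows ->
  {in rows, forall r, size r = size x /\ dot_mod r x = 0} -> x = nseq (size x) 0.
Proof.
elim: x rows => // b x IH [|[|h t] rows] //= /andP[/unit_mod_neq0 h0 el] rP.
have [[st] dt] := rP _ (mem_head _ _).
have x0 : x = nseq (size x) 0.
  apply: IH el _ => _ /mapP[r r_in ->].
  have [sr dr] := rP r (mem_behead (s := _ :: rows) r_in).
  split; last exact: dot_mod_reduce dt dr.
  case: r sr {dr r_in} => //= g u [su]; case: ifP => // _.
  by rewrite size_map size1_zip su ?st.
move: dt; rewrite /dot_mod big_cons /=.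
have -> : \sum_(ab <- zip t x) zr Fq ab.1 * ab.2 = 0.
  rewrite x0; elim: t (size x) {st el rP} => [|e t IHt] [|n] /=; rewrite ?big_nil //.
  by rewrite big_cons mulr0 add0r.
by rewrite addr0 => /eqP; rewrite mulf_eq0 (negbTE h0) => /eqP ->; rewrite -x0.
Qed.

(** The determinant of the integer matrix T survives reduction modulo 7, hence is nonzero in Z and
    in K. The rows agree with T only modulo 7, so the large integers T i j are never computed. *)
Lemma kernel_char0 (K : fieldType) (charK0 : [pchar K] =i pred0) n (T : nat -> nat -> Z)
    (rows : seq (seq Z)) (c : nat -> K) :
  size rows = n -> all (fun r => size r == n) rows -> eliminate n rows ->
  (forall i j, (i < n)%N -> (j < n)%N ->
     zr Fq (nth Z0 (nth [::] rows i) j) = zr Fq (T i j)) ->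
  (forall i, (i < n)%N -> \sum_(j < n) c j * zr K (T i j) = 0) ->
  forall j, (j < n)%N -> c j = 0.
Proof.
move=> sr /allP rn el TE cT j jn.
(* Transposed, so that the unknowns form a row vector, as in [det0P]. *)
pose B : 'M[int]_n := \matrix_(i, j) int_of_Z (T j i).
have detF : \det (map_mx (intr : int -> Fq) B) != 0.
  apply/det0P => -[v vn0 vB]; case/negP: vn0; apply/eqP/rowP => k; rewrite mxE.
  pose x := [seq v 0 i | i <- enum 'I_n].
  have sx : size x = n by rewrite size_map size_enum_ord.
  suff x0 : x = nseq n 0.
    have := congr1 (fun s => nth 0 s k) x0; rewrite nth_nseq ltn_ord => <-.
    by rewrite (nth_map k) ?size_enum_ord // nth_ord_enum.
  rewrite -[in RHS]sx; apply: eliminateP; first by rewrite sx; exact: el.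
  move=> r r_in; split; first by rewrite sx; apply/eqP/rn.
  have [i i_lt <-] := nthP [::] r_in; rewrite sr in i_lt.
  have := congr1 (fun u : 'rV_n => u 0 (Ordinal i_lt)) vB; rewrite !mxE => <-.
  rewrite /dot_mod (big_nth (Z0, 0)) size2_zip ?sx; last first.
    by rewrite (eqP (rn _ _)) ?mem_nth ?sr.
  rewrite big_mkord; apply: eq_bigr => l _.
  rewrite nth_zip /=; last by rewrite sx; apply/eqP/rn; rewrite mem_nth ?sr.
  rewrite (nth_map l) ?size_enum_ord // nth_ord_enum mulrC TE // !mxE.
  by [].
have detB : \det B != 0.
  by apply: contraNneq detF => B0; rewrite det_map_mx B0 rmorph0.
have detK : \det (map_mx (intr : int -> K) B) != 0.
  rewrite det_map_mx; case: (\det B) detB => k k0 /=.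
    by rewrite -pmulrn natr_neq0 // lt0n.
  by rewrite NegzE rmorphN /= oppr_eq0 -pmulrn natr_neq0.
have : \row_(j < n) c j = 0.
  have uB : map_mx (intr : int -> K) B \in unitmx by rewrite unitmxE unitfE.
  apply: (can_inj (mulmxK uB)); rewrite mul0mx; apply/rowP => i; rewrite !mxE.
  by rewrite -[RHS](cT i) //; apply: eq_bigr => l _; rewrite !mxE.
by move/rowP/(_ (Ordinal jn)); rewrite !mxE.
Qed.

End ModularElimination.

(* Coord k is the coefficient of the k-th monomial, Point X Y is the evaluation at a pair
   of traceless matrices, each encoded by one number. *)
Inductive row_spec := Coord of nat | Point of positive & positive.

(** Digits in base 4 below a leading 1, lowest first, the digit 3 standing for -1. Sixteen digits
    list a 4 x 4 matrix row by row. *)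
Fixpoint entries_of_pos (p : positive) : seq Z :=
  match p with
  | xO (xO p) => Z0 :: entries_of_pos p
  | xI (xO p) => Zpos xH :: entries_of_pos p
  | xO (xI p) => Zpos 2 :: entries_of_pos p
  | xI (xI p) => Zneg xH :: entries_of_pos p
  | _ => [::]
  end.

Definition lmx_of_pos (p : positive) : lmx :=
  let e := entries_of_pos p in
  [:: take 4 e; take 4 (drop 4 e); take 4 (drop 8 e); take 4 (drop 12 e)].

Definition mono_mod (g : seq Z) (ws : seq nat) : Z :=
  foldr (fun v x => let a := nth Z0 g v in
           if Z.eqb a Z0 then Z0 else Z.modulo (Z.mul a x) (Zpos 7)) (Zpos xH) ws.

Definition unit_row (n k : nat) : seq Z :=
  mkseq (fun j => if j == k then Zpos xH else Z0) n.

Definition spec_row (L : seq (seq nat)) (s : row_spec) : seq Z :=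
  match s with
  | Coord k => unit_row (size L) k
  | Point X Y =>
      let g := [seq Z.modulo a (Zpos 7) | a <- gen_values (lmx_of_pos X) (lmx_of_pos Y)] in
      map (mono_mod g) L
  end.

Definition traceless_lmx (X : positive) : bool :=
  let A := lmx_of_pos X in wf_lmx A && Z.eqb (lmx_tr A) Z0.

Definition wf_spec (s : row_spec) : bool :=
  if s is Point X Y then traceless_lmx X && traceless_lmx Y else true.

Definition rank_check (a b : nat) (L : seq (seq nat)) (specs : seq row_spec) : bool :=
  [&& uniq L, all (sorted leq) L, all (all (ltn^~ 30)) L,
      all (mem L) (monomials (iota 0 30) a b), size specs == size L, all wf_spec specs
    & eliminate (size L) (map (spec_row L) specs)].

Section RankCheck.

Variable K : fieldType.
Hypothesis charK0 : [pchar K] =i pred0.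

Definition mono_value (g : seq Z) (ws : seq nat) : Z :=
  foldr (fun v => Z.mul (nth Z0 g v)) (Zpos xH) ws.

Definition spec_value (L : seq (seq nat)) (s : row_spec) (j : nat) : Z :=
  match s with
  | Coord k => nth Z0 (unit_row (size L) k) j
  | Point X Y => mono_value (gen_values (lmx_of_pos X) (lmx_of_pos Y)) (nth [::] L j)
  end.

Lemma mono_modE g ws :
  zr 'F_7 (mono_mod [seq Z.modulo a (Zpos 7) | a <- g] ws) = zr 'F_7 (mono_value g ws).
Proof.
elim: ws => //= v ws IH; rewrite zrM -IH.
have E : zr 'F_7 (nth Z0 [seq Z.modulo a (Zpos 7) | a <- g] v) = zr 'F_7 (nth Z0 g v).
  case: (ltnP v (size g)) => vg; last by rewrite !nth_default ?size_map.
  by rewrite (nth_map Z0) // zr_mod.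
by case: Z.eqb_spec E => [-> <-|_ <-]; rewrite ?zr0 ?mul0r // zr_mod zrM.
Qed.

Lemma spec_rowE L s j : (j < size L)%N ->
  zr 'F_7 (nth Z0 (spec_row L s) j) = zr 'F_7 (spec_value L s j).
Proof. by case: s => [k|X Y] // jL; rewrite [spec_row _ _]/spec_row (nth_map [::]) // mono_modE. Qed.

Definition inv_binoms (ws : seq nat) : K :=
  \prod_(v <- ws) 'C(a_ (fam (inord v)), yexp (inord v))%:R^-1.

Lemma inv_binoms_neq0 ws : inv_binoms ws != 0.
Proof.
apply: (big_ind (fun x => x != 0)) => [|x y|v _]; [exact: oner_neq0 | exact: mulf_neq0 |].
by rewrite invr_eq0 natr_neq0 // bin_gt0 -xexp_yexp leq_addl.
Qed.

Lemma meval_vars X Y ws : all (ltn^~ 30) ws ->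
  (vars K ws).@[gen_point K X Y] = inv_binoms ws * zr K (mono_value (gen_values X Y) ws).
Proof.
elim: ws => [|v ws IH] /=; first by rewrite /vars /inv_binoms !big_nil meval1 mul1r.
case/andP=> v30 ws30; rewrite vars_cons mevalM IH // mevalXU /inv_binoms big_cons zrM.
by rewrite /gen_point inordK // mulrACA.
Qed.

Lemma rank_checkP a b L specs (p : {mpoly K[30]}) : rank_check a b L specs ->
  bihomog a b p -> J p ->
  (forall k, (k < size L)%N -> has (fun s => if s is Coord j then j == k else false) specs ->
     p@_(vars_mnm (nth [::] L k)) = 0) ->
  p = 0.
Proof.
case/and5P=> uL sL L30 cL /and3P[/eqP sz /(all_nthP (Coord 0)) wf el] hp Jp p0.
have pE := bihomog_expand uL sL L30 cL hp.
(* Absorbing the inverse binomials into the unknowns leaves a linear system with integer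
   coefficients; since they are nonzero, c j = 0 still gives the vanishing of the coefficient. *)
pose c j := p@_(vars_mnm (nth [::] L j)) * inv_binoms (nth [::] L j).
have c0 : forall j, (j < size L)%N -> c j = 0.
  apply: (@kernel_char0 K charK0 _ (fun i => spec_value L (nth (Coord 0) specs i)) _ c) el _ _.
  - by rewrite size_map.
  - by rewrite all_map; apply/(all_nthP (Coord 0)) => i _ /=;
      case: nth => [k|X Y]; rewrite ?size_mkseq ?size_map.
  - by move=> i j iL jL; rewrite (nth_map (Coord 0)) ?sz // spec_rowE.
  move=> i iL; have i_lt : (i < size specs)%N by rewrite sz.
  have := wf i i_lt.
  case E : (nth (Coord 0) specs i) => [k|X Y] /=.
    move=> _; apply: big1 => j _; rewrite nth_mkseq //.
    case: eqP => [jk|_]; last by rewrite zr0 mulr0.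
    suff pj : p@_(vars_mnm (nth [::] L j)) = 0 by rewrite /c pj !mul0r.
    apply: p0 => //; apply/(has_nthP (Coord 0)); exists i => //.
    by rewrite E jk.
  case/andP=> /andP[wX /Z.eqb_spec tX] /andP[wY /Z.eqb_spec tY].
  have := congr1 (meval (point K (lmx_of_pos X) (lmx_of_pos Y))) (Jp : evalG p = 0).
  rewrite meval_evalG // meval0 {1}pE rmorph_sum /= (big_nth [::]) big_mkord => pv.
  rewrite -[RHS]pv; apply: eq_bigr => j _.
  by rewrite mevalZ meval_vars ?(all_nthP [::] L30) // mulrA.
rewrite pE (big_nth [::]) big_mkord big1 // => j _.
have /eqP := c0 j (ltn_ord j); rewrite /c mulf_eq0 (negbTE (inv_binoms_neq0 _)) orbF.
by move/eqP ->; rewrite scale0r.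
Qed.

End RankCheck.


(** The monomials of bidegree (6,6), in an order for which, together with the order of [rows66],
    every pivot met by [eliminate] is a unit modulo 7. *)
Definition monomials66 : seq (seq nat) :=
  [:: [:: 0; 1; 2; 3; 6]; [:: 0; 1; 2; 4; 5]; [:: 0; 1;
  2; 18]; [:: 0; 2; 5; 13]; [:: 2; 3; 6; 8]; [:: 0; 0; 2; 4; 6]; [:: 2; 4; 6; 7]; [:: 0; 1; 1; 2;
  12]; [:: 0; 1; 2; 16]; [:: 0; 1; 23]; [:: 0; 2; 2; 3; 5]; [:: 0; 3; 5; 11]; [:: 0; 2; 9; 12];
  [:: 0; 3; 6; 10]; [:: 0; 5; 20]; [:: 1; 2; 3; 14]; [:: 1; 2; 8; 12]; [:: 1; 2; 21]; [:: 1; 3; 6;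
  9]; [:: 1; 1; 1; 3; 6]; [:: 1; 3; 6; 12]; [:: 1; 5; 19]; [:: 2; 4; 5; 8]; [:: 0; 0; 2; 5; 5];
  [:: 0; 1; 1; 4; 6]; [:: 1; 4; 6; 8]; [:: 1; 4; 5; 12]; [:: 0; 0; 1; 5; 6]; [:: 1; 5; 6; 7]; [::
  0; 5; 6; 8]; [:: 0; 1; 6; 13]; [:: 0; 4; 5; 10]; [:: 0; 5; 5; 12]; [:: 6; 8; 13]; [:: 0; 1; 5;
  14]; [:: 0; 1; 1; 5; 5]; [:: 0; 4; 6; 9]; [:: 0; 2; 4; 14]; [:: 0; 2; 22]; [:: 0; 4; 6; 12]; [::
  1; 2; 4; 13]; [:: 1; 1; 2; 15]; [:: 1; 3; 5; 10]; [:: 1; 1; 2; 3; 5]; [:: 1; 2; 2; 3; 4]; [:: 1;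
  3; 4; 11]; [:: 1; 1; 2; 4; 4]; [:: 2; 3; 4; 10]; [:: 2; 3; 20]; [:: 3; 10; 14]; [:: 1; 4; 5; 9];
  [:: 1; 1; 1; 4; 5]; [:: 1; 1; 4; 14]; [:: 1; 5; 5; 8]; [:: 5; 8; 14]; [:: 1; 1; 5; 13]; [:: 1;
  13; 14]; [:: 2; 3; 5; 9]; [:: 2; 3; 5; 12]; [:: 3; 4; 5; 6]; [:: 5; 26]; [:: 4; 5; 18]; [:: 4;
  27]; [:: 0; 0; 1; 2; 10]; [:: 0; 0; 1; 1; 2; 2]; [:: 0; 1; 1; 2; 9]; [:: 0; 1; 1; 1; 1; 2]; [::
  0; 1; 2; 2; 8]; [:: 0; 2; 8; 10]; [:: 1; 2; 8; 9]; [:: 0; 0; 1; 1; 11]; [:: 0; 1; 8; 11]; [:: 0;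
  1; 1; 1; 10]; [:: 0; 1; 9; 10]; [:: 0; 1; 10; 12]; [:: 0; 1; 1; 17]; [:: 0; 5; 5; 9]; [:: 1; 1;
  1; 2; 8]; [:: 1; 2; 7; 10]; [:: 1; 1; 2; 2; 7]; [:: 1; 1; 7; 11]; [:: 1; 1; 8; 10]; [:: 1; 8;
  17]; [:: 0; 0; 2; 2; 12]; [:: 0; 2; 12; 12]; [:: 0; 2; 24]; [:: 0; 6; 19]; [:: 1; 4; 4; 10]; [::
  1; 10; 15]; [:: 1; 4; 20]; [:: 4; 10; 13]; [:: 2; 8; 18]; [:: 5; 9; 13]; [:: 5; 12; 13]; [:: 13;
  20]; [:: 0; 0; 2; 2; 9]; [:: 0; 2; 9; 9]; [:: 0; 0; 2; 17]; [:: 0; 0; 9; 11]; [:: 0; 0; 11; 12];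
  [:: 0; 2; 2; 4; 4]; [:: 0; 0; 0; 2; 11]; [:: 0; 0; 0; 2; 2; 2]; [:: 0; 2; 2; 2; 7]; [:: 0; 2; 7;
  11]; [:: 0; 2; 2; 15]; [:: 0; 4; 4; 11]; [:: 0; 11; 15]; [:: 0; 9; 17]; [:: 0; 12; 17]; [:: 0;
  10; 18]; [:: 2; 4; 4; 9]; [:: 2; 4; 19]; [:: 0; 10; 16]; [:: 1; 12; 18]; [:: 2; 5; 5; 7]; [:: 0;
  0; 0; 6; 6]; [:: 0; 6; 6; 7]; [:: 0; 0; 6; 14]; [:: 6; 7; 14]; [:: 0; 14; 14]; [:: 0; 0; 10;
  10]; [:: 7; 10; 10]; [:: 1; 1; 9; 12]; [:: 1; 1; 12; 12]; [:: 1; 1; 24]; [:: 1; 9; 18]; [:: 1;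
  1; 1; 18]; [:: 1; 1; 22]; [:: 1; 29]; [:: 1; 1; 1; 1; 12]; [:: 1; 12; 16]; [:: 1; 1; 9; 9]; [::
  1; 1; 1; 16]; [:: 1; 1; 1; 1; 1; 1]; [:: 1; 1; 1; 1; 9]; [:: 1; 9; 16]; [:: 2; 2; 7; 12]; [:: 7;
  11; 12]; [:: 2; 4; 4; 12]; [:: 2; 12; 15]; [:: 2; 8; 16]; [:: 2; 9; 15]; [:: 4; 9; 14]; [:: 4;
  12; 14]; [:: 2; 2; 2; 3; 3]; [:: 2; 3; 3; 11]; [:: 2; 2; 3; 13]; [:: 3; 11; 13]; [:: 2; 2; 7;
  9]; [:: 7; 9; 11]; [:: 2; 7; 17]; [:: 2; 13; 13]; [:: 3; 5; 5; 5]; [:: 3; 5; 17]; [:: 5; 5; 15];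
  [:: 4; 4; 5; 5]; [:: 4; 5; 16]; [:: 14; 19]; [:: 2; 2; 8; 8]; [:: 8; 8; 11]; [:: 3; 6; 16]; [::
  3; 3; 6; 6]; [:: 3; 6; 18]; [:: 3; 28]; [:: 6; 25]; [:: 16; 18]; [:: 16; 16]; [:: 4; 6; 15]; [::
  4; 4; 4; 6]; [:: 4; 4; 17]; [:: 15; 17]; [:: 9; 22]; [:: 8; 10; 12]; [:: 10; 21]; [:: 8; 23];
  [:: 12; 22]; [:: 8; 9; 10]; [:: 9; 9; 9]; [:: 9; 12; 12]; [:: 9; 9; 12]; [:: 9; 24]; [:: 12;
  24]; [:: 12; 12; 12]; [:: 18; 18]]%N.

Definition rows66 : seq row_spec :=
  [:: Point 7584645120 4429204497; Point 5405671680
  7516196869; Point 4630774947 7651524608; Point 4362079493 4836032576; Point 7517839360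
  4362142592; Point 4363128448 4567867392; Point 5116003332 4616893760; Point 4563406017
  4299163139; Point 4311752768 7516454913; Point 4307619852 7785693440; Point 7517245440
  5368982548; Point 4433379600 4349493456; Point 5369233427 4311777344; Point 7517515780
  4833415235; Point 4479979584 7516259328; Point 4566561856 4832133120; Point 4362158080
  4303356192; Point 4332720448 4563665664; Point 4320133168 4563959808; Point 4315987972
  4630642816; Point 7517511760 4563714048; Point 4294988304 5511577859; Point 4295033136
  5100535872; Point 7528775697 4567600189; Point 4563714048 5578689792; Point 5168499760
  4563456036; Point 5649734720 4328521744; Point 7718584448 5376049664; Point 5649730560
  5368777744; Point 4429185744 5909777408; Point 4366278672 5301641216; Point 4362080320
  8066760704; Point 4496494592 4298114060; Point 5372645376 4311760928; Point 4680843520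
  5101337728; Point 5640355888 7583303168; Point 4298113925 4311745543; Point 4311810096
  4496326664; Point 5112860744 5368777728; Point 4899999508 4294983944; Point 4831849537
  4295295168; Point 4299185409 4429193744; Point 5368765952 5368745732; Point 4576247820
  4313321220; Point 4634975233 4564205584; Point 4346350704 4298114316; Point 4546637888
  4295049228; Point 5386272787 4832133168; Point 4303359009 4349509680; Point 5100290052
  4295035921; Point 4311823104 5368712964; Point 5100290112 5469490944; Point 4325638147
  4563550208; Point 4395696384 4328538192; Point 4583343360 4295245872; Point 4445962244
  4329848963; Point 4294970369 8325694464; Point 4496314880 4320133168; Point 4299227152
  5372051472; Point 4295754256 4362076800; Point 4294967616 4429185280; Point 5908988160
  4295245840; Point 5506088976 4320137216; Point 7600078849 5435817987; Point 7537181728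
  5368741632; Point 4298244097 4363145219; Point 7521697804 5376049408; Point 4374691904
  5385489424; Point 4300213264 5419069447; Point 4296015875 4516757505; Point 4497358851
  4310958145; Point 4848713740 4314891328; Point 4362080384 4296097795; Point 4366336256
  4362207248; Point 5100351680 7516455169; Point 4320202752 7767982097; Point 4563419168
  5386275856; Point 7717733392 4563419156; Point 5368774659 5372646160; Point 4314891264
  4429258880; Point 5368908816 4433379600; Point 4311794695 4575986691; Point 4299276356
  4315942912; Point 5637406723 4295033136; Point 4295033632 4496375816; Point 4567609356
  4298208256; Point 4525662208 7517241348; Point 5117165568 4295033028; Point 4563419140
  4496375888; Point 4295230016 4597022976; Point 4295524400 4314891316; Point 5368712320
  4362149888; Point 4299161616 4480565891; Point 4307554304 7584546832; Point 4296019276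
  5100732608; Point 4499488781 7987003408; Point 4362109955 8053281025; Point 4342157323
  7516193800; Point 4329046080 4295327776; Point 4366270768 4567646208; Point 5905776651
  4296035328; Point 4294984707 7517241360; Point 7516209217 4563665156; Point 4296278019
  5389683760; Point 7516459009 4567612417; Point 5368799024 4315947072; Point 5368908816
  4295016972; Point 7851917325 4314891264; Point 4630577156 5368778947; Point 4345300035
  4362126080; Point 4312563712 5368709395; Point 4835050496 4295012360; Point 5371871248
  4563665152; Point 4496298048 7583433728; Point 4328718852 4831871232; Point 4311748672
  4902141953; Point 4295492112 4571791360; Point 4295230256 5112906755; Point 4320133152
  7517241344; Point 4295176204 4497424387; Point 4563419712 4295296003; Point 4295037056
  4496326656; Point 4299165704 4327474368; Point 4429185052 4299161864; Point 4316135424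
  7784640585; Point 4299161860 4898947092; Point 4353687552 4563402824; Point 5100290048
  7529021461; Point 4312006672 4295111815; Point 4299162416 4563615748; Point 4315201537
  4362080320; Point 4597223624 4299161608; Point 5100286156 4296822600; Point 5372429188
  4299169796; Point 5637669775 4307607572; Point 4366343177 4564189440; Point 4437639236
  4395647004; Point 4315676673 4832051208; Point 4617929987 7685046356; Point 5371867200
  4500488384; Point 5368794112 4345303048; Point 5100471299 4295230144; Point 4566550064
  4345565248; Point 4346350656 4299161872; Point 4362275873 4294968000; Point 4295761920
  4563599424; Point 7784988673 4563468352; Point 4298114560 4563714048; Point 5640290572
  5302140928; Point 4500815920 4312796352; Point 5040506116 5419831299; Point 4312006880
  7517242116; Point 7517245444 4429250688; Point 4362088448 4324392976; Point 4563664960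
  4563746816; Point 4294967568 4333244464; Point 4563550224 4563665152; Point 4299424048
  4346085392; Coord 158; Point 4567597056 4362076448; Point 5419502624 4366271232; Point
  4315938848 4298114316; Point 5690818576 4568657923; Point 4295040005 4295036932; Point
  4299428112 7718584320; Point 4563468480 4332744728; Coord 166; Point 4313615416 4848648208;
  Point 4563472448 4831838412; Point 4362076624 7718568128; Point 4563468352 4295786496; Point
  7516193816 4328816656; Point 4303568928 4429185312; Point 4563779584 4831870980; Point
  4429254668 4362272832; Point 4320141312 5426384904; Point 4564189248 4311994496; Point
  4362080384 4362145808; Point 4362404032 4328525840; Point 4513140736 4299227396; Point
  4429250560 4295045184; Point 4831839168 4563681536; Point 5368774663 4613734704; Point
  4324327428 4294979588; Coord 184].

Lemma rank_check66 : rank_check 6 6 monomials66 rows66.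
Proof. by vm_compute. Qed.

(** * The highest weight vectors *)

Definition xexp_nat (v : nat) : nat := (nth (0, 0, 0)%N basisG v).1.2.

Definition yexp_nat (v : nat) : nat := (nth (0, 0, 0)%N basisG v).2.

(** Neighbouring numbers within a family differ by one exchange of x and y, so F and E shift the
    number by one. *)
Definition spoly_lower : spoly -> spoly := spoly_der (fun v => Z.of_nat (xexp_nat v)) predn.

Definition spoly_raise : spoly -> spoly := spoly_der (fun v => Z.of_nat (yexp_nat v)) succn.

Section GeneratorLists.

Variable K : fieldType.

Lemma lowerG_inord v : (v < 30)%N ->
  lowerG 'X_(inord v) = zr K (Z.of_nat (xexp_nat v)) *: 'X_(inord v.-1).
Proof.
move=> v30; rewrite lowerG_X zr_nat /xexp /yexp /fam inordK // /xexp_nat.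
have /allP/(_ v) : all (fun v => let t := nth (0, 0, 0)%N basisG v in
    (t.1.2 == 0)%N || (index (t.1.1, t.1.2.-1, t.2.+1) basisG == v.-1)) (iota 0 30) by [].
rewrite mem_iota v30 => /(_ isT); case: (nth _ _ v) => [[i j] k]; cbn [fst snd].
case/orP=> [/eqP -> | /eqP E]; first by rewrite !scale0r.
by rewrite /zG -index_mem size_basisG E (leq_ltn_trans (leq_pred v) v30).
Qed.

Lemma raiseG_inord v : (v < 30)%N ->
  raiseG 'X_(inord v) = zr K (Z.of_nat (yexp_nat v)) *: 'X_(inord v.+1).
Proof.
move=> v30; rewrite raiseG_X zr_nat /xexp /yexp /fam inordK // /yexp_nat.
have /allP/(_ v) : all (fun v => let t := nth (0, 0, 0)%N basisG v in
    (t.2 == 0)%N || (index (t.1.1, t.1.2.+1, t.2.-1) basisG == v.+1) && (v.+1 < 30)%N)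
  (iota 0 30) by [].
rewrite mem_iota v30 => /(_ isT); case: (nth _ _ v) => [[i j] k]; cbn [fst snd].
case/orP=> [/eqP -> | /andP[/eqP E v1]]; first by rewrite !scale0r.
by rewrite /zG -index_mem size_basisG E v1.
Qed.

Lemma lowerG1 : lowerG 1 = 0 :> {mpoly K[30]}.
Proof. by rewrite -mpolyC1 /lowerG derC. Qed.

Lemma raiseG1 : raiseG 1 = 0 :> {mpoly K[30]}.
Proof. by rewrite -mpolyC1 /raiseG derC. Qed.

Lemma lowerGM (p q : {mpoly K[30]}) : lowerG (p * q) = lowerG p * q + p * lowerG q.
Proof. exact: derM. Qed.

Lemma raiseGM (p q : {mpoly K[30]}) : raiseG (p * q) = raiseG p * q + p * raiseG q.
Proof. exact: derM. Qed.

Lemma lowerG_pol l : small_vars l -> lowerG (pol K l) = pol K (spoly_lower l).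
Proof. exact: (pol_der lowerGM lowerG1 lowerG_inord). Qed.

Lemma raiseG_pol l : small_vars l -> raiseG (pol K l) = pol K (spoly_raise l).
Proof. exact: (pol_der raiseGM raiseG1 raiseG_inord). Qed.

Lemma bihomog_pol a b l : small_vars l -> spoly_weight xweight a l ->
  spoly_weight yweight b l -> bihomog a b (pol K l).
Proof.
move=> l30 la lb; apply/andP; split.
  exact: pol_homog xdeg_inord l30 la.
exact: pol_homog ydeg_inord l30 lb.
Qed.

End GeneratorLists.

Definition v66_spoly : spoly := spoly_lower v75_spoly.

Definition v57_spoly : spoly := spoly_lower v66_spoly.

Section HighestWeightVectors.

Variable K : fieldType.
Local Notation v75 := (v75 K).
Local Notation v66' := (v66' K).
Local Notation v66'' := (v66'' K).

Lemma v66E : lowerG v75 = pol K v66_spoly.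
Proof. by rewrite v75E lowerG_pol. Qed.

Lemma v57E : lowerG (lowerG v75) = pol K v57_spoly.
Proof. by rewrite v66E lowerG_pol //; vm_compute. Qed.

Lemma lowerG3_v75 : lowerG (lowerG (lowerG v75)) = 0.
Proof.
rewrite v57E lowerG_pol; last by vm_compute.
by rewrite -(pol_nil K); apply: pol_eq; vm_compute.
Qed.

Lemma lowerG_v66' : lowerG v66' = 0.
Proof. by rewrite v66'E lowerG_pol // -(pol_nil K); apply: pol_eq; vm_compute. Qed.

Lemma lowerG_v66'' : lowerG v66'' = 0.
Proof. by rewrite v66''E lowerG_pol // -(pol_nil K); apply: pol_eq; vm_compute. Qed.

Lemma raiseG_v75 : raiseG v75 = 0.
Proof. by rewrite v75E raiseG_pol // -(pol_nil K); apply: pol_eq; vm_compute. Qed.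

Lemma raiseG_v66' : raiseG v66' = 0.
Proof. by rewrite v66'E raiseG_pol // -(pol_nil K); apply: pol_eq; vm_compute. Qed.

Lemma raiseG_v66'' : raiseG v66'' = 0.
Proof. by rewrite v66''E raiseG_pol // -(pol_nil K); apply: pol_eq; vm_compute. Qed.

Lemma bihomog_v75 : bihomog 7 5 v75.
Proof. by rewrite v75E; apply: bihomog_pol; vm_compute. Qed.

Lemma bihomog_v66' : bihomog 6 6 v66'.
Proof. by rewrite v66'E; apply: bihomog_pol; vm_compute. Qed.

Lemma bihomog_v66'' : bihomog 6 6 v66''.
Proof. by rewrite v66''E; apply: bihomog_pol; vm_compute. Qed.

Lemma bihomog_v66 : bihomog 6 6 (lowerG v75).
Proof. by rewrite v66E; apply: bihomog_pol; vm_compute. Qed.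

Lemma bihomog_v57 : bihomog 5 7 (lowerG (lowerG v75)).
Proof. by rewrite v57E; apply: bihomog_pol; vm_compute. Qed.

Hypothesis charK0 : [pchar K] =i pred0.

Lemma J_v75 : J v75.
Proof. by rewrite v75E; apply: (relation_checkP charK0 v75_check). Qed.

Lemma J_v66' : J v66'.
Proof. by rewrite v66'E; apply: (relation_checkP charK0 v66'_check). Qed.

Lemma J_v66'' : J v66''.
Proof. by rewrite v66''E; apply: (relation_checkP charK0 v66''_check). Qed.

Let coef_check (ws : seq nat) (l : spoly) (c : Z) : bool :=
  [&& all (ltn^~ 30) ws, small_vars l & Z.eqb (spoly_coef ws l) c].

Let coef_checkP ws l c : coef_check ws l c -> (pol K l)@_(vars_mnm ws) = zr K c.
Proof. by case/and3P=> ws30 l30 /Z.eqb_spec <-; apply: mcoeff_pol. Qed.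

(** On these three monomials the coefficients of [v66'], [v66''] and [lowerG v75] form, up to order,
    a triangular matrix with diagonal -6, 96, 8. This yields both the span and the independence. *)
Let m1 := vars_mnm [:: 14; 19]%N.
Let m2 := vars_mnm [:: 16; 18]%N.
Let m3 := vars_mnm [:: 18; 18]%N.

Let coefs : [/\ v66'@_m1 = zr K (Zneg 6), v66'@_m2 = 0 & v66'@_m3 = 0]
  /\ [/\ v66''@_m1 = 0, v66''@_m2 = 0 & v66''@_m3 = zr K (Zpos 96)]
  /\ [/\ (lowerG v75)@_m1 = zr K (Zneg 24), (lowerG v75)@_m2 = zr K (Zpos 8)
       & (lowerG v75)@_m3 = 0].
Proof.
rewrite v66'E v66''E v66E -(zr0 K).
by do !split; apply: coef_checkP; vm_compute.
Qed.

Let zr_neg_neq0 c : zr K (Zneg c) != 0.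
Proof. by rewrite -[Zneg c]/(Z.opp (Zpos c)) zrN oppr_eq0 zr_pos_neq0. Qed.

(* The three coordinates are those of the rows Coord of rows66. *)
Lemma J66_span (p : {mpoly K[30]}) : bihomog 6 6 p -> J p ->
  exists a b c, p = a *: v66' + b *: v66'' + c *: lowerG v75.
Proof.
move=> hp Jp; have [[c11 c12 c13] [[c21 c22 c23] [c31 c32 c33]]] := coefs.
pose c := p@_m2 / zr K (Zpos 8); pose b := p@_m3 / zr K (Zpos 96).
pose a := (p@_m1 - c * zr K (Zneg 24)) / zr K (Zneg 6).
exists a, b, c; apply/eqP; rewrite -subr_eq0; apply/eqP.
apply: (rank_checkP charK0 rank_check66).
- move: hp bihomog_v66' bihomog_v66'' bihomog_v66 => /andP[? ?] /andP[? ?] /andP[? ?] /andP[? ?].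
  by apply/andP; split; rewrite ?(rpredB, rpredD, rpredZ).
- move: Jp J_v66' J_v66'' (J_lowerG charK0 J_v75); rewrite /J /evalG comp_mpolyB !comp_mpolyD !comp_mpolyZ.
  by move=> -> -> -> ->; rewrite !scaler0 !addr0 subr0.
move=> k k_lt k_in.
have : [|| k == 158, k == 166 | k == 184]%N.
  have /allP/(_ k) : all (fun k => has (fun s => if s is Coord j then j == k else false) rows66
    ==> [|| k == 158, k == 166 | k == 184]%N) (iota 0 (size monomials66)) by vm_compute.
  by rewrite mem_iota add0n k_lt k_in => /(_ isT).
case/or3P=> /eqP ->.
- rewrite -[nth _ _ _]/[:: 14; 19]%N -/m1 !(mcoeffB, mcoeffD, mcoeffZ) c11 c21 c31.
  by rewrite mulr0 addr0 /a divfK // subrK subrr.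
- rewrite -[nth _ _ _]/[:: 16; 18]%N -/m2 !(mcoeffB, mcoeffD, mcoeffZ) c12 c22 c32.
  by rewrite !mulr0 !add0r /c divfK ?subrr // zr_pos_neq0.
- rewrite -[nth _ _ _]/[:: 18; 18]%N -/m3 !(mcoeffB, mcoeffD, mcoeffZ) c13 c23 c33.
  by rewrite !mulr0 !add0r addr0 /b divfK ?subrr // zr_pos_neq0.
Qed.

Lemma hwv66_free (a b c : K) : a *: v66' + b *: v66'' + c *: lowerG v75 = 0 ->
  [/\ a = 0, b = 0 & c = 0].
Proof.
have [[c11 c12 c13] [[c21 c22 c23] [c31 c32 c33]]] := coefs => E.
have coefE m : a * v66'@_m + b * v66''@_m + c * (lowerG v75)@_m = 0.
  by have := congr1 (mcoeff m) E; rewrite !(mcoeffD, mcoeffZ) mcoeff0.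
have /eqP := coefE m2; rewrite c12 c22 c32 !mulr0 !add0r mulf_eq0.
rewrite (negbTE (zr_pos_neq0 charK0 _)) orbF => /eqP c0.
have /eqP := coefE m3; rewrite c13 c23 c33 !mulr0 addr0 add0r mulf_eq0.
rewrite (negbTE (zr_pos_neq0 charK0 _)) orbF => /eqP b0.
have /eqP := coefE m1; rewrite c0 b0 !mul0r !addr0 c11 mulf_eq0.
by rewrite (negbTE (zr_neg_neq0 _)) orbF => /eqP.
Qed.

End HighestWeightVectors.

(** * Relations of degree 12 as an sl_2-module *)

Section LoweringChain.

Variables (K : fieldType) (V : lmodType K) (E F : {linear V -> V}) (l : K).

(** The sl_2-formula for a highest weight vector of weight l. The relation [E, F] = H is assumed
    only along the chain F^k p, where H is the scalar l - 2 k. *)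
Lemma raise_lower_iter n p : E p = 0 ->
  (forall k, (k <= n)%N ->
     E (F (iter k F p)) - F (E (iter k F p)) = (l - k%:R *+ 2) *: iter k F p) ->
  E (iter n.+1 F p) = (n.+1%:R * (l - n%:R)) *: iter n F p.
Proof.
move=> Ep; elim: n => [|n IH] comm.
  have := comm 0%N isT; rewrite /= Ep linear0 subr0 mul0rn subr0 => ->.
  by rewrite mul1r.
have /eqP := comm n.+1 (leqnn _).
rewrite IH; last by move=> k kn; apply: comm; apply: leqW.
rewrite subr_eq => /eqP ->; rewrite linearZ /= -scalerDl; congr (_ *: _).
by rewrite -!natr1; ring.
Qed.

Lemma raise_lower_power n p : E p = 0 ->
  (forall k, (k < n)%N ->
     E (F (iter k F p)) - F (E (iter k F p)) = (l - k%:R *+ 2) *: iter k F p) ->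
  iter n E (iter n F p) = (\prod_(k < n) (k.+1%:R * (l - k%:R))) *: p.
Proof.
move=> Ep; elim: n => [|n IH] comm; first by rewrite big_ord0 scale1r.
rewrite iterSr raise_lower_iter //.
have iterZ c q : iter n E (c *: q) = c *: iter n E q.
  by elim: n {IH comm} => //= m ->; rewrite linearZ.
rewrite iterZ IH; last by move=> k kn; apply: comm; apply: leqW.
by rewrite scalerA big_ord_recr mulrC.
Qed.

End LoweringChain.

(** D - l_i kills the component u_i and multiplies each other u_k by the nonzero number l_k - l_i.
    Induction gives the other components, and u_i remains by subtraction. *)
Lemma eigen_components (K : fieldType) (V : lmodType K) (S : V -> Prop) (D : V -> V)
    (I : eqType) (s : seq I) (l : I -> K) (u : I -> V) :
  (forall c v w, S v -> S w -> S (c *: v + w)) -> (forall v, S v -> S (D v)) ->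
  linear D -> (forall i, D (u i) = l i *: u i) ->
  {in s &, injective l} -> uniq s -> S (\sum_(i <- s) u i) ->
  {in s, forall i, S (u i)}.
Proof.
move=> SL SD linD Du.
have DD : {morph D : v w / v + w} by move=> v w; have := linD 1 v w; rewrite !scale1r.
have D0 : D 0 = 0 by apply: (addIr (D 0)); rewrite -DD !add0r.
have DZ c v : D (c *: v) = c *: D v by have := linD c v 0; rewrite D0 !addr0.
elim: s u Du => // i s IH u Du inj /= /andP[i_s us]; rewrite big_cons => Ssum.
have Ss : {in s, forall j, S (u j)}.
  move=> j js; pose w k := (l k - l i) *: u k.
  have Sw : S (w j).
    apply: (IH w) => //.
    - by move=> k; rewrite DZ Du !scalerA [X in X *: _]mulrC.
    - by move=> k k' ks k's; apply: inj; rewrite in_cons ?ks ?k's orbT.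
    have := SL (- l i) _ _ Ssum (SD _ Ssum).
    rewrite DD (big_morph D DD D0) Du scalerDr addrACA scaleNr addNr add0r.
    rewrite scaler_sumr -big_split /=; congr (S _).
    by apply: eq_bigr => k _; rewrite Du /w scalerBl scaleNr addrC.
  have ji : l j - l i != 0.
    rewrite subr_eq0; apply: contra i_s => /eqP E.
    by rewrite (_ : i = j) //; apply: inj; rewrite ?in_cons ?eqxx ?js ?orbT.
  have := SL (l j - l i)^-1 _ _ Sw (SL (- 1) _ _ Sw Sw).
  by rewrite scaleN1r addNr addr0 scalerA mulVf // scale1r.
move=> j; rewrite in_cons => /predU1P[->|/Ss //].
suff Srest : S (\sum_(k <- s) u k).
  have := SL (- 1) _ _ Srest Ssum.
  by rewrite scaleN1r addrC addrK.
have S0 : S 0 by have := SL (- 1) _ _ Ssum Ssum; rewrite scaleN1r addNr.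
rewrite big_seq; apply: big_ind => // v w Sv Sw.
by have := SL 1 _ _ Sv Sw; rewrite scale1r.
Qed.

(** * The commutator of E and F and the bidegrees *)

Section Weights.

Variable K : fieldType.
Local Notation KG0 := {mpoly K[30]}.

Definition weightG : KG0 -> KG0 :=
  der (fun v => ((xdeg v)%:R - (ydeg v)%:R) *: 'X_v) id.

HB.instance Definition _ := GRing.Linear.on weightG.

Lemma weightGC c : weightG c%:MP = 0. Proof. exact: derC. Qed.
Lemma lowerGC (c : K) : lowerG c%:MP = 0. Proof. exact: derC. Qed.
Lemma raiseGC (c : K) : raiseG c%:MP = 0. Proof. exact: derC. Qed.

Lemma lowerG0 : lowerG 0 = 0 :> KG0. Proof. exact: linear0. Qed.
Lemma raiseG0 : raiseG 0 = 0 :> KG0. Proof. exact: linear0. Qed.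

Lemma weightGD : {morph weightG : p q / p + q}. Proof. exact: linearD. Qed.
Lemma lowerGD : {morph @lowerG K : p q / p + q}. Proof. exact: linearD. Qed.
Lemma raiseGD : {morph @raiseG K : p q / p + q}. Proof. exact: linearD. Qed.

Lemma weightGM p q : weightG (p * q) = weightG p * q + p * weightG q.
Proof. exact: derM. Qed.

Lemma zG_tripG v : zG K (fam v) (xexp v) (yexp v) = 'X_v.
Proof. by rewrite /zG -/(tripG v) tripG_in -/(idxG _ _ _) idxG_tripG. Qed.

Lemma lowerG_zG i j k : (i, j, k) \in basisG ->
  lowerG (zG K i j k) = j%:R *: zG K i j.-1 k.+1.
Proof.
move=> b; rewrite {1}/zG b -/(idxG i j k) lowerG_X.
by have [-> -> ->] := tripG_idxG b.
Qed.

Lemma raiseG_zG i j k : (i, j, k) \in basisG ->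
  raiseG (zG K i j k) = k%:R *: zG K i j.+1 k.-1.
Proof.
move=> b; rewrite {1}/zG b -/(idxG i j k) raiseG_X.
by have [-> -> ->] := tripG_idxG b.
Qed.

(** For x^j y^k the two products give j (k + 1) - k (j + 1) = j - k, and this is the difference of
    the degrees because b_i occurs in both. *)
Lemma commutator_gen (v : 'I_30) :
  raiseG (lowerG 'X_v) - lowerG (raiseG 'X_v) = weightG 'X_v :> KG0.
Proof.
rewrite /weightG der_gen (big_pred1 v) // lowerG_X raiseG_X [raiseG (_ *: _)]linearZ [lowerG (_ *: _)]linearZ /=.
have -> : (xdeg v)%:R - (ydeg v)%:R = (xexp v)%:R - (yexp v)%:R :> K.
  by rewrite /xdeg /ydeg !natrD opprD addrACA subrr add0r.
have -> : (xexp v)%:R *: raiseG (zG K (fam v) (xexp v).-1 (yexp v).+1)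
    = ((xexp v)%:R * (yexp v).+1%:R) *: 'X_v.
  case E : (xexp v) => [|j]; first by rewrite !scale0r mul0r scale0r.
  rewrite raiseG_zG ?mem_basisG ?fam_bounds /= -?xexp_yexp ?E ?addnS //.
  by rewrite -E zG_tripG scalerA.
have -> : (yexp v)%:R *: lowerG (zG K (fam v) (xexp v).+1 (yexp v).-1)
    = ((yexp v)%:R * (xexp v).+1%:R) *: 'X_v.
  case E : (yexp v) => [|j]; first by rewrite !scale0r mul0r scale0r.
  rewrite lowerG_zG ?mem_basisG ?fam_bounds /= -?xexp_yexp ?E ?addnS //.
  by rewrite -E zG_tripG scalerA.
by rewrite -scalerBl -!natr1; congr (_ *: _); ring.
Qed.

(** A commutator of derivations is a derivation, since the mixed terms cancel; so the generators
    decide. *)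
Lemma commutatorG (p : KG0) : raiseG (lowerG p) - lowerG (raiseG p) = weightG p.
Proof.
elim/mpoly_ring_ind: p => [c|v|p q IHp IHq|p q IHp IHq].
- by rewrite lowerGC raiseG0 raiseGC lowerG0 weightGC subrr.
- exact: commutator_gen.
- by rewrite !(lowerGD, raiseGD) weightGD -IHp -IHq opprD addrACA.
rewrite lowerGM raiseGM lowerGD raiseGD !(lowerGM, raiseGM) weightGM -IHp -IHq.
rewrite !mulrBl !mulrBr.
move: (raiseG p) (raiseG q) (lowerG p) (lowerG q) => rp rq lp lq.
by ring.
Qed.

Lemma der_monomial (g : 'I_30 -> K) (m : 'X_{1..30}) :
  der (fun v => g v *: 'X_v) id 'X_[m] = (\sum_v g v * (m v)%:R) *: 'X_[m].
Proof.
rewrite [der]unlock scaler_suml; apply: eq_bigr => v _.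
rewrite mderivX -scalerAl -scalerAr scalerA -mpolyXD; case: (posnP (m v)) => [->|mv].
  by rewrite mulr0 !scale0r.
by rewrite addmC submK // lep1mP -lt0n.
Qed.

Lemma weightG_bihomog a b (p : KG0) : bihomog a b p -> weightG p = (a%:R - b%:R) *: p.
Proof.
case/andP=> /dhomogP pa /dhomogP pb; rewrite [in LHS](mpolyE p) [in RHS](mpolyE p).
rewrite linear_sum scaler_sumr big_seq [RHS]big_seq; apply: eq_bigr => m mp.
rewrite linearZ /= /weightG der_monomial scalerA scalerA mulrC -(pa m mp) -(pb m mp).
congr (_ * _ *: _); rewrite /= /weight !natr_sum -sumrB; apply: eq_bigr => v _.
by rewrite mulrBl !natrM.
Qed.

(* Multiplication by g v after differentiation by 'X_v changes the weight by s - t, which is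
   stated without subtraction. *)
Lemma der_dhomog c s t d d' (g : 'I_30 -> KG0) (p : KG0) :
  (forall v, g v = 0 \/ exists2 e, g v \is e.-homog for (weight c) & (e + t = c v + s)%N) ->
  (d' + t = d + s)%N -> p \is d.-homog for (weight c) ->
  der g id p \is d'.-homog for (weight c).
Proof.
move=> gP dd /dhomogP pd; rewrite (mpolyE p) linear_sum big_seq rpred_sum // => m mp.
rewrite linearZ rpredZ //= [der]unlock rpred_sum // => v _.
have [->|[e ge ec]] := gP v; first by rewrite mul0r rpred0.
rewrite mderivX -scalerAr; case: (posnP (m v)) => [->|mv]; first by rewrite scale0r rpred0.
rewrite rpredZ // (_ : d' = e + (d' - e))%N; last first.
  rewrite subnKC //; have : (weight c m = d)%N by apply: pd.
  rewrite /weight (bigD1 v) //=; case: (m v) mv => // k _; rewrite mulnS; lia.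
apply: dhomogM => //; rewrite dhomogX /=; apply/eqP.
have : weight c ((m - U_(v)) + U_(v))%MM = d.
  by rewrite submK ?lep1mP -?lt0n //; apply: pd.
have -> : weight c ((m - U_(v)) + U_(v))%MM = (weight c (m - U_(v)) + c v)%N.
  rewrite weightD; congr (_ + _)%N; rewrite /weight (bigD1 v) //= mnm1E eqxx muln1.
  by rewrite big1 ?addn0 // => u uv; rewrite mnm1E eq_sym (negbTE uv) muln0.
lia.
Qed.

Lemma zG_homog c (wt : nat -> nat -> nat -> nat) i j k :
  (forall v, c v = wt (fam v) (xexp v) (yexp v)) ->
  zG K i j k \is (wt i j k).-homog for (weight c).
Proof.
move=> cE; rewrite /zG; case: ifP => [b|_]; last exact: rpred0.
rewrite dhomogX /= -/(idxG i j k) /weight (bigD1 (idxG i j k)) //= mnm1E eqxx muln1.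
rewrite big1 ?addn0 => [|u uv]; last by rewrite mnm1E eq_sym (negbTE uv) muln0.
by rewrite cE; have [-> -> ->] := tripG_idxG b.
Qed.

Lemma lowerG_bihomog a b (p : KG0) : bihomog a.+1 b p -> bihomog a b.+1 (lowerG p).
Proof.
case/andP=> pa pb; apply/andP; split.
  apply: (der_dhomog (s := 0) (t := 1)) pa; rewrite ?addn0 ?addn1 // => v.
  case E : (xexp v) => [|j]; [by left; rewrite scale0r | right].
  exists (b_ (fam v) + j)%N; last by rewrite /xdeg E addn0 addn1 addnS.
  by rewrite rpredZ //; apply: (@zG_homog xdeg (fun i j _ => b_ i + j)%N).
apply: (der_dhomog (s := 1) (t := 0)) pb; rewrite ?addn0 ?addn1 // => v; right.
exists (b_ (fam v) + (yexp v).+1)%N; last by rewrite /ydeg addn0 addn1 addnS.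
by rewrite rpredZ //; apply: (@zG_homog ydeg (fun i _ k => b_ i + k)%N).
Qed.

Lemma raiseG_bihomog a b (p : KG0) : bihomog a b.+1 p -> bihomog a.+1 b (raiseG p).
Proof.
case/andP=> pa pb; apply/andP; split; last first.
  apply: (der_dhomog (s := 0) (t := 1)) pb; rewrite ?addn0 ?addn1 // => v.
  case E : (yexp v) => [|j]; [by left; rewrite scale0r | right].
  exists (b_ (fam v) + j)%N; last by rewrite /ydeg E addn0 addn1 addnS.
  by rewrite rpredZ //; apply: (@zG_homog ydeg (fun i _ k => b_ i + k)%N).
apply: (der_dhomog (s := 1) (t := 0)) pa; rewrite ?addn0 ?addn1 // => v; right.
exists (b_ (fam v) + (xexp v).+1)%N; last by rewrite /xdeg addn0 addn1 addnS.
by rewrite rpredZ //; apply: (@zG_homog xdeg (fun i j _ => b_ i + j)%N).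
Qed.

(** A polynomial of weight 0 contains no variable of positive weight. This settles the extreme
    bidegrees, where E or F has no target. *)
Lemma der_weight0 c (g : 'I_30 -> KG0) (p : KG0) :
  (forall v, c v = 0%N -> g v = 0) -> p \is 0.-homog for (weight c) -> der g id p = 0.
Proof.
move=> g0 /dhomogP p0; rewrite (mpolyE p) linear_sum big_seq big1 // => m mp.
rewrite linearZ /= [der]unlock big1 ?scaler0 // => v _.
rewrite mderivX; case: (posnP (m v)) => [->|mv]; first by rewrite scale0r mulr0.
rewrite g0 ?mul0r //; have /eqP := p0 m mp; rewrite /= /weight sum_nat_eq0.
by move/forallP/(_ v); rewrite /= muln_eq0 => /orP[/eqP //|]; rewrite -leqn0 leqNgt mv.
Qed.

Lemma raiseG_y0 a (p : KG0) : bihomog a 0 p -> raiseG p = 0.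
Proof.
case/andP=> _; apply: der_weight0 => v /eqP; rewrite addn_eq0 => /andP[_ /eqP ->].
by rewrite scale0r.
Qed.

Lemma lowerG_x0 b (p : KG0) : bihomog 0 b p -> lowerG p = 0.
Proof.
case/andP=> + _; apply: der_weight0 => v /eqP; rewrite addn_eq0 => /andP[_ /eqP ->].
by rewrite scale0r.
Qed.

End Weights.

(** * The spaces of relations of degree 12 *)

Section DegreeTwelve.

Variable K : fieldType.
Hypothesis charK0 : [pchar K] =i pred0.
Local Notation KG0 := {mpoly K[30]}.
Local Notation v75 := (v75 K).
Local Notation v66' := (v66' K).
Local Notation v66'' := (v66'' K).

Lemma natr_inj_char0 m n : m%:R = n%:R :> K -> m = n.
Proof.
wlog mn : m n / (m <= n)%N => [H|].
  by case/orP: (leq_total m n) => mn E; [apply: H | apply/esym/H].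
move/esym/eqP; rewrite -subr_eq0 -natrB //; move/pcharf0P: charK0 => ->.
by rewrite subn_eq0 => nm; apply/eqP; rewrite eqn_leq mn.
Qed.

(* By raise_lower_power, raising F^k p back up gives a nonzero multiple of p. *)
Lemma extremal_eq0 (E F : {linear KG0 -> KG0}) k (p : KG0) : E p = 0 ->
  (forall n, (n < k)%N -> E (F (iter n F p)) - F (E (iter n F p))
     = (k.*2%:R - n%:R *+ 2) *: iter n F p) ->
  (1 < k)%N -> E (E (iter k F p)) = 0 -> p = 0.
Proof.
move=> Ep comm k1 E2; have := raise_lower_power Ep comm.
have -> : iter k E (iter k F p) = 0.
  case: k k1 E2 {comm} => [|[|k]] // _ E2; rewrite 2!iterSr E2.
  by elim: k {E2} => //= k ->; rewrite linear0.
move/esym/eqP; rewrite scaler_eq0 => /orP[|/eqP //]; rewrite prodf_seq_eq0.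
case/hasP=> n _ /=; rewrite mulf_eq0 -natrB; last by rewrite -addnn ltnW // ltn_addr.
rewrite !(negbTE (natr_neq0 charK0 _)) //.
by rewrite subn_gt0 -addnn ltn_addr.
Qed.

Lemma iter_lowerG n a b (p : KG0) : bihomog (a + n) b p -> J p ->
  bihomog a (b + n) (iter n (@lowerG K) p) /\ J (iter n (@lowerG K) p).
Proof.
elim: n a b => [|n IH] a b; first by rewrite !addn0.
rewrite addnS -addSn => hp Jp; have [h1 J1] := IH _ _ hp Jp.
by rewrite addnS; split; [apply: lowerG_bihomog | apply: J_lowerG].
Qed.

Lemma iter_raiseG n a b (p : KG0) : bihomog a (b + n) p -> J p ->
  bihomog (a + n) b (iter n (@raiseG K) p) /\ J (iter n (@raiseG K) p).
Proof.
elim: n a b => [|n IH] a b; first by rewrite !addn0.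
rewrite addnS -addSn => hp Jp; have [h1 J1] := IH _ _ hp Jp.
by rewrite addnS; split; [apply: raiseG_bihomog | apply: J_raiseG].
Qed.

Lemma lowerGZ c (p : KG0) : lowerG (c *: p) = c *: lowerG p. Proof. exact: linearZ. Qed.
Lemma raiseGZ c (p : KG0) : raiseG (c *: p) = c *: raiseG p. Proof. exact: linearZ. Qed.

Lemma raiseG_v66 : raiseG (lowerG v75) = v75 *+ 2.
Proof.
have := commutatorG v75; rewrite raiseG_v75 lowerG0 subr0 => ->.
by rewrite (weightG_bihomog (bihomog_v75 K)) -natrB // scaler_nat.
Qed.

Lemma raiseG_J66 (p : KG0) : bihomog 6 6 p -> J p -> exists c, raiseG p = c *: v75.
Proof.
move=> hp Jp; have [a [b [c ->]]] := J66_span charK0 hp Jp; exists (c *+ 2).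
rewrite !raiseGD !raiseGZ raiseG_v66' raiseG_v66'' raiseG_v66 !scaler0 !add0r.
by rewrite -scalerMnr scalerMnl.
Qed.

Lemma lowerG_J66 (p : KG0) : bihomog 6 6 p -> J p ->
  exists c, lowerG p = c *: lowerG (lowerG v75).
Proof.
move=> hp Jp; have [a [b [c ->]]] := J66_span charK0 hp Jp; exists c.
by rewrite !lowerGD !lowerGZ lowerG_v66' lowerG_v66'' !scaler0 !add0r.
Qed.

Let LK n k : (n < k)%N -> (6 + (k - n) + n = 6 + k)%N. Proof. lia. Qed.

Let weight_diff n k b : (n < k)%N -> (k + b = 6)%N ->
  (6 + (k - n))%:R - (b + n)%:R = k.*2%:R - n%:R *+ 2 :> K.
Proof.
move=> nk kb; rewrite -mulrnA; apply/eqP; rewrite subr_eq addrAC eq_sym subr_eq -!natrD.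
by apply/eqP; congr (_ %:R); lia.
Qed.

Lemma high_weight_eq0 k b (p : KG0) : (k + b = 6)%N -> (1 < k)%N ->
  bihomog (6 + k) b p -> J p -> p = 0.
Proof.
elim: b k p => [|b IH] k p kb k1 hp Jp.
(* The base case and the inductive step differ only in the reason for E p = 0: the degree in y is 0,
   or E p lies in the next space, which is zero by induction. *)
all: have [h66 J66] := iter_lowerG hp Jp.
all: rewrite (addnC _ k) kb in h66; have [c Ec] := raiseG_J66 h66 J66.
all: have E2 : raiseG (raiseG (iter k (@lowerG K) p)) = 0 by rewrite Ec raiseGZ raiseG_v75 scaler0.
all: have comm n : (n < k)%N -> raiseG (lowerG (iter n (@lowerG K) p)) - lowerG (raiseG (iter n (@lowerG K) p))
    = (k.*2%:R - n%:R *+ 2) *: iter n (@lowerG K) p by move=> nk;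
    rewrite commutatorG;
    have [hn _] := iter_lowerG (etrans (congr1 (fun a => bihomog a _ p) (LK nk)) hp) Jp;
    rewrite (weightG_bihomog hn); congr (_ *: _); exact: weight_diff.
all: apply: (@extremal_eq0 (@raiseG K) (@lowerG K) k p _ comm k1 E2).
- exact: raiseG_y0 hp.
- by apply: (IH k.+1); [lia | lia | rewrite addnS; apply: raiseG_bihomog | apply: J_raiseG].
Qed.

Lemma low_weight_eq0 k a (p : KG0) : (k + a = 6)%N -> (1 < k)%N ->
  bihomog a (6 + k) p -> J p -> p = 0.
Proof.
elim: a k p => [|a IH] k p ka k1 hp Jp.
all: have [h66 J66] := iter_raiseG hp Jp.
all: rewrite (addnC _ k) ka in h66; have [c Ec] := lowerG_J66 h66 J66.
all: have E2 : lowerG (lowerG (iter k (@raiseG K) p)) = 0 by rewrite Ec lowerGZ lowerG3_v75 scaler0.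
all: have comm n : (n < k)%N -> lowerG (raiseG (iter n (@raiseG K) p)) - raiseG (lowerG (iter n (@raiseG K) p))
    = (k.*2%:R - n%:R *+ 2) *: iter n (@raiseG K) p by move=> nk;
    rewrite -opprB commutatorG;
    have [hn _] := iter_raiseG (etrans (congr1 (fun b => bihomog _ b p) (LK nk)) hp) Jp;
    rewrite (weightG_bihomog hn) -scaleNr opprB; congr (_ *: _); exact: weight_diff.
all: apply: (@extremal_eq0 (@lowerG K) (@raiseG K) k p _ comm k1 E2).
- exact: lowerG_x0 hp.
- by apply: (IH k.+1); [lia | lia | rewrite addnS; apply: lowerG_bihomog | apply: J_lowerG].
Qed.

(** E p has bidegree (8,4) and vanishes, so 2 p = E (F p); F p is a relation of bidegree (6,6),
    which E maps into the line of [v75]. *)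
Lemma J75_span (p : KG0) : bihomog 7 5 p -> J p -> exists c, p = c *: v75.
Proof.
move=> hp Jp; have Ep : raiseG p = 0.
  by apply: (@high_weight_eq0 2 4) => //; [apply: raiseG_bihomog | apply: J_raiseG].
have := commutatorG p; rewrite Ep lowerG0 subr0 (weightG_bihomog hp) -natrB // => E.
have [|c Ec] := raiseG_J66 (lowerG_bihomog hp); first exact: J_lowerG.
exists (2%:R^-1 * c); rewrite -scalerA -Ec E scalerA mulVf ?scale1r //.
exact: natr_neq0.
Qed.

Lemma J57_span (p : KG0) : bihomog 5 7 p -> J p -> exists c, p = c *: lowerG (lowerG v75).
Proof.
move=> hp Jp; have Fp : lowerG p = 0.
  by apply: (@low_weight_eq0 2 4) => //; [apply: lowerG_bihomog | apply: J_lowerG].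
have := commutatorG p; rewrite Fp raiseG0 sub0r (weightG_bihomog hp) -opprB -natrB //.
rewrite scaleNr => /oppr_inj E.
have [|c Ec] := lowerG_J66 (raiseG_bihomog hp); first exact: J_raiseG.
exists (2%:R^-1 * c); rewrite -scalerA -Ec E scalerA mulVf ?scale1r //.
exact: natr_neq0.
Qed.

Definition x_component (p : KG0) (a : nat) : KG0 :=
  \sum_(m <- msupp p | weight xdeg m == a) p@_m *: 'X_[m].

Lemma weight_tdeg m : weight tdeg m = (weight xdeg m + weight ydeg m)%N.
Proof. by rewrite /weight -big_split; apply: eq_bigr => v _; exact: mulnDl. Qed.

Lemma x_component_bihomog d p a : p \is d.-homog for (weight tdeg) ->
  bihomog a (d - a) (x_component p a).
Proof.
move/dhomogP=> pd; apply/andP; split; rewrite /x_component big_seq_cond rpred_sum //.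
  by move=> m /andP[_ /eqP ma]; rewrite rpredZ // dhomogX /= ma.
move=> m /andP[mp /eqP ma]; rewrite rpredZ // dhomogX /=.
by rewrite -(pd m mp) /= weight_tdeg ma addKn.
Qed.

Lemma sum_x_component d p : p \is d.-homog for (weight tdeg) ->
  p = \sum_(a <- iota 0 d.+1) x_component p a.
Proof.
move/dhomogP=> pd; rewrite [LHS]mpolyE; under [RHS]eq_bigr do rewrite /x_component big_mkcond.
rewrite exchange_big big_seq [RHS]big_seq; apply: eq_bigr => m mp /=.
rewrite -big_mkcond (eq_bigl (pred1 (weight xdeg m))) /=; last first.
  by move=> a; rewrite /= eq_sym.
have w_in : weight xdeg m \in iota 0 d.+1.
  by rewrite mem_iota ltnS; have /= <- := pd m mp; rewrite weight_tdeg leq_addr.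
by rewrite -big_filter (filter_pred1_uniq (iota_uniq _ _) w_in) big_seq1.
Qed.

(** On the component of degree i in x, [E, F] is the scalar i - (d - i); these scalars are distinct
    in characteristic 0. *)
Lemma J_x_component d p a : p \is d.-homog for (weight tdeg) -> J p -> (a <= d)%N ->
  J (x_component p a).
Proof.
move=> pd Jp ad; pose l i : K := i%:R - (d - i)%:R.
have JL c (v w : KG0) : J v -> J w -> J (c *: v + w).
  by rewrite /J /evalG comp_mpolyD comp_mpolyZ => -> ->; rewrite scaler0 addr0.
have JW (v : KG0) : J v -> J (weightG v).
  move=> Jv; rewrite -commutatorG addrC -scaleN1r.
  by apply: JL; [apply/J_lowerG/J_raiseG | apply/J_raiseG/J_lowerG].
have linW : linear (@weightG K) by move=> c v w; rewrite linearP.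
have := @eigen_components K _ _ _ _ (iota 0 d.+1) l (x_component p) JL JW linW.
apply => [i||||]; first exact/weightG_bihomog/x_component_bihomog.
- move=> i j; rewrite !mem_iota !ltnS /l => id jd /eqP.
  rewrite subr_eq addrAC eq_sym subr_eq -!natrD => /eqP/natr_inj_char0.
  lia.
- exact: iota_uniq.
- by rewrite -sum_x_component.
- by rewrite mem_iota ltnS.
Qed.

Lemma R12_span p : R 12 p -> exists a b c d e,
  p = a *: v75 + b *: lowerG v75 + c *: lowerG (lowerG v75) + d *: v66' + e *: v66''.
Proof.
move=> [Jp pd]; have hc i := x_component_bihomog i pd.
have Jc i : (i <= 12)%N -> J (x_component p i) by apply: J_x_component pd Jp.
have hi i : (8 <= i <= 12)%N -> x_component p i = 0.
  move=> /andP[i8 i12]; apply: (@high_weight_eq0 (i - 6) (12 - i)); [lia|lia| |exact: Jc].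
  by rewrite subnKC //; lia.
have lo i : (i <= 4)%N -> x_component p i = 0.
  move=> i4; apply: (@low_weight_eq0 (6 - i) i); [lia|lia| |apply: Jc; lia].
  by rewrite (_ : 6 + (6 - i) = 12 - i)%N; [exact: hc | lia].
have [a Ea] := J75_span (hc 7%N) (Jc 7%N isT).
have [d [e [b Eb]]] := J66_span charK0 (hc 6%N) (Jc 6%N isT).
have [c Ec] := J57_span (hc 5%N) (Jc 5%N isT).
exists a, b, c, d, e; rewrite [LHS](sum_x_component pd) !big_cons big_nil.
rewrite (lo 0%N) // (lo 1%N) // (lo 2%N) // (lo 3%N) // (lo 4%N) //.
rewrite (hi 8%N) // (hi 9%N) // (hi 10%N) // (hi 11%N) // (hi 12%N) // Ea Eb Ec !add0r !addr0.
move: (a *: _) (b *: _) (c *: _) (d *: _) (e *: _) => A B C D E.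
by ring.
Qed.

End DegreeTwelve.

(** * The action of GL_2 *)

Section BinaryForms.

Definition mnm2 (a b : nat) : 'X_{1..2} := (U_(0%R) *+ a + U_(1%R) *+ b)%MM.

Lemma ord2P (i : 'I_2) : i = 0 \/ i = 1.
Proof. by case: i => [[|[|]]] // ?; [left | right]; apply: val_inj. Qed.

Lemma mnm2_0 a b : mnm2 a b 0 = a.
Proof. by rewrite mnmDE !mulmnE !mnm1E eqxx /= mul1n mul0n addn0. Qed.

Lemma mnm2_1 a b : mnm2 a b 1 = b.
Proof. by rewrite mnmDE !mulmnE !mnm1E eqxx /= mul1n mul0n. Qed.

Lemma eq_mnm2 a b c d : (mnm2 a b == mnm2 c d) = (a == c) && (b == d).
Proof.
apply/eqP/andP => [E|[/eqP -> /eqP -> //]].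
by have := mnm2_0 a b; have := mnm2_1 a b; rewrite E mnm2_0 mnm2_1 => -> ->.
Qed.

Lemma mnm2E (m : 'X_{1..2}) : m = mnm2 (m 0) (m 1).
Proof. by apply/mnmP => i; case: (ord2P i) => ->; rewrite ?mnm2_0 ?mnm2_1. Qed.

Variable K : fieldType.

Lemma mpolyX_mnm2 a b : 'X_[mnm2 a b] = 'X_0 ^+ a * 'X_1 ^+ b :> {mpoly K[2]}.
Proof. by rewrite mpolyXD !mpolyXn. Qed.

Lemma mdeg_mnm2 a b : mdeg (mnm2 a b) = (a + b)%N.
Proof. by rewrite mdegD !mdegMn !mdeg1 !mul1n. Qed.

Lemma form_expand d (f : {mpoly K[2]}) : f \is d.-homog ->
  f = \sum_(k < d.+1) f@_(mnm2 (d - k) k) *: ('X_0 ^+ (d - k) * 'X_1 ^+ k).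
Proof.
move/dhomogP=> fd; apply/mpolyP => m; rewrite raddf_sum /=.
under eq_bigr => k _ do rewrite mcoeffZ -mpolyX_mnm2 mcoeffX.
have [dm|dm] := eqVneq (mdeg m) d; last first.
  rewrite memN_msupp_eq0; last by apply: contra dm => /fd /= ->.
  rewrite big1 // => k _; case: eqP => [E|_]; last by rewrite mulr0.
  by case/negP: dm; rewrite -E mdeg_mnm2 subnK // -ltnS.
have m1d : (m 1%R < d.+1)%N by rewrite -dm [m in mdeg m]mnm2E mdeg_mnm2 ltnS leq_addl.
have m0d : (d - m 1%R)%N = m 0%R by rewrite -dm [m in mdeg m]mnm2E mdeg_mnm2 addnK.
rewrite (bigD1 (Ordinal m1d)) //= m0d -mnm2E eqxx mulr1 big1 ?addr0 // => k km.
rewrite -val_eqE /= in km.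
by rewrite [m]mnm2E eq_mnm2 (negbTE km) andbF mulr0.
Qed.

End BinaryForms.

Section GroupAction.

Variable K : fieldType.
Local Notation KG0 := {mpoly K[30]}.

Lemma inG_sup i s (f : {mpoly K[2]}) : uniq s -> {subset msupp f <= s} ->
  inG i f = \sum_(m <- s) f@_m *: zG K i (m 0) (m 1).
Proof.
by apply: (sum_msupp_sup (F := fun c m => c *: zG K i (m 0) (m 1))) => m; rewrite scale0r.
Qed.

Lemma inG_is_linear i : linear (@inG K i).
Proof.
move=> c f g; set s := undup (msupp f ++ msupp g); have us : uniq s by apply: undup_uniq.
rewrite !(@inG_sup i s) //.
- rewrite scaler_sumr -big_split; apply: eq_bigr => m _ /=.
  by rewrite mcoeffD mcoeffZ scalerDl scalerA.
- by move=> m mg; rewrite mem_undup mem_cat mg orbT.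
- by move=> m mf; rewrite mem_undup mem_cat mf.
- move=> m /msuppD_le; rewrite mem_undup !mem_cat => /orP[/msuppZ_le|] ->; rewrite ?orbT //.
Qed.

HB.instance Definition _ i := GRing.isSemilinear.Build K {mpoly K[2]} KG0 _ (@inG K i)
  (GRing.semilinear_linear (inG_is_linear i)).

Lemma inG_monomial i j k : inG i ('X_0 ^+ j * 'X_1 ^+ k) = zG K i j k.
Proof.
rewrite -mpolyX_mnm2 (@inG_sup i [:: mnm2 j k]) //; last by move=> m; rewrite msuppX.
by rewrite big_seq1 mcoeffX eqxx scale1r mnm2_0 mnm2_1.
Qed.

Lemma actGC g c : actG g c%:MP = c%:MP :> KG0. Proof. exact: comp_mpolyC. Qed.

Lemma actGD g : {morph actG g : p q / p + q : KG0}. Proof. exact: comp_mpolyD. Qed.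

Lemma actGZ g c (p : KG0) : actG g (c *: p) = c *: actG g p. Proof. exact: comp_mpolyZ. Qed.

Lemma actG_mul g : {morph actG g : p q / p * q : KG0}. Proof. exact: rmorphM. Qed.

Lemma actFD g : {morph @actF K g : p q / p + q}. Proof. exact: comp_mpolyD. Qed.

Lemma actFZ g c (f : {mpoly K[2]}) : actF g (c *: f) = c *: actF g f.
Proof. exact: comp_mpolyZ. Qed.

Lemma actF_sum g (I : finType) (f : I -> {mpoly K[2]}) :
  actF g (\sum_i f i) = \sum_i actF g (f i).
Proof. exact: raddf_sum. Qed.

Lemma actF_mul g : {morph @actF K g : p q / p * q}. Proof. exact: rmorphM. Qed.

Lemma actF_X g l : actF g 'X_l = \sum_(m < 2) g m l *: 'X_m :> {mpoly K[2]}.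
Proof. by rewrite /actF comp_mpolyXU -tnth_nth tnth_mktuple. Qed.

Lemma actG_X g v : actG g 'X_v = \det g ^+ b_ (fam v)
  *: inG (fam v) (actF g ('X_0 ^+ xexp v * 'X_1 ^+ yexp v)) :> KG0.
Proof. by rewrite /actG comp_mpolyXU -tnth_nth tnth_mktuple. Qed.

Lemma actG_zG g i j k : (i, j, k) \in basisG ->
  actG g (zG K i j k) = \det g ^+ b_ i *: inG i (actF g ('X_0 ^+ j * 'X_1 ^+ k)).
Proof.
move=> b; rewrite {1}/zG b -/(idxG i j k) actG_X.
by have [-> -> ->] := tripG_idxG b.
Qed.

Lemma actFM (g h : 'M[K]_2) f : actF (g *m h) f = actF g (actF h f).
Proof.
elim/mpoly_ring_ind: f => [c|l|p q IHp IHq|p q IHp IHq].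
- by rewrite /actF !comp_mpolyC.
- rewrite !actF_X actF_sum; under [RHS]eq_bigr => m _ do rewrite actFZ actF_X scaler_sumr.
  rewrite exchange_big; apply: eq_bigr => k _ /=.
  rewrite mxE scaler_suml; apply: eq_bigr => m _.
  by rewrite scalerA mulrC.
- by rewrite !actFD IHp IHq.
- by rewrite !actF_mul IHp IHq.
Qed.

Lemma monomial_homog j k : ('X_0 ^+ j * 'X_1 ^+ k : {mpoly K[2]}) \is (j + k).-homog.
Proof. by rewrite -mpolyX_mnm2 dhomogX /= mdeg_mnm2. Qed.

Lemma actG_inG g i (f : {mpoly K[2]}) : (0 < i <= 12)%N -> f \is (a_ i).-homog ->
  actG g (inG i f) = \det g ^+ b_ i *: inG i (actF g f).
Proof.
move=> i12 fa; rewrite [in LHS](form_expand fa) [in RHS](form_expand fa).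
rewrite [inG _ _]linear_sum /= [actG _ _]raddf_sum [actF _ _]raddf_sum.
rewrite [inG _ _ in RHS]linear_sum scaler_sumr /=.
apply: eq_bigr => k _; rewrite linearZ /= !comp_mpolyZ linearZ /= inG_monomial.
rewrite -/(actG g _) -/(actF g _) actG_zG.
  by rewrite scalerA mulrC -scalerA.
by rewrite mem_basisG i12 subnK //= -ltnS.
Qed.

Lemma actGM (g h : 'M[K]_2) (p : KG0) : actG (g *m h) p = actG g (actG h p).
Proof.
elim/mpoly_ring_ind: p => [c|v|p q IHp IHq|p q IHp IHq].
- by rewrite !actGC.
- rewrite !actG_X det_mulmx exprMn actFM actGZ actG_inG ?fam_bounds //.
    by rewrite scalerA [X in X *: _]mulrC.
  by apply: actF_homog; rewrite -xexp_yexp monomial_homog.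
- by rewrite !actGD IHp IHq.
- by rewrite !actG_mul IHp IHq.
Qed.

End GroupAction.

(** * Generators of GL_2 and the unipotent one-parameter group *)

Section TwoByTwo.

Variable K : fieldType.

Definition mx2 (a b c d : K) : 'M[K]_2 :=
  \matrix_(i, j) if i == 0 then (if j == 0 then a else b) else (if j == 0 then c else d).

Lemma mx2E (g : 'M[K]_2) : g = mx2 (g 0 0) (g 0 1) (g 1 0) (g 1 1).
Proof.
by apply/matrixP => i j; rewrite mxE; case: (ord2P i) => ->; case: (ord2P j) => ->.
Qed.

Lemma mx2M a b c d a' b' c' d' : mx2 a b c d *m mx2 a' b' c' d'
  = mx2 (a * a' + b * c') (a * b' + b * d') (c * a' + d * c') (c * b' + d * d').
Proof.
by apply/matrixP => i j; rewrite !mxE !big_ord_recl big_ord0 addr0 !mxE;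
  case: (ord2P i) => ->; case: (ord2P j) => ->.
Qed.

Lemma det_mx2 a b c d : \det (mx2 a b c d) = a * d - b * c.
Proof.
rewrite (expand_det_row _ 0) !big_ord_recl big_ord0 addr0 /cofactor !det_mx11 !mxE /=.
by rewrite expr0 expr1 mul1r mulN1r mulrN.
Qed.

Lemma actF_mx2_0 a b c d : actF (mx2 a b c d) 'X_0 = a *: 'X_0 + c *: 'X_1 :> {mpoly K[2]}.
Proof. by rewrite actF_X !big_ord_recl big_ord0 addr0 !mxE. Qed.

Lemma actF_mx2_1 a b c d : actF (mx2 a b c d) 'X_1 = b *: 'X_0 + d *: 'X_1 :> {mpoly K[2]}.
Proof. by rewrite actF_X !big_ord_recl big_ord0 addr0 !mxE. Qed.

(** For a nonzero upper left entry this is the factorization lower unipotent, diagonal, upper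
    unipotent, the last factor being a lower one conjugated by the exchange. Otherwise one exchange
    of rows produces such an entry. *)
Lemma gl2_ind (P : 'M[K]_2 -> Prop) :
  (forall g h, P g -> P h -> P (g *m h)) -> (forall c, P (mx2 1 0 c 1)) ->
  (forall s t, P (mx2 s 0 0 t)) -> P (mx2 0 1 1 0) -> forall g, g \in unitmx -> P g.
Proof.
move=> PM PL PD PS; have PA a b c d : a != 0 -> P (mx2 a b c d).
  move=> a0; have -> : mx2 a b c d = mx2 1 0 (c / a) 1 *m mx2 a 0 0 (d - c / a * b)
      *m (mx2 0 1 1 0 *m mx2 1 0 (b / a) 1 *m mx2 0 1 1 0).
    by rewrite !mx2M; congr mx2; field.
  apply: (PM); first by apply: (PM).
  by apply: (PM) => //; apply: (PM).
move=> g; rewrite (mx2E g); move: (g 0 0) (g 0 1) (g 1 0) (g 1 1) => a b c d.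
rewrite unitmxE unitfE det_mx2; have [->|a0 _] := eqVneq a 0; last exact: PA.
rewrite mul0r sub0r oppr_eq0 mulf_eq0 negb_or => /andP[b0 c0].
have -> : mx2 0 b c d = mx2 0 1 1 0 *m mx2 c d 0 b.
  by rewrite !mx2M; congr mx2; ring.
by apply: PM => //; apply: PA.
Qed.

End TwoByTwo.

(** The binomial expansion of (x_i + c y_i)^j y_i^k as a polynomial in c. *)
Definition zG_flow (K : fieldType) (i j k : nat) : {poly {mpoly K[30]}} :=
  \poly_(l < j.+1) (zG K i (j - l) (k + l) *+ 'C(j, l)).

Definition const2 (K : fieldType) : {rmorphism K -> {poly {mpoly K[30]}}} :=
  polyC \o @mpolyC 30 K.

(* The one-parameter group x |-> x + c y acts on K[G_0] by the exponential of c times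
   lowerG: flow p is this exponential as a polynomial in c. *)
HB.lock Definition flow (K : fieldType) : {mpoly K[30]} -> {poly {mpoly K[30]}} :=
  mmap (const2 K) (fun v => zG_flow K (fam v) (xexp v) (yexp v)).

Section Flow.

Variable K : fieldType.
Local Notation KG0 := {mpoly K[30]}.
Local Notation flow := (@flow K).
Local Notation zG_flow := (zG_flow K).

Lemma flowC c : flow c%:MP = c%:MP%:P. Proof. by rewrite unlock; exact: mmapC. Qed.
Lemma flowD : {morph flow : p q / p + q}. Proof. by rewrite unlock; exact: mmapD. Qed.
Lemma flowM : {morph flow : p q / p * q}. Proof. by rewrite unlock; exact: rmorphM. Qed.
Lemma flowZ c p : flow (c *: p) = c%:MP%:P * flow p. Proof. by rewrite unlock; exact: mmapZ. Qed.

Lemma flow_X v : flow 'X_v = zG_flow (fam v) (xexp v) (yexp v).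
Proof. by rewrite unlock mmapX mmap1U. Qed.

Lemma flow_zG i j k : (i, j, k) \in basisG -> flow (zG K i j k) = zG_flow i j k.
Proof.
move=> b; rewrite {1}/zG b -/(idxG i j k) flow_X.
by have [-> -> ->] := tripG_idxG b.
Qed.

(** The differential equation of the exponential. On a generator it is the identity (l + 1) binom(j
    + 1, l + 1) = (j + 1) binom(j, l). *)
Lemma deriv_flow p : (flow p)^`() = flow (lowerG p).
Proof.
elim/mpoly_ring_ind: p => [c|v|p q IHp IHq|p q IHp IHq].
- by rewrite lowerGC flowC derivC -mpolyC0 flowC mpolyC0 polyC0.
- rewrite flow_X lowerG_X flowZ; case E : (xexp v) => [|j].
    rewrite mpolyC0 polyC0 mul0r; apply/polyP => l.
    by rewrite coef_deriv coef_poly /= coef0 mul0rn.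
  rewrite flow_zG; last by rewrite mem_basisG fam_bounds /= -xexp_yexp E addnS.
  apply/polyP => l; rewrite coef_deriv coefCM !coef_poly !ltnS /=.
  case: leqP => lj; last by rewrite mul0rn mulr0.
  rewrite mpolyC_nat mulr_natl -!mulrnA addSnnS subSS; congr (_ *+ _).
  by rewrite [RHS]mulnC mul_bin_diag mulnC.
- by rewrite lowerGD (flowD p q) (flowD (lowerG p)) derivD IHp IHq.
- by rewrite lowerGM (flowM p q) (flowD (_ * _)) (flowM (lowerG p)) (flowM p) derivM IHp IHq.
Qed.

Lemma flow_coef0 p : (flow p)`_0 = p.
Proof.
elim/mpoly_ring_ind: p => [c|v|p q IHp IHq|p q IHp IHq].
- by rewrite flowC coefC.
- by rewrite flow_X coef_poly /= subn0 addn0 bin0 mulr1n zG_tripG.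
- by rewrite flowD coefD IHp IHq.
- by rewrite flowM coef0M IHp IHq.
Qed.

Lemma horner_flow c p : (flow p).[c%:MP] = actG (mx2 1 0 c 1) p.
Proof.
elim/mpoly_ring_ind: p => [d|v|p q IHp IHq|p q IHp IHq].
- by rewrite flowC hornerC actGC.
- rewrite flow_X actG_X det_mx2 mul0r subr0 mulr1 expr1n scale1r horner_poly.
  rewrite actF_mul; set F := actF _; have FX l n : F ('X_l ^+ n) = F 'X_l ^+ n.
    exact: rmorphXn.
  rewrite !FX /F actF_mx2_0 actF_mx2_1 scale0r add0r !scale1r exprDn mulr_suml.
  rewrite [RHS]linear_sum; apply: eq_bigr => l _ /=.
  rewrite exprZn !mulrnAl -scalerAr -scalerAl -mulrA -exprD.
  rewrite [RHS]linearMn linearZ /= inG_monomial -rmorphXn /= mulrC mul_mpolyC.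
  by rewrite addnC scalerMnr.
- by rewrite flowD hornerD actGD IHp IHq.
- by rewrite flowM hornerM actG_mul IHp IHq.
Qed.

Hypothesis charK0 : [pchar K] =i pred0.

(** In characteristic 0 a polynomial is determined by its constant term and its derivative. *)
Lemma flow_unique p (s : {poly KG0}) : s`_0 = p -> s^`() = flow (lowerG p) -> flow p = s.
Proof.
move=> s0; rewrite -deriv_flow => ds; apply/polyP => -[|l]; first by rewrite flow_coef0.
have /eqP := congr1 (fun q : {poly KG0} => q`_l) ds; rewrite /= !coef_deriv.
rewrite -subr_eq0 -mulrnBl -scaler_nat scaler_eq0 (negbTE (natr_neq0 charK0 _)) //=.
by rewrite subr_eq0 => /eqP.
Qed.

(** The exponential series stops after the quadratic term. It is found by integrating the flow of
    F^2 p, then of F p, then of p. *)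
Lemma actG_lower c (p : KG0) : lowerG (lowerG (lowerG p)) = 0 ->
  actG (mx2 1 0 c 1) p = p + c *: lowerG p + (c ^+ 2 / 2%:R) *: lowerG (lowerG p).
Proof.
move=> F3; have E2 : flow (lowerG (lowerG p)) = (lowerG (lowerG p))%:P.
  by apply: flow_unique; rewrite ?coefC // derivC F3 -mpolyC0 flowC mpolyC0 polyC0.
have E1 : flow (lowerG p) = (lowerG p)%:P + (lowerG (lowerG p))%:P * 'X.
  apply: flow_unique; first by rewrite coefD coefC coefMX addr0.
  by rewrite derivD derivM !derivC mul0r !add0r derivX mulr1 E2.
have E0 : flow p = p%:P + (lowerG p)%:P * 'X
    + (2%:R^-1 *: lowerG (lowerG p))%:P * 'X^2.
  apply: flow_unique; first by rewrite !coefD coefC coefMX coefMXn !addr0.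
  rewrite !derivD (derivM _ 'X) (derivM _ 'X^2) !derivC !mul0r !add0r derivX derivXn mulr1 E1; congr (_ + _).
  rewrite mulrnAr -mulrnAl -polyCMn expr1; congr (_%:P * _).
  by rewrite -scaler_nat scalerA divff ?scale1r // natr_neq0.
rewrite -horner_flow E0 !hornerD hornerC !hornerCM hornerX hornerXn -rmorphXn /=; congr (_ + _ + _).
  by rewrite mulrC mul_mpolyC.
by rewrite mulrC mul_mpolyC scalerA.
Qed.

End Flow.

Definition swap_index (v : nat) : nat :=
  let: (i, j, k) := nth (0, 0, 0)%N basisG v in index (i, k, j) basisG.

(** The exchange of x and y has determinant -1, which enters through det^(b_i). *)
Definition swap_sign (v : nat) : Z :=
  let: (i, j, k) := nth (0, 0, 0)%N basisG v in if odd (b_ i) then Zneg xH else Zpos xH.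

Definition spoly_swap : spoly -> spoly := spoly_map swap_sign swap_index.

Section Equivariance.

Variable K : fieldType.
Hypothesis charK0 : [pchar K] =i pred0.
Local Notation KG0 := {mpoly K[30]}.
Local Notation v75 := (v75 K).
Local Notation v66' := (v66' K).
Local Notation v66'' := (v66'' K).
Local Notation v66 := (lowerG v75).
Local Notation v57 := (lowerG (lowerG v75)).
Local Notation swap := (mx2 0 1 1 0 : 'M[K]_2).

Let two_neq0 : 2%:R != 0 :> K. Proof. exact: natr_neq0. Qed.

Let halfK (x : K) : (x / 2%:R) *+ 2 = x. Proof. by rewrite -(mulr_natr (x / _)) divfK. Qed.

Let halfMn (x : K) : x *+ 2 / 2%:R = x. Proof. by rewrite -(mulr_natr x) mulfK. Qed.

(** The map of F(2) to K[G_0] that sends x^2 to [v75] and commutes with F: it is forced by F(x^2) =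
    2 x y and F^2(x^2) = 2 y^2. *)
Definition form75 (f : {mpoly K[2]}) : KG0 :=
  f@_(mnm2 2 0) *: v75 + (f@_(mnm2 1 1) / 2%:R) *: v66 + (f@_(mnm2 0 2) / 2%:R) *: v57.

Lemma form75_is_linear : linear form75.
Proof.
move=> c f g; rewrite /form75; move: v75 v66 v57 => A B C.
have E m : (c *: f + g)@_m = c * f@_m + g@_m by rewrite mcoeffD mcoeffZ.
have H x y : (c * x + y) / 2%:R = c * (x / 2%:R) + y / 2%:R by rewrite mulrDl mulrA.
have L x y (P : KG0) : (c * x + y) *: P = c *: (x *: P) + y *: P by rewrite scalerDl scalerA.
rewrite !E !H !L !scalerDr [X in X + _ = _]addrACA [LHS]addrACA.
by [].
Qed.

(** Coordinates with respect to x^2, F(x^2), F^2(x^2), in which [form75] has no denominators. *)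
Definition quad (a b c : K) : {mpoly K[2]} :=
  a *: 'X_0 ^+ 2 + (b *+ 2) *: ('X_0 * 'X_1) + (c *+ 2) *: 'X_1 ^+ 2.

Lemma quadP f : f \is 2.-homog -> exists a b c, f = quad a b c.
Proof.
move=> hf; exists f@_(mnm2 2 0), (f@_(mnm2 1 1) / 2%:R), (f@_(mnm2 0 2) / 2%:R).
rewrite [LHS](form_expand hf) !big_ord_recl big_ord0 addr0 /= /quad addrA.
by rewrite !halfK !expr0 !expr1 mul1r mulr1.
Qed.

Lemma form75_quad a b c : form75 (quad a b c) = a *: v75 + b *: v66 + c *: v57.
Proof.
have E0 : 'X_0 ^+ 2 = 'X_[mnm2 2 0] :> {mpoly K[2]} by rewrite mpolyX_mnm2 mulr1.
have E1 : 'X_0 * 'X_1 = 'X_[mnm2 1 1] :> {mpoly K[2]} by rewrite mpolyX_mnm2.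
have E2 : 'X_1 ^+ 2 = 'X_[mnm2 0 2] :> {mpoly K[2]} by rewrite mpolyX_mnm2 mul1r.
rewrite /form75 /quad E0 E1 E2 !mcoeffD !mcoeffZ !mcoeffX !eq_mnm2 /=.
by rewrite !mulr0 !mulr1 !addr0 !add0r !halfMn.
Qed.

(** The parameter k is half of c^2; with it the formula is polynomial and accessible to [ring]. *)
Lemma actF_quad a b c d k x y z : c ^+ 2 = k *+ 2 ->
  actF (mx2 a b c d) (quad x y z)
  = quad (x * a ^+ 2 + y * a * b *+ 2 + z * b ^+ 2 *+ 2)
         (x * a * c + y * (a * d + b * c) + z * b * d *+ 2)
         (x * k + y * c * d + z * d ^+ 2).
Proof.
move=> ck; rewrite /quad !actFD !actFZ !expr2 !actF_mul actF_mx2_0 actF_mx2_1.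
have -> : ((x * k + y * c * d + z * (d * d)) *+ 2) = x * c ^+ 2 + (y * c * d + z * (d * d)) *+ 2.
  by rewrite ck; ring.
rewrite -!mul_mpolyC !(mpolyCD, mpolyCM, mpolyCMn, rmorphXn) /=.
by ring.
Qed.

(** The exponents 5 and 6 come from W(7,5) = det^5 (x) F(2) and W(6,6) = det^6. The condition is
    multiplicative in g, so [gl2_ind] applies. *)
Definition equivariant (g : 'M[K]_2) : Prop :=
  [/\ forall f, f \is 2.-homog -> actG g (form75 f) = \det g ^+ 5 *: form75 (actF g f),
      actG g v66' = \det g ^+ 6 *: v66' & actG g v66'' = \det g ^+ 6 *: v66''].

Lemma equivariantM g h : equivariant g -> equivariant h -> equivariant (g *m h).
Proof.
move=> [g1 g2 g3] [h1 h2 h3]; split=> [f hf||].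
- rewrite actGM h1 // actGZ g1; last exact: actF_homog.
  by rewrite actFM det_mulmx exprMn scalerA mulrC.
- by rewrite actGM h2 actGZ g2 det_mulmx exprMn scalerA mulrC.
- by rewrite actGM h3 actGZ g3 det_mulmx exprMn scalerA mulrC.
Qed.

Lemma equivariant_mx2 a b c d k (D := a * d - b * c) : c ^+ 2 = k *+ 2 ->
  actG (mx2 a b c d) v75 = D ^+ 5 *: (a ^+ 2 *: v75 + (a * c) *: v66 + k *: v57) ->
  actG (mx2 a b c d) v66
    = D ^+ 5 *: ((a * b *+ 2) *: v75 + (a * d + b * c) *: v66 + (c * d) *: v57) ->
  actG (mx2 a b c d) v57
    = D ^+ 5 *: ((b ^+ 2 *+ 2) *: v75 + (b * d *+ 2) *: v66 + d ^+ 2 *: v57) ->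
  actG (mx2 a b c d) v66' = D ^+ 6 *: v66' ->
  actG (mx2 a b c d) v66'' = D ^+ 6 *: v66'' ->
  equivariant (mx2 a b c d).
Proof.
move=> ck h0 h1 h2 h3 h4; split; rewrite ?det_mx2 // => f /quadP[x [y [z ->]]].
rewrite (actF_quad _ _ _ _ _ _ ck) !form75_quad !actGD !actGZ h0 h1 h2 -/D.
move: v75 v66 v57 => A B C; move: (D ^+ 5) => e.
rewrite -!mul_mpolyC !(mpolyCD, mpolyCM, mpolyCMn, rmorphXn) /=.
by ring.
Qed.

Lemma equivariant_lower c : equivariant (mx2 1 0 c 1).
Proof.
have h n : (1 * 1 - 0 * c) ^+ n = 1 :> K by rewrite mul0r subr0 mulr1 expr1n.
apply: (@equivariant_mx2 _ _ _ _ (c ^+ 2 / 2%:R)); rewrite ?h ?scale1r.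
- by rewrite halfK.
- by rewrite actG_lower ?lowerG3_v75 // expr1n scale1r mul1r.
- rewrite actG_lower ?lowerG3_v75 ?lowerG0 // scaler0 addr0.
  by rewrite mulr0 mul0rn scale0r add0r mul0r addr0 mulr1 scale1r mulr1.
- rewrite actG_lower ?lowerG3_v75 ?lowerG0 // !scaler0 !addr0.
  by rewrite expr0n /= mul0rn mul0r mul0rn !scale0r !add0r expr1n scale1r.
- by rewrite actG_lower // lowerG_v66' !lowerG0 // !scaler0 !addr0.
- by rewrite actG_lower // lowerG_v66'' !lowerG0 // !scaler0 !addr0.
Qed.

Lemma actG_diag s t a b (p : KG0) : bihomog a b p ->
  actG (mx2 s 0 0 t) p = (s ^+ a * t ^+ b) *: p.
Proof.
case/andP=> /dhomogP pa /dhomogP pb; rewrite [in LHS](mpolyE p) [in RHS](mpolyE p).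
rewrite [actG _ _]raddf_sum scaler_sumr big_seq [RHS]big_seq; apply: eq_bigr => m mp /=.
rewrite -/(actG _ _) actGZ [RHS]scalerA [in RHS]mulrC -scalerA; congr (_ *: _).
rewrite /actG comp_mpolyX [in RHS]mpolyXE_id -(pa m mp) -(pb m mp) /= /weight.
rewrite -!prodrXr -big_split /= -scaler_prod; apply: eq_bigr => v _.
rewrite tnth_mktuple actF_mul; have FX l n : actF (mx2 s 0 0 t) ('X_l ^+ n)
   = actF (mx2 s 0 0 t) 'X_l ^+ n by exact: rmorphXn.
rewrite !FX actF_mx2_0 actF_mx2_1 !scale0r addr0 add0r !exprZn -scalerAr -scalerAl scalerA.
rewrite linearZ /= inG_monomial zG_tripG exprZn scalerA det_mx2 mul0r subr0.
congr (_ *: _); rewrite !exprM -!exprMn; congr (_ ^+ _).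
(* The determinant contributes (s t)^(b_i), which raises the exponents of s and t from those of x_i
   and y_i to the two degrees of the generator. *)
by rewrite /xdeg /ydeg exprMn !exprD; ring.
Qed.

Lemma equivariant_diag s t : equivariant (mx2 s 0 0 t).
Proof.
apply: (@equivariant_mx2 _ _ _ _ 0); rewrite ?mul0r ?subr0 ?mulr0 ?mul0rn ?addr0 ?scale0r.
- by rewrite expr0n.
- rewrite (actG_diag _ _ (bihomog_v75 K)) !addr0 scalerA; congr (_ *: _); ring.
- rewrite (actG_diag _ _ (bihomog_v66 K)) !add0r addr0 scalerA; congr (_ *: _); ring.
- rewrite (actG_diag _ _ (bihomog_v57 K)) expr0n mul0rn scale0r !add0r scalerA.
  congr (_ *: _); ring.
- by rewrite (actG_diag _ _ (bihomog_v66' K)) exprMn.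
- by rewrite (actG_diag _ _ (bihomog_v66'' K)) exprMn.
Qed.

Lemma actG_swap_X v : (v < 30)%N ->
  actG swap 'X_(inord v) = zr K (swap_sign v) *: 'X_(inord (swap_index v)).
Proof.
move=> v30; rewrite actG_X det_mx2 mul0r mulr1 sub0r actF_mul.
have FX l n : actF swap ('X_l ^+ n) = actF swap 'X_l ^+ n by exact: rmorphXn.
rewrite !FX actF_mx2_0 actF_mx2_1 !scale0r !scale1r addr0 add0r mulrC inG_monomial.
have b := tripG_in (inord v); rewrite /swap_sign /swap_index.
have := tripGE (inord v); rewrite inordK // => <-.
rewrite /tripG mem_basisG addnC -mem_basisG in b *; rewrite zG_index //.
by rewrite -signr_odd; case: odd; rewrite ?expr1 ?expr0 // -[Zneg xH]/(Z.opp (Zpos xH)) zrN.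
Qed.

Lemma actG_swap_pol l : small_vars l -> actG swap (pol K l) = pol K (spoly_swap l).
Proof. exact: (pol_map actG_swap_X). Qed.

Lemma equivariant_swap : equivariant swap.
Proof.
have half (p q : KG0) : p + p = q -> p = (2%:R^-1 : K) *: q.
  by move=> <-; rewrite -mulr2n -scaler_nat scalerA mulVf ?scale1r.
have E0 : actG swap v75 = - ((2%:R^-1 : K) *: v57).
  (* The identity is doubled to stay with integer coefficients. *)
  rewrite -scalerN; apply: half; rewrite v57E v75E actG_swap_pol // -pol_cat -pol_opp.
  by apply: pol_eq; vm_compute.
have E1 : actG swap v66 = - v66.
  by rewrite v66E actG_swap_pol -?pol_opp; [apply: pol_eq|]; vm_compute.
have E2 : actG swap v57 = - (v75 + v75).
  by rewrite v57E v75E actG_swap_pol -?pol_cat -?pol_opp; [apply: pol_eq|]; vm_compute.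
have E3 : actG swap v66' = v66'.
  by rewrite v66'E actG_swap_pol; [apply: pol_eq|]; vm_compute.
have E4 : actG swap v66'' = v66''.
  by rewrite v66''E actG_swap_pol; [apply: pol_eq|]; vm_compute.
have d : 0 * 0 - 1 * 1 = -1 :> K by rewrite mul0r mulr1 sub0r.
apply: (@equivariant_mx2 _ _ _ _ 2%:R^-1); rewrite ?d ?E0 ?E1 ?E2 ?E3 ?E4.
- by rewrite expr1n -[_^-1]mul1r halfK.
all: rewrite ?(mul0r, mulr0, mulr1, mul1r, mul0rn, expr0n, expr1n, add0r, addr0, scale0r, scale1r).
- by rewrite -signr_odd /= expr1 scaleN1r.
- by rewrite -signr_odd /= expr1 scaleN1r.
- by rewrite -signr_odd /= expr1 scaleN1r scaler_nat.
- by rewrite -signr_odd /= expr0 scale1r.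
- by rewrite -signr_odd /= expr0 scale1r.
Qed.

Lemma equivariant_gl2 g : g \in unitmx -> equivariant g.
Proof.
apply: gl2_ind => [g' h|c|s t|]; [exact: equivariantM | exact: equivariant_lower |
  exact: equivariant_diag | exact: equivariant_swap].
Qed.

End Equivariance.

(** * The module of relations *)

Section RelationModule.

Variable K : fieldType.
Hypothesis charK0 : [pchar K] =i pred0.
Local Notation KG0 := {mpoly K[30]}.
Local Notation v75 := (v75 K).
Local Notation v66' := (v66' K).
Local Notation v66'' := (v66'' K).
Local Notation v66 := (lowerG v75).
Local Notation v57 := (lowerG (lowerG v75)).

Lemma v75_neq0 : v75 != 0.
Proof.
apply/eqP => v0; have [|_ _] := @hwv66_free K charK0 0 0 1.
  by rewrite v0 lowerG0 scaler0 !scale0r !addr0.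
by apply/eqP; apply: oner_neq0.
Qed.

(** The vectors lie in the bidegrees (7,5), (6,6) and (5,7). E^2 isolates c, then E isolates b, and
    E F isolates a; what is left is a relation between [v66'] and [v66'']. *)
Lemma hwv_free a b c d e :
  a *: v75 + b *: v66 + c *: v57 + d *: v66' + e *: v66'' = 0 ->
  [/\ a = 0, b = 0, c = 0, d = 0 & e = 0].
Proof.
have E57 : raiseG v57 = v66 *+ 2.
  have w0 : weightG v66 = 0 by rewrite (weightG_bihomog (bihomog_v66 K)) subrr scale0r.
  have /eqP := commutatorG v66; rewrite w0 subr_eq0 => /eqP ->.
  by rewrite raiseG_v66 !mulr2n lowerGD.
have Z c' : c' *: v75 = 0 -> c' = 0.
  by move/eqP; rewrite scaler_eq0 (negbTE v75_neq0) orbF => /eqP.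
have E1 q : raiseG (a *: v75 + b *: v66 + c *: v57 + d *: v66' + e *: v66'') = q ->
    q = (b *+ 2) *: v75 + (c *+ 2) *: v66.
  move=> <-; rewrite !raiseGD !raiseGZ raiseG_v75 raiseG_v66' raiseG_v66'' raiseG_v66 E57.
  by rewrite !scaler0 add0r !addr0 -!scalerMnr !scalerMnl.
move=> E0; have /esym E2 := E1 _ erefl; rewrite E0 raiseG0 in E2.
have nz2 x : x *+ 2 = 0 :> K -> x = 0.
  by move/eqP; rewrite -mulr_natr mulf_eq0 (negbTE (natr_neq0 charK0 _)) // orbF => /eqP.
have c0 : c = 0.
  have := congr1 (@raiseG K) E2; rewrite raiseG0 raiseGD !raiseGZ raiseG_v75 raiseG_v66.
  by rewrite scaler0 add0r -scalerMnr scalerMnl => /Z/nz2/nz2.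
have b0 : b = 0 by move: E2; rewrite c0 mul0rn scale0r addr0 => /Z/nz2.
have a0 : a = 0.
  have := congr1 (@lowerG K) E0; rewrite b0 c0 !scale0r !addr0 !lowerGD !lowerGZ.
  rewrite lowerG_v66' lowerG_v66'' lowerG0 !scaler0 !addr0 => E3.
  have := congr1 (@raiseG K) E3; rewrite raiseGZ raiseG_v66 raiseG0 -scalerMnr scalerMnl.
  by move/Z/nz2.
move: E0; rewrite a0 b0 c0 !scale0r !add0r => E4.
by have [|-> ->] := @hwv66_free K charK0 d e 0; rewrite ?scale0r ?addr0.
Qed.

Lemma bihomog_tdeg a b (p : KG0) : bihomog a b p -> p \is (a + b).-homog for (weight tdeg).
Proof.
case/andP=> /dhomogP pa /dhomogP pb; apply/dhomogP => m mp.
by rewrite /= weight_tdeg; rewrite -(pa m mp) -(pb m mp).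
Qed.

Lemma R12_gens a b c d e :
  R 12 (a *: v75 + b *: v66 + c *: v57 + d *: v66' + e *: v66'').
Proof.
have J1 := J_v75 charK0; have J2 := J_lowerG charK0 J1; have J3 := J_lowerG charK0 J2.
have J4 := J_v66' charK0; have J5 := J_v66'' charK0; split.
  move: J1 J2 J3 J4 J5; rewrite /J /evalG !comp_mpolyD !comp_mpolyZ.
  by move=> -> -> -> -> ->; rewrite !scaler0 !addr0.
have h1 := bihomog_tdeg (bihomog_v75 K); have h2 := bihomog_tdeg (bihomog_v66 K).
have h3 := bihomog_tdeg (bihomog_v57 K); have h4 := bihomog_tdeg (bihomog_v66' K).
have h5 := bihomog_tdeg (bihomog_v66'' K).
by rewrite !rpredD // rpredZ.
Qed.

Local Notation M := (W K 7 5 * (W K 6 6 * W K 6 6))%type.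

(** W(6,6) is realized on forms of degree 0, so an element of it is its constant coefficient. *)
Definition relation_map (u : M) : KG0 :=
  form75 u.1 + (u.2.1 : {mpoly K[2]})@_0%MM *: v66' + (u.2.2 : {mpoly K[2]})@_0%MM *: v66''.

Lemma relation_map_is_linear : linear relation_map.
Proof.
move=> c u v; rewrite /relation_map /= form75_is_linear !mcoeffD !mcoeffZ.
rewrite !scalerDl -!scalerA !scalerDr [X in X + _ = _]addrACA.
exact: addrACA.
Qed.

HB.instance Definition _ := GRing.isSemilinear.Build K M KG0 _ relation_map
  (GRing.semilinear_linear relation_map_is_linear).

Lemma form0E (f : {mpoly K[2]}) : f \is 0.-homog -> f = f@_0%MM *: 1.
Proof.
by move/form_expand ->; rewrite big_ord1 !expr0 mulr1 mcoeffZ mcoeff1 eqxx mulr1.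
Qed.

Lemma relation_map_quad a b c (f : W K 7 5) (k l : W K 6 6) :
  f = quad a b c :> {mpoly K[2]} ->
  relation_map (f, (k, l)) = a *: v75 + b *: v66 + c *: v57
    + (k : {mpoly K[2]})@_0%MM *: v66' + (l : {mpoly K[2]})@_0%MM *: v66''.
Proof. by move=> fE; rewrite /relation_map /= fE form75_quad. Qed.

Lemma relation_map_inj : injective relation_map.
Proof.
suff ker0 u : relation_map u = 0 -> u = 0.
  move=> u v uv; apply/eqP; rewrite -subr_eq0; apply/eqP; apply: ker0.
  by rewrite linearB /= uv subrr.
case: u => f [k l]; have [a [b [c fE]]] := quadP charK0 (valP f).
rewrite (relation_map_quad k l fE) => /hwv_free[a0 b0 c0 k0 l0].
have f0 : f = 0 by apply: val_inj; rewrite /= fE a0 b0 c0 /quad !mul0rn !scale0r !addr0.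
have kl0 (m : W K 6 6) : (m : {mpoly K[2]})@_0%MM = 0 -> m = 0.
  by move=> m0; apply: val_inj; rewrite /= (form0E (valP m)) m0 scale0r.
by rewrite f0 (kl0 k) // (kl0 l).
Qed.

Lemma quad_homog a b c : (quad a b c : {mpoly K[2]}) \is 2.-homog.
Proof.
have E0 : 'X_0 ^+ 2 = 'X_[mnm2 2 0] :> {mpoly K[2]} by rewrite mpolyX_mnm2 mulr1.
have E1 : 'X_0 * 'X_1 = 'X_[mnm2 1 1] :> {mpoly K[2]} by rewrite mpolyX_mnm2.
have E2 : 'X_1 ^+ 2 = 'X_[mnm2 0 2] :> {mpoly K[2]} by rewrite mpolyX_mnm2 mul1r.
by rewrite /quad E0 E1 E2 !rpredD // rpredZ // dhomogX /= mdeg_mnm2.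
Qed.

Lemma const_homog (c : K) : (c *: 1 : {mpoly K[2]}) \is 0.-homog.
Proof. by rewrite rpredZ // dhomog1. Qed.

Lemma relation_map_image p : R 12 p <-> exists u, relation_map u = p.
Proof.
split=> [/(R12_span charK0)[a [b [c [d [e ->]]]]] | [[f [k l]] <-]].
  exists (DHomog (quad_homog a b c), (DHomog (const_homog d), DHomog (const_homog e))).
  by rewrite (@relation_map_quad a b c) //= !mcoeffZ mcoeff1 eqxx !mulr1.
have [a [b [c fE]]] := quadP charK0 (valP f).
by rewrite (relation_map_quad k l fE); apply: R12_gens.
Qed.

Lemma relation_map_equivariant (g : 'M[K]_2) (u : M) : g \in unitmx ->
  relation_map (actW g u.1, (actW g u.2.1, actW g u.2.2)) = actG g (relation_map u).
Proof.
move/(equivariant_gl2 charK0) => [g75 g66' g66'']; case: u => f [k l].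
rewrite /relation_map /= (actGD g (_ + _)) (actGD g (form75 f)) 2!(actGZ g) g66' g66''.
rewrite (g75 f (valP f)).
(* Substitution fixes constants, so g acts on W(6,6) through det^6 alone. *)
have c0 (m : W K 6 6) : (actF g m)@_0%MM = (m : {mpoly K[2]})@_0%MM.
  by rewrite (form0E (valP m)) actFZ /actF comp_mpoly1 !mcoeffZ mcoeff1 eqxx !mulr1.
rewrite !mcoeffZ !c0 !scalerA; congr (_ + _ *: _ + _ *: _); try exact: mulrC.
have := form75_is_linear (\det g ^+ 5) (actF g f) 0.
have -> : @form75 K 0 = 0 by rewrite /form75 !mcoeff0 !mul0r !scale0r !addr0.
by rewrite !addr0.
Qed.

Lemma relation_map_hw75 : relation_map (hwW K 7 5, 0) = v75.
Proof.
rewrite (@relation_map_quad 1 0 0); last first.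
  by rewrite /= /quad scale1r !mul0rn !scale0r !addr0.
by rewrite /= !mcoeff0 !scale0r !addr0 scale1r.
Qed.

Lemma relation_map_hw66' : relation_map (0, (hwW K 6 6, 0)) = v66'.
Proof.
rewrite (@relation_map_quad 0 0 0); last by rewrite /= /quad !mul0rn !scale0r !addr0.
by rewrite /= mcoeff0 mcoeff1 eqxx !scale0r !add0r addr0 scale1r.
Qed.

Lemma relation_map_hw66'' : relation_map (0, (0, hwW K 6 6)) = v66''.
Proof.
rewrite (@relation_map_quad 0 0 0); last by rewrite /= /quad !mul0rn !scale0r !addr0.
by rewrite /= mcoeff0 mcoeff1 eqxx !scale0r !add0r scale1r.
Qed.

End RelationModule.

Theorem theorem3p1 (K : fieldType) (charK0 : [pchar K] =i pred0) :
  (exists psi : {linear (W K 7 5 * (W K 6 6 * W K 6 6))%type -> {mpoly K[30]}},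
     [/\ injective psi,
         (forall p, R 12 p <-> exists u, psi u = p),
         (forall (g : 'M[K]_2) u, g \in unitmx ->
            psi (actW g u.1, (actW g u.2.1, actW g u.2.2)) = actG g (psi u)) &
         [/\ psi (hwW K 7 5, 0) = v75 K,
             psi (0, (hwW K 6 6, 0)) = v66' K &
             psi (0, (0, hwW K 6 6)) = v66'' K]])
  /\ [/\ is_hwv 7 5 (v75 K), is_hwv 6 6 (v66' K), is_hwv 6 6 (v66'' K) &
         forall c d : K, c *: v66' K + d *: v66'' K = 0 -> c = 0 /\ d = 0]
  /\ [/\ evalG (v75 K) = 0, evalG (v66' K) = 0 & evalG (v66'' K) = 0].
Proof.
split.
  exists (@relation_map K); split.
  - exact: relation_map_inj.
  - exact: relation_map_image.
  - exact: relation_map_equivariant.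
  - by split; [exact: relation_map_hw75 | exact: relation_map_hw66' | exact: relation_map_hw66''].
have free c d e : c *: v66' K + d *: v66'' K + e *: lowerG (v75 K) = 0 ->
    [/\ c = 0, d = 0 & e = 0] by exact: hwv66_free.
split; last first.
  by split; [exact: J_v75 | exact: J_v66' | exact: J_v66''].
split.
- by split; [exact: v75_neq0 | exact: bihomog_v75 | rewrite DeltaGE raiseG_v75].
- split; [apply/eqP => v0 | exact: bihomog_v66' | by rewrite DeltaGE raiseG_v66'].
  have [|/eqP] := free 1 0 0; first by rewrite v0 scaler0 !scale0r !addr0.
  by rewrite oner_eq0.
- split; [apply/eqP => v0 | exact: bihomog_v66'' | by rewrite DeltaGE raiseG_v66''].
  have [|_ /eqP] := free 0 1 0; first by rewrite v0 scaler0 !scale0r !addr0.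
  by rewrite oner_eq0.
- by move=> c d E; have [|-> ->] := free c d 0; rewrite ?scale0r ?addr0.
Qed.
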